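(* Let $\mathcal C=\mathcal C_\pi$ be the continuous cluster category over a field $\mathbb k$. There is a split surjective group homomorphism $$\mathrm{Aut}(\mathcal C)\to \mathrm{Homeo}_+(S^1),$$ sending $\Phi$ to the unique orientation preserving homeomorphism $\varphi$ of $S^1$ such that $\Phi E(x,y)\cong E(\varphi(x),\varphi(y))$ for all $x,y$, whose kernel consists of all automorphisms in $\mathrm{Aut}(\mathcal C)$ which send each object to an isomorphic object.
   Context: Category $\mathcal C$. Let $R=\mathbb k[[t]]$, $S^1=\mathbb R/2\pi\mathbb Z$. $\mathcal P_{S^1}$ is the additive $R$-category with indecomposable objects $P_{[x]}$, $[x]\in S^1$, and a morphism $e^\alpha:P_{[x]}\to P_{[x+\alpha]}$ for every real $\alpha\ge 0$, with $e^\alpha e^\beta=e^{\alpha+\beta}$ and $e^{2\pi}=$ multiplication by $t$; $\mathrm{Hom}(P_{[x]},P_{[y]})$ is the free $R$-module of rank 1 generated by $e^\alpha$ with $\alpha\ge0$ smallest such that $[x+\alpha]=[y]$. $\mathcal F$ is the category of pairs $(V,d)$, $V\in\mathcal P_{S^1}$, $d\in\mathrm{End}(V)$, $d^2=t$, with morphisms those of $\mathcal P_{S^1}$ commuting with $d$; a sequence in $\mathcal F$ is exact if the underlying sequence in $\mathcal P_{S^1}$ is split exact. For $x\le y\le x+2\pi$ put $E(x,y)=\left(P_{[x]}\oplus P_{[y]},\begin{bmatrix}0&e^{x+2\pi-y}\\ e^{y-x}&0\end{bmatrix}\right)$; then $E(x,y)=E(x+2\pi,y+2\pi)$ and $E(x,y)\cong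 E(y,x+2\pi)$. It is known that $\mathcal F$ is a Krull–Schmidt Frobenius category whose indecomposables are the objects isomorphic to some $E(x,y)$ and whose indecomposable projective-injectives are those isomorphic to some $E(x,x)$. $\mathcal C=\mathcal C_\pi$ is the stable category of $\mathcal F$; its objects are taken to be the finite ordered direct sums (including the empty sum $0$) of the objects $E(x,y)$, $x<y<x+2\pi$. Its triangulated structure is Happel's, using for each indecomposable the exact sequence $$E(x,y)\xrightarrow{\binom{1}{-1}}E(y,y)\oplus E(x,x+2\pi)\xrightarrow{(1,1)}E(y,x+2\pi),$$ where for $x\le x'$, $y\le y'$ the entry $1:E(x,y)\to E(x',y')$ denotes the diagonal morphism with entries $e^{x'-x},e^{y'-y}$; so $\Sigma E(x,y)=E(y,x+2\pi)$. Isomorphism classes of indecomposables of $\mathcal C$ are unordered pairs of distinct points of $S^1$, so $E(\varphi(x),\varphi(y))$ is well defined up to isomorphism for a bijection $\varphi$ of $S^1$. $\mathrm{Aut}(\mathcal C)$ is the group of $\mathbb k$-linear automorphisms of $\mathcal C$ that are strictly additive (commute strictly with direct sums of objects and morphisms and preserve $0$) and strictly triangulated (commute strictly with $\Sigma$ and send distinguished triangles to distinguished triangles). $\mathrm{Homeo}_+(S^1)$ is the group of orientation preserving homeomorphisms of $S^1$. *)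

(* Defs.v *)
From HB Require Import structures.
From mathcomp Require Import all_boot all_order all_algebra.
From mathcomp Require Import generic_quotient ring_quotient archimedean.
From mathcomp Require Import all_classical all_reals all_analysis.
From mathcomp Require Import ring lra.
Set Implicit Arguments.
Unset Strict Implicit.
Unset Printing Implicit Defensive.
Import Order.TTheory GRing.Theory Num.Theory.
Import numFieldNormedType.Exports.
Local Open Scope ring_scope.
Local Open Scope quotient_scope.

Section Circle.
Variable R : realType.

Definition tau : R := 2 * pi.

Definition tauZ : {pred R} := fun x => x / tau \is a Num.int.

Lemma tau_gt0 : 0 < tau.
Proof. by rewrite /tau mulr_gt0 ?pi_gt0. Qed.

Lemma tau_neq0 : tau != 0.
Proof. exact: lt0r_neq0 tau_gt0. Qed.

Lemma tauZE x : (x \in tauZ) = (x / tau \is a Num.int).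
Proof. by []. Qed.

Lemma tauZ_closed : zmod_closed tauZ.
Proof.
split=> [|x y]; rewrite !tauZE ?mul0r ?rpred0 // => hx hy.
by rewrite mulrBl rpredB.
Qed.
HB.instance Definition _ := GRing.isZmodClosed.Build R tauZ tauZ_closed.

Definition circle := quotient_topology (Quotient.quot tauZ).
HB.instance Definition _ := Topological.on circle.
HB.instance Definition _ := Quotient.on circle.

Definition cpt (x : R) : circle := \pi_circle x.

Lemma cpt_eq (x y : R) : (cpt x = cpt y) <-> (x - y \in tauZ).
Proof.
split.
  by move=> h; rewrite Quotient.idealrBE; apply/eqP; exact: h.
by rewrite Quotient.idealrBE => /eqP; exact.
Qed.

Lemma cptK (p : circle) : cpt (repr p) = p.
Proof. exact: reprK. Qed.

(* the representative of x modulo 2 pi lying in [0, 2 pi[ *)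
Definition cfrac (x : R) : R := x - tau * (Num.floor (x / tau))%:~R.

Lemma cfrac_itv x : 0 <= cfrac x < tau.
Proof.
have /andP[h1 h2] := floor_itv (x / tau).
rewrite /cfrac subr_ge0 mulrC -ler_pdivlMr ?tau_gt0 // h1 /=.
rewrite ltrBlDr -{1}[tau]mul1r -mulrDl -ltr_pdivrMr ?tau_gt0 //.
by rewrite addrC; move: h2; rewrite intrD.
Qed.

Lemma cfracE x y : x - y \in tauZ -> cfrac x = cfrac y.
Proof.
rewrite tauZE => h; rewrite /cfrac.
have -> : x / tau = (x - y) / tau + y / tau by rewrite -mulrDl subrK.
rewrite floorDzr // intrD mulrDr opprD addrA; congr (_ - _).
by rewrite floorK // mulrC divfK ?tau_neq0 // opprB addrC subrK.
Qed.

Lemma cfrac_tauZ x : x - cfrac x \in tauZ.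
Proof.
rewrite /cfrac opprB addrC subrK tauZE mulrC mulrA mulVf ?tau_neq0 //.
by rewrite mul1r intr_int.
Qed.

Lemma cfrac_id x : 0 <= x < tau -> cfrac x = x.
Proof.
move=> /andP[h1 h2]; rewrite /cfrac (@floor_def _ _ 0) ?mulr0 ?subr0 //.
by rewrite add0r divr_ge0 ?(ltW tau_gt0) //= ltr_pdivrMr ?tau_gt0 // mul1r.
Qed.

(* the smallest a >= 0 such that [x + a] = q, where p = [x] *)
Definition arc (p q : circle) : R := cfrac (repr q - repr p).

Lemma arc_itv p q : 0 <= arc p q < tau.
Proof. exact: cfrac_itv. Qed.

Lemma arc_ge0 p q : 0 <= arc p q.
Proof. by have /andP[] := arc_itv p q. Qed.

Lemma arcE x y : arc (cpt x) (cpt y) = cfrac (y - x).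
Proof.
apply: cfracE.
have hx : repr (cpt x) - x \in tauZ by apply/cpt_eq; rewrite cptK.
have hy : repr (cpt y) - y \in tauZ by apply/cpt_eq; rewrite cptK.
have -> : repr (cpt y) - repr (cpt x) - (y - x) =
  (repr (cpt y) - y) - (repr (cpt x) - x) by ring.
by rewrite rpredB.
Qed.

Lemma arcP p q : cpt (repr p + arc p q) = q.
Proof.
rewrite -[RHS]cptK; apply/cpt_eq; rewrite -opprB rpredN.
by rewrite opprD addrA cfrac_tauZ.
Qed.

Lemma arcpp p : arc p p = 0.
Proof. by rewrite /arc subrr cfrac_id // lexx tau_gt0. Qed.

Lemma arc_gt0 p q : p != q -> 0 < arc p q.
Proof.
move=> pq; rewrite lt0r arc_ge0 andbT; apply: contra_neq pq => h.
by rewrite -[RHS](arcP p) h addr0 cptK.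
Qed.

(* For a >= 0, e^a = t ^ (wind a) e^(cfrac a), because e^(2 pi) = t; hence
   e^(arc q r) e^(arc p q) = t ^ (carry p q r) e^(arc p r). *)
Definition wind (a : R) : nat := Num.truncn (a / tau).
Definition carry (p q r : circle) : nat := wind (arc p q + arc q r).

Lemma windE a : 0 <= a -> tau * (wind a)%:R = a - cfrac a.
Proof.
move=> a0; rewrite /cfrac opprB addrC subrK /wind truncn_floor.
have h : 0 <= a / tau by rewrite divr_ge0 // ltW ?tau_gt0.
rewrite h; congr (_ * _); rewrite -floor_ge0 in h.
by rewrite natr_absz ger0_norm.
Qed.

Lemma carryE p q r : tau * (carry p q r)%:R = arc p q + arc q r - arc p r.
Proof.
rewrite windE; last by apply: addr_ge0; apply: arc_ge0.
suff -> : cfrac (arc p q + arc q r) = cfrac (repr r - repr p) by [].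
apply: cfracE; rewrite -opprB rpredN.
have -> : repr r - repr p - (arc p q + arc q r) =
  (repr q - repr p - cfrac (repr q - repr p)) +
  (repr r - repr q - cfrac (repr r - repr q)) by rewrite /arc; ring.
by rewrite rpredD ?cfrac_tauZ.
Qed.

Lemma tau_natI m n : tau * m%:R = tau * n%:R -> m = n.
Proof. by move/(mulfI tau_neq0)/eqP; rewrite eqr_nat => /eqP. Qed.

Lemma carrypp p q : carry p p q = 0%N.
Proof. by apply: tau_natI; rewrite carryE arcpp mulr0 add0r subrr. Qed.

Lemma carry0 p q : carry p q q = 0%N.
Proof. by apply: tau_natI; rewrite carryE arcpp mulr0 addr0 subrr. Qed.

Lemma carryA p q r s :
  (carry p q r + carry p r s = carry q r s + carry p q s)%N.
Proof.
by apply: tau_natI; rewrite !natrD !mulrDr !carryE; ring.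
Qed.

Lemma wind_carry x a b : 0 <= a -> 0 <= b ->
  (carry (cpt x) (cpt (x + a)) (cpt (x + a + b)) + wind a + wind b =
   wind (a + b))%N.
Proof.
move=> a0 b0; apply: tau_natI; rewrite !natrD !mulrDr carryE !arcE.
rewrite !windE ?addr_ge0 //.
have -> : x + a - x = a by ring.
have -> : x + a + b - (x + a) = b by ring.
have -> : x + a + b - x = a + b by ring.
by ring.
Qed.

End Circle.

Section PowerSeries.
Variable k : fieldType.

(* k[[t]]; fcoef f n is the coefficient of t^n *)
Record fps := FPS { fcoef : nat -> k }.
HB.instance Definition _ := gen_eqMixin fps.
HB.instance Definition _ := gen_choiceMixin fps.

Implicit Types f g h : fps.

Lemma fpsP f g : (forall n, fcoef f n = fcoef g n) -> f = g.
Proof. by case: f g => [f] [g] /= fg; congr FPS; apply/funext. Qed.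

Definition fps0 := FPS (fun=> 0).
Definition fps1 := FPS (fun n => (n == 0%N)%:R).
Definition fpsX := FPS (fun n => (n == 1%N)%:R).
Definition fpsD f g := FPS (fun n => fcoef f n + fcoef g n).
Definition fpsN f := FPS (fun n => - fcoef f n).
Definition fpsZ (a : k) f := FPS (fun n => a * fcoef f n).
Definition fpsM f g := FPS (fun n => \sum_(i < n.+1) fcoef f i * fcoef g (n - i)%N).

Lemma fpsDA : associative fpsD.
Proof. by move=> f g h; apply: fpsP => n /=; rewrite addrA. Qed.
Lemma fpsDC : commutative fpsD.
Proof. by move=> f g; apply: fpsP => n /=; rewrite addrC. Qed.
Lemma fps0D : left_id fps0 fpsD.
Proof. by move=> f; apply: fpsP => n /=; rewrite add0r. Qed.
Lemma fpsND : left_inverse fps0 fpsN fpsD.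
Proof. by move=> f; apply: fpsP => n /=; rewrite addNr. Qed.
HB.instance Definition _ := GRing.isZmodule.Build fps fpsDA fpsDC fps0D fpsND.

Let trunc N f : {poly k} := \poly_(i < N) fcoef f i.

Let fpsM_trunc N f g n : (n < N)%N ->
  fcoef (fpsM f g) n = (trunc N f * trunc N g)`_n.
Proof.
move=> nN; rewrite coefM; apply: eq_bigr => -[i /= lin] _.
by rewrite !coef_poly (leq_ltn_trans _ nN) // (leq_ltn_trans _ nN) ?leq_subr.
Qed.

Lemma fpsMC : commutative fpsM.
Proof. by move=> f g; apply: fpsP => n; rewrite !(@fpsM_trunc n.+1) // mulrC. Qed.

Let truncM N f g n : (n < N)%N ->
  (trunc N (fpsM f g))`_n = (trunc N f * trunc N g)`_n.
Proof. by move=> nN; rewrite coef_poly nN (fpsM_trunc _ _ nN). Qed.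

Lemma fpsMA : associative fpsM.
Proof.
move=> f g h; apply: fpsP => n; rewrite !(@fpsM_trunc n.+1) //.
have -> : (trunc n.+1 f * trunc n.+1 (fpsM g h))`_n =
    (trunc n.+1 f * (trunc n.+1 g * trunc n.+1 h))`_n.
  rewrite !coefM; apply: eq_bigr => -[i /= lin] _.
  by rewrite truncM // ltnS leq_subr.
rewrite mulrA !coefM; apply: eq_bigr => -[i /= lin] _.
by rewrite truncM.
Qed.

Lemma fps1M : left_id fps1 fpsM.
Proof.
move=> f; apply: fpsP => n /=; rewrite big_ord_recl /= mul1r subn0.
by rewrite big1 ?addr0 // => i _; rewrite mul0r.
Qed.

Lemma fpsMDl : left_distributive fpsM fpsD.
Proof.
move=> f g h; apply: fpsP => n /=; rewrite -big_split /=.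
by apply: eq_bigr => i _; rewrite mulrDl.
Qed.

Lemma fps1_neq0 : fps1 != fps0.
Proof.
by apply/eqP => /(congr1 (fcoef^~ 0%N))/eqP; rewrite /= oner_eq0.
Qed.

HB.instance Definition _ := GRing.Zmodule_isComNzRing.Build fps
  fpsMA fpsMC fps1M fpsMDl fps1_neq0.

Lemma fpsZA a b f : fpsZ a (fpsZ b f) = fpsZ (a * b) f.
Proof. by apply: fpsP => n /=; rewrite mulrA. Qed.
Lemma fps1Z : left_id 1 fpsZ.
Proof. by move=> f; apply: fpsP => n /=; rewrite mul1r. Qed.
Lemma fpsZDr : right_distributive fpsZ +%R.
Proof. by move=> a f g; apply: fpsP => n /=; rewrite mulrDr. Qed.
Lemma fpsZDl f : {morph fpsZ^~ f : a b / a + b}.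
Proof. by move=> a b; apply: fpsP => n /=; rewrite mulrDl. Qed.
HB.instance Definition _ := GRing.Zmodule_isLmodule.Build k fps
  fpsZA fps1Z fpsZDr fpsZDl.

Lemma fpsZAl a f g : a *: (f * g) = (a *: f) * g.
Proof.
apply: fpsP => n /=; rewrite big_distrr /=.
by apply: eq_bigr => i _; rewrite mulrA.
Qed.
HB.instance Definition _ := GRing.Lmodule_isLalgebra.Build k fps fpsZAl.

Lemma fpsZAr a f g : a *: (f * g) = f * (a *: g).
Proof. by rewrite mulrC fpsZAl mulrC. Qed.
HB.instance Definition _ := GRing.Lalgebra_isAlgebra.Build k fps fpsZAr.

End PowerSeries.

Section CategoryF.
Variables (R : realType) (k : fieldType).

(* The finite family (p_i) stands for the direct sum of the P_(p_i). *)
Record pobj := PObj { pidx : finType; ppt : pidx -> circle R }.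

(* Hom(P_p, P_q) is identified with k[[t]] through its generator e^(arc p q);
   the entry f (j, i) is the component from the i-th to the j-th summand. *)
Definition phom (V W : pobj) := {ffun pidx W * pidx V -> fps k}.
HB.instance Definition _ (V W : pobj) := GRing.Lmodule.on (phom V W).

Definition pid (V : pobj) : phom V V := [ffun z => (z.1 == z.2)%:R].

(* The matrix product, corrected by the power of t that relates the product of
   two generators to the generator. *)
Definition pcomp (U V W : pobj) (g : phom V W) (f : phom U V) : phom U W :=
  [ffun z => \sum_j fpsX k ^+ carry (ppt z.2) (ppt j) (ppt z.1) *
                    (g (z.1, j) * f (j, z.2))].

Fact pcompA_aux (S : comNzRingType) (a b c d x y z : S) :
  a * b = c * d -> a * (x * (b * (y * z))) = c * (d * (x * y) * z).
Proof.
move=> e; have -> : a * (x * (b * (y * z))) = a * b * (x * y * z) by ring.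
by rewrite e; ring.
Qed.

Lemma pcompA (U V W Z : pobj) (h : phom W Z) (g : phom V W) (f : phom U V) :
  pcomp h (pcomp g f) = pcomp (pcomp h g) f.
Proof.
apply/ffunP => -[z u]; rewrite !ffunE /=.
under eq_bigr => w _ do rewrite ffunE mulr_sumr mulr_sumr.
rewrite exchange_big /=; apply: eq_bigr => v _.
rewrite ffunE mulr_suml mulr_sumr; apply: eq_bigr => w _ /=.
apply: pcompA_aux; rewrite -!exprD; congr (_ ^+ _).
by rewrite addnC carryA addnC.
Qed.

Lemma pcomp1l (U V : pobj) (f : phom U V) : pcomp (pid V) f = f.
Proof.
apply/ffunP => -[v u]; rewrite !ffunE /= (bigD1 v) //= big1 => [|w wv].
  by rewrite ffunE eqxx mul1r carry0 expr0 mul1r addr0.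
by rewrite ffunE /= eq_sym (negPf wv) mul0r mulr0.
Qed.

Lemma pcomp1r (U V : pobj) (f : phom U V) : pcomp f (pid U) = f.
Proof.
apply/ffunP => -[v u]; rewrite !ffunE /= (bigD1 u) //= big1 => [|w wv].
  by rewrite ffunE eqxx mulr1 carrypp expr0 mul1r addr0.
by rewrite ffunE /= (negPf wv) !mulr0.
Qed.

Lemma pcompDl (U V W : pobj) (g g' : phom V W) (f : phom U V) :
  pcomp (g + g') f = pcomp g f + pcomp g' f.
Proof.
apply/ffunP => -[v u]; rewrite !ffunE /= -big_split /=.
by apply: eq_bigr => w _; rewrite ffunE mulrDl mulrDr.
Qed.

Lemma pcompDr (U V W : pobj) (g : phom V W) (f f' : phom U V) :
  pcomp g (f + f') = pcomp g f + pcomp g f'.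
Proof.
apply/ffunP => -[v u]; rewrite !ffunE /= -big_split /=.
by apply: eq_bigr => w _; rewrite ffunE !mulrDr.
Qed.

Lemma pcompZl (U V W : pobj) a (g : phom V W) (f : phom U V) :
  pcomp (a *: g) f = a *: pcomp g f.
Proof.
apply/ffunP => -[v u]; rewrite !ffunE /= scaler_sumr.
by apply: eq_bigr => w _; rewrite ffunE scalerAr scalerAl.
Qed.

Lemma pcompZr (U V W : pobj) a (g : phom V W) (f : phom U V) :
  pcomp g (a *: f) = a *: pcomp g f.
Proof.
apply/ffunP => -[v u]; rewrite !ffunE /= scaler_sumr.
by apply: eq_bigr => w _; rewrite ffunE !scalerAr.
Qed.

Definition ptmul (V W : pobj) (f : phom V W) : phom V W :=
  [ffun z => fpsX k * f z].

Record fobj := FObj {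
  fV : pobj;
  fd : phom fV fV;
  fdP : pcomp fd fd = ptmul (pid fV) }.

Definition fcommute (A B : fobj) : {pred phom (fV A) (fV B)} :=
  fun f => pcomp f (fd A) == pcomp (fd B) f.

Lemma fcommute_closed (A B : fobj) : submod_closed (@fcommute A B).
Proof.
split=> [|a f g].
  by rewrite unfold_in /fcommute -(scale0r 0) pcompZl pcompZr !scale0r.
rewrite !unfold_in /fcommute => /eqP hf /eqP hg.
by rewrite pcompDl pcompDr pcompZl pcompZr hf hg.
Qed.
HB.instance Definition _ (A B : fobj) :=
  GRing.isSubmodClosed.Build k (phom (fV A) (fV B)) (@fcommute A B)
    (@fcommute_closed A B).

Record fhom (A B : fobj) := FHom {
  fhom_val :> phom (fV A) (fV B);
  _ : fhom_val \in @fcommute A B }.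
HB.instance Definition _ (A B : fobj) := [isSub for @fhom_val A B].
HB.instance Definition _ (A B : fobj) := [Choice of fhom A B by <:].
HB.instance Definition _ (A B : fobj) :=
  [SubChoice_isSubLmodule of fhom A B by <:].

Lemma fhomP (A B : fobj) (f : fhom A B) : pcomp f (fd A) = pcomp (fd B) f.
Proof. by apply/eqP; case: f. Qed.

Lemma fid_commute (A : fobj) : pid (fV A) \in @fcommute A A.
Proof. by rewrite unfold_in /fcommute pcomp1l pcomp1r. Qed.

Definition fid (A : fobj) : fhom A A := FHom (fid_commute A).

Lemma fcomp_commute (A B C : fobj) (g : fhom B C) (f : fhom A B) :
  pcomp g f \in @fcommute A C.
Proof. by rewrite unfold_in /fcommute -pcompA fhomP pcompA fhomP pcompA. Qed.

Definition fcomp (A B C : fobj) (g : fhom B C) (f : fhom A B) : fhom A C :=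
  FHom (fcomp_commute g f).

Lemma fcompA (A B C D : fobj) (h : fhom C D) (g : fhom B C) (f : fhom A B) :
  fcomp h (fcomp g f) = fcomp (fcomp h g) f.
Proof. by apply/val_inj; rewrite /= pcompA. Qed.
Lemma fcomp1l (A B : fobj) (f : fhom A B) : fcomp (fid B) f = f.
Proof. by apply/val_inj; rewrite /= pcomp1l. Qed.
Lemma fcomp1r (A B : fobj) (f : fhom A B) : fcomp f (fid A) = f.
Proof. by apply/val_inj; rewrite /= pcomp1r. Qed.
Lemma fcompDl (A B C : fobj) (g g' : fhom B C) (f : fhom A B) :
  fcomp (g + g') f = fcomp g f + fcomp g' f.
Proof. by apply/val_inj; rewrite /= pcompDl. Qed.
Lemma fcompDr (A B C : fobj) (g : fhom B C) (f f' : fhom A B) :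
  fcomp g (f + f') = fcomp g f + fcomp g f'.
Proof. by apply/val_inj; rewrite /= pcompDr. Qed.
Lemma fcompZl (A B C : fobj) a (g : fhom B C) (f : fhom A B) :
  fcomp (a *: g) f = a *: fcomp g f.
Proof. by apply/val_inj; rewrite /= pcompZl. Qed.
Lemma fcompZr (A B C : fobj) a (g : fhom B C) (f : fhom A B) :
  fcomp g (a *: f) = a *: fcomp g f.
Proof. by apply/val_inj; rewrite /= pcompZr. Qed.
Lemma fcomp0l (A B C : fobj) (f : fhom A B) : fcomp (0 : fhom B C) f = 0.
Proof. by rewrite -(scale0r 0) fcompZl scale0r. Qed.
Lemma fcomp0r (A B C : fobj) (g : fhom B C) : fcomp g (0 : fhom A B) = 0.
Proof. by rewrite -(scale0r 0) fcompZr scale0r. Qed.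

Lemma fcompNl (A B C : fobj) (g : fhom B C) (f : fhom A B) :
  fcomp (- g) f = - fcomp g f.
Proof. by apply/eqP; rewrite -addr_eq0 -fcompDl addNr fcomp0l. Qed.
Lemma fcompNr (A B C : fobj) (g : fhom B C) (f : fhom A B) :
  fcomp g (- f) = - fcomp g f.
Proof. by apply/eqP; rewrite -addr_eq0 -fcompDr addNr fcomp0r. Qed.

Definition pzero : pobj := @PObj void (fun v => match v with end).
Lemma fzero_subproof : pcomp (0 : phom pzero pzero) 0 = ptmul (pid pzero).
Proof. by apply/ffunP => -[[]]. Qed.
Definition fzero : fobj := FObj fzero_subproof.

Definition psum (V W : pobj) : pobj :=
  @PObj (pidx V + pidx W)%type
    (fun i => match i with inl a => ppt a | inr b => ppt b end).

Definition pdiag (V V' W W' : pobj) (f : phom V V') (g : phom W W') :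
    phom (psum V W) (psum V' W') :=
  [ffun z => match z with
             | (inl a, inl b) => f (a, b)
             | (inr a, inr b) => g (a, b)
             | _ => 0
             end].

Definition pinl (V W : pobj) : phom V (psum V W) :=
  [ffun z => if z.1 is inl a then pid V (a, z.2) else 0].
Definition pinr (V W : pobj) : phom W (psum V W) :=
  [ffun z => if z.1 is inr a then pid W (a, z.2) else 0].
Definition pprl (V W : pobj) : phom (psum V W) V :=
  [ffun z => if z.2 is inl a then pid V (z.1, a) else 0].
Definition pprr (V W : pobj) : phom (psum V W) W :=
  [ffun z => if z.2 is inr a then pid W (z.1, a) else 0].



Lemma pcompE (U V W : pobj) (g : phom V W) (f : phom U V) w u :
  pcomp g f (w, u) = \sum_j fpsX k ^+ carry (ppt u) (ppt j) (ppt w) *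
                     (g (w, j) * f (j, u)).
Proof. by rewrite ffunE. Qed.

Lemma pcomp0 (U V W : pobj) (g : phom V W) (f : phom U V) w u :
  (forall j, g (w, j) * f (j, u) = 0) -> pcomp g f (w, u) = 0.
Proof. by move=> h; rewrite pcompE big1 // => j _; rewrite h mulr0. Qed.

Lemma pdiag_comp (V V' V'' W W' W'' : pobj) (f' : phom V' V'') (f : phom V V')
    (g' : phom W' W'') (g : phom W W') :
  pcomp (pdiag f' g') (pdiag f g) = pdiag (pcomp f' f) (pcomp g' g).
Proof.
apply/ffunP => -[[a|a] [b|b]]; rewrite pcompE big_sumType /= [RHS]ffunE.
- rewrite [X in _ + X]big1 ?addr0 => [|i _]; last by rewrite !ffunE mulr0 mulr0.
  by rewrite ffunE; apply: eq_bigr => i _; rewrite !ffunE /= ?ffunE.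
- by rewrite !big1 ?addr0 // => i _; rewrite !ffunE ?mul0r ?mulr0.
- by rewrite !big1 ?addr0 // => i _; rewrite !ffunE ?mul0r ?mulr0.
- rewrite [X in X + _]big1 ?add0r => [|i _]; last by rewrite !ffunE mulr0 mulr0.
  by rewrite ffunE; apply: eq_bigr => i _; rewrite !ffunE /= ?ffunE.
Qed.

Lemma pdiag_inl (V V' W W' : pobj) (f : phom V V') (g : phom W W') :
  pcomp (pdiag f g) (pinl V W) = pcomp (pinl V' W') f.
Proof.
apply/ffunP => -[[a|a] b].
  rewrite [RHS](_ : _ = pcomp (pid V') f (a, b)); last first.
    by rewrite !pcompE; apply: eq_bigr => i _; rewrite !ffunE /= ?ffunE.
  rewrite pcomp1l -{2}(pcomp1r f) !pcompE big_sumType /=.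
  rewrite [X in _ + X]big1 ?addr0 => [|i _]; last by rewrite !ffunE !mulr0.
  by apply: eq_bigr => i _; rewrite !ffunE /= ?ffunE.
rewrite [RHS]pcomp0 => [|j]; last by rewrite ffunE mul0r.
by rewrite pcomp0 // => -[j|j]; rewrite !ffunE ?mul0r ?mulr0.
Qed.

Lemma pdiag_inr (V V' W W' : pobj) (f : phom V V') (g : phom W W') :
  pcomp (pdiag f g) (pinr V W) = pcomp (pinr V' W') g.
Proof.
apply/ffunP => -[[a|a] b].
  rewrite [RHS]pcomp0 => [|j]; last by rewrite ffunE mul0r.
  by rewrite pcomp0 // => -[j|j]; rewrite !ffunE ?mul0r ?mulr0.
rewrite [RHS](_ : _ = pcomp (pid W') g (a, b)); last first.
  by rewrite !pcompE; apply: eq_bigr => i _; rewrite !ffunE /= ?ffunE.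
rewrite pcomp1l -{2}(pcomp1r g) !pcompE big_sumType /=.
rewrite [X in X + _]big1 ?add0r => [|i _]; last by rewrite !ffunE !mulr0.
by apply: eq_bigr => i _; rewrite !ffunE /= ?ffunE.
Qed.

Lemma pprl_diag (V V' W W' : pobj) (f : phom V V') (g : phom W W') :
  pcomp (pprl V' W') (pdiag f g) = pcomp f (pprl V W).
Proof.
apply/ffunP => -[a [b|b]].
  rewrite [RHS](_ : _ = pcomp f (pid V) (a, b)); last first.
    by rewrite !pcompE; apply: eq_bigr => i _; rewrite !ffunE /= ?ffunE.
  rewrite pcomp1r -{2}(pcomp1l f) !pcompE big_sumType /=.
  rewrite [X in _ + X]big1 ?addr0 => [|i _]; last by rewrite !ffunE !mulr0.
  by apply: eq_bigr => i _; rewrite !ffunE /= ?ffunE.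
rewrite [RHS]pcomp0 => [|j]; last by rewrite [X in _ * X]ffunE mulr0.
by rewrite pcomp0 // => -[j|j]; rewrite !ffunE ?mul0r ?mulr0.
Qed.

Lemma pprr_diag (V V' W W' : pobj) (f : phom V V') (g : phom W W') :
  pcomp (pprr V' W') (pdiag f g) = pcomp g (pprr V W).
Proof.
apply/ffunP => -[a [b|b]].
  rewrite [RHS]pcomp0 => [|j]; last by rewrite [X in _ * X]ffunE mulr0.
  by rewrite pcomp0 // => -[j|j]; rewrite !ffunE ?mul0r ?mulr0.
rewrite [RHS](_ : _ = pcomp g (pid W) (a, b)); last first.
  by rewrite !pcompE; apply: eq_bigr => i _; rewrite !ffunE /= ?ffunE.
rewrite pcomp1r -{2}(pcomp1l g) !pcompE big_sumType /=.
rewrite [X in X + _]big1 ?add0r => [|i _]; last by rewrite !ffunE !mulr0 ?mul0r ?mulr0.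
by apply: eq_bigr => i _; rewrite !ffunE /= ?ffunE.
Qed.

Lemma pprl_inl (V W : pobj) : pcomp (pprl V W) (pinl V W) = pid V.
Proof.
rewrite -[RHS]pcomp1l; apply/ffunP => -[a b]; rewrite !pcompE big_sumType /=.
rewrite [X in _ + X]big1 ?addr0 => [|i _]; last by rewrite !ffunE !mulr0.
by apply: eq_bigr => i _; rewrite !ffunE /= ?ffunE.
Qed.

Lemma pprr_inr (V W : pobj) : pcomp (pprr V W) (pinr V W) = pid W.
Proof.
rewrite -[RHS]pcomp1l; apply/ffunP => -[a b]; rewrite !pcompE big_sumType /=.
rewrite [X in X + _]big1 ?add0r => [|i _]; last by rewrite !ffunE !mulr0.
by apply: eq_bigr => i _; rewrite !ffunE /= ?ffunE.
Qed.

Lemma pprl_inr (V W : pobj) : pcomp (pprl V W) (pinr V W) = 0.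
Proof.
apply/ffunP => -[a b]; rewrite pcomp0 ?ffunE // => -[j|j];
  by rewrite !ffunE ?mul0r ?mulr0.
Qed.

Lemma pprr_inl (V W : pobj) : pcomp (pprr V W) (pinl V W) = 0.
Proof.
apply/ffunP => -[a b]; rewrite pcomp0 ?ffunE // => -[j|j];
  by rewrite !ffunE ?mul0r ?mulr0.
Qed.

Lemma psum_id (V W : pobj) :
  pcomp (pinl V W) (pprl V W) + pcomp (pinr V W) (pprr V W) = pid (psum V W).
Proof.
apply/ffunP => -[[a|a] [b|b]]; rewrite ffunE.
- rewrite [X in _ + X]pcomp0 ?addr0 => [|j]; last by rewrite !ffunE mulr0.
  rewrite [RHS](_ : _ = pid V (a, b)); last by rewrite !ffunE /= ?ffunE.
  by rewrite -(pcomp1l (pid V)) !pcompE; apply: eq_bigr => i _; rewrite !ffunE /= ?ffunE.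
- by rewrite !pcomp0 ?addr0 => [|j|j]; rewrite !ffunE ?mul0r ?mulr0.
- by rewrite !pcomp0 ?addr0 => [|j|j]; rewrite !ffunE ?mul0r ?mulr0.
- rewrite [X in X + _]pcomp0 ?add0r => [|j]; last by rewrite !ffunE mulr0.
  rewrite [RHS](_ : _ = pid W (a, b)); last by rewrite !ffunE /= ?ffunE.
  by rewrite -(pcomp1l (pid W)) !pcompE; apply: eq_bigr => i _; rewrite !ffunE /= ?ffunE.
Qed.

Lemma fsum_subproof (A B : fobj) :
  pcomp (pdiag (fd A) (fd B)) (pdiag (fd A) (fd B)) =
  ptmul (pid (psum (fV A) (fV B))).
Proof.
rewrite pdiag_comp !fdP; apply/ffunP => -[[a|a] [b|b]];
  by rewrite !ffunE /= ?mulr0.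
Qed.

Definition fsum (A B : fobj) : fobj := FObj (fsum_subproof A B).

Lemma finl_commute A B : pinl (fV A) (fV B) \in @fcommute A (fsum A B).
Proof. by rewrite unfold_in /fcommute pdiag_inl. Qed.
Lemma finr_commute A B : pinr (fV A) (fV B) \in @fcommute B (fsum A B).
Proof. by rewrite unfold_in /fcommute pdiag_inr. Qed.
Lemma fprl_commute A B : pprl (fV A) (fV B) \in @fcommute (fsum A B) A.
Proof. by rewrite unfold_in /fcommute pprl_diag. Qed.
Lemma fprr_commute A B : pprr (fV A) (fV B) \in @fcommute (fsum A B) B.
Proof. by rewrite unfold_in /fcommute pprr_diag. Qed.

Definition finl A B : fhom A (fsum A B) := FHom (finl_commute A B).
Definition finr A B : fhom B (fsum A B) := FHom (finr_commute A B).
Definition fprl A B : fhom (fsum A B) A := FHom (fprl_commute A B).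
Definition fprr A B : fhom (fsum A B) B := FHom (fprr_commute A B).

Lemma fprl_inl A B : fcomp (fprl A B) (finl A B) = fid A.
Proof. by apply/val_inj; rewrite /= pprl_inl. Qed.
Lemma fprr_inr A B : fcomp (fprr A B) (finr A B) = fid B.
Proof. by apply/val_inj; rewrite /= pprr_inr. Qed.
Lemma fprl_inr A B : fcomp (fprl A B) (finr A B) = 0.
Proof. by apply/val_inj; rewrite /= pprl_inr. Qed.
Lemma fprr_inl A B : fcomp (fprr A B) (finl A B) = 0.
Proof. by apply/val_inj; rewrite /= pprr_inl. Qed.
Lemma fsum_id A B :
  fcomp (finl A B) (fprl A B) + fcomp (finr A B) (fprr A B) = fid (fsum A B).
Proof. by apply/val_inj; rewrite /= psum_id. Qed.

Definition fsumhom (A A' B B' : fobj) (f : fhom A A') (g : fhom B B') :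
    fhom (fsum A B) (fsum A' B') :=
  fcomp (finl A' B') (fcomp f (fprl A B)) +
  fcomp (finr A' B') (fcomp g (fprr A B)).

(* the underlying sequence in the category of the P_[x] is split exact *)
Definition fexact (A B C : fobj) (f : fhom A B) (g : fhom B C) : Prop :=
  exists (r : phom (fV B) (fV A)) (s : phom (fV C) (fV B)),
    [/\ pcomp r f = pid (fV A), pcomp g s = pid (fV C), pcomp g f = 0 &
        pcomp f r + pcomp s g = pid (fV B)].

Definition fprojective (Q : fobj) : Prop :=
  forall (A B C : fobj) (f : fhom A B) (g : fhom B C), fexact f g ->
  forall h : fhom Q C, exists l : fhom Q B, fcomp g l = h.

Definition finjective (Q : fobj) : Prop :=
  forall (A B C : fobj) (f : fhom A B) (g : fhom B C), fexact f g ->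
  forall h : fhom A Q, exists l : fhom B Q, fcomp l f = h.

Lemma fprojective_sum Q Q' :
  fprojective Q -> fprojective Q' -> fprojective (fsum Q Q').
Proof.
move=> pQ pQ' A B C f g e h.
have [l1 h1] := pQ _ _ _ _ _ e (fcomp h (finl Q Q')).
have [l2 h2] := pQ' _ _ _ _ _ e (fcomp h (finr Q Q')).
exists (fcomp l1 (fprl Q Q') + fcomp l2 (fprr Q Q')).
by rewrite fcompDr !fcompA h1 h2 -!fcompA -fcompDr fsum_id fcomp1r.
Qed.

Lemma finjective_sum Q Q' :
  finjective Q -> finjective Q' -> finjective (fsum Q Q').
Proof.
move=> pQ pQ' A B C f g e h.
have [l1 h1] := pQ _ _ _ _ _ e (fcomp (fprl Q Q') h).
have [l2 h2] := pQ' _ _ _ _ _ e (fcomp (fprr Q Q') h).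
exists (fcomp (finl Q Q') l1 + fcomp (finr Q Q') l2).
by rewrite fcompDl -!fcompA h1 h2 !fcompA -fcompDl fsum_id fcomp1l.
Qed.

(* The morphisms that factor through a projective-injective object form a
   subspace because such objects are closed under direct sums. *)
Definition fnull (A B : fobj) : {pred fhom A B} := fun f =>
  `[< exists (Q : fobj) (a : fhom A Q) (b : fhom Q B),
      [/\ fprojective Q, finjective Q & f = fcomp b a] >].

Lemma fnullP (A B : fobj) (f : fhom A B) :
  reflect (exists (Q : fobj) (a : fhom A Q) (b : fhom Q B),
    [/\ fprojective Q, finjective Q & f = fcomp b a]) (f \in @fnull A B).
Proof. exact: asboolP. Qed.

Lemma fzero_ext (A : fobj) (f : fhom A fzero) : f = 0.
Proof. by apply/val_inj/ffunP => -[[]]. Qed.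
Lemma fzero_ext' (A : fobj) (f : fhom fzero A) : f = 0.
Proof. by apply/val_inj/ffunP => -[? []]. Qed.

Lemma fzero_projective : fprojective fzero.
Proof. by move=> A B C f g e h; exists 0; rewrite fcomp0r (fzero_ext' h). Qed.
Lemma fzero_injective : finjective fzero.
Proof. by move=> A B C f g e h; exists 0; rewrite fcomp0l (fzero_ext h). Qed.

Fact fnullZ (A B : fobj) (c : k) (f : fhom A B) :
  f \in @fnull A B -> c *: f \in @fnull A B.
Proof.
move=> /fnullP[Q [a [b [pQ iQ ->]]]]; apply/fnullP; exists Q, a, (c *: b).
by split=> //; rewrite fcompZl.
Qed.

Fact fnullD (A B : fobj) (f g : fhom A B) :
  f \in @fnull A B -> g \in @fnull A B -> f + g \in @fnull A B.
Proof.
move=> /fnullP[Q [a [b [pQ iQ ->]]]] /fnullP[Q' [a' [b' [pQ' iQ' ->]]]].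
apply/fnullP; exists (fsum Q Q').
exists (fcomp (finl Q Q') a + fcomp (finr Q Q') a').
exists (fcomp b (fprl Q Q') + fcomp b' (fprr Q Q')); split.
- exact: fprojective_sum.
- exact: finjective_sum.
rewrite fcompDl !fcompDr -!fcompA.
rewrite (fcompA (fprl Q Q')) (fcompA (fprl Q Q')) fprl_inl fprl_inr.
rewrite (fcompA (fprr Q Q')) (fcompA (fprr Q Q')) fprr_inl fprr_inr.
by rewrite !fcomp1l !fcomp0l !fcomp0r addr0 add0r.
Qed.

Lemma fnull_closed (A B : fobj) : submod_closed (@fnull A B).
Proof.
split=> [|c f g hf hg]; last by apply: fnullD => //; exact: fnullZ.
apply/fnullP; exists fzero, 0, 0; split; last by rewrite fcomp0r.
- exact: fzero_projective.
- exact: fzero_injective.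
Qed.
HB.instance Definition _ (A B : fobj) :=
  GRing.isSubmodClosed.Build k (fhom A B) (@fnull A B) (@fnull_closed A B).

Lemma fnull_compl (A B C : fobj) (g : fhom B C) (f : fhom A B) :
  f \in @fnull A B -> fcomp g f \in @fnull A C.
Proof.
move=> /fnullP[Q [a [b [pQ iQ ->]]]]; apply/fnullP.
by exists Q, a, (fcomp g b); split=> //; rewrite fcompA.
Qed.
Lemma fnull_compr (A B C : fobj) (g : fhom B C) (f : fhom A B) :
  g \in @fnull B C -> fcomp g f \in @fnull A C.
Proof.
move=> /fnullP[Q [a [b [pQ iQ ->]]]]; apply/fnullP.
by exists Q, (fcomp a f), b; split=> //; rewrite fcompA.
Qed.

Definition shom (A B : fobj) := Quotient.quot (@fnull A B).
HB.instance Definition _ (A B : fobj) := GRing.Zmodule.on (shom A B).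
HB.instance Definition _ (A B : fobj) := Quotient.on (shom A B).

Definition sclass (A B : fobj) (f : fhom A B) : shom A B := \pi_(shom A B) f.

Lemma sclass_eq (A B : fobj) (f g : fhom A B) :
  sclass f = sclass g <-> f - g \in @fnull A B.
Proof.
rewrite Quotient.idealrBE; split=> [h|/eqP]; last by [].
by apply/eqP.
Qed.

Lemma sclassK (A B : fobj) (f : shom A B) : sclass (repr f) = f.
Proof. exact: reprK. Qed.

Lemma sclassD (A B : fobj) (f g : fhom A B) :
  sclass (f + g) = sclass f + sclass g.
Proof. by rewrite /sclass !piE. Qed.

Definition scomp (A B C : fobj) (g : shom B C) (f : shom A B) : shom A C :=
  sclass (fcomp (repr g) (repr f)).
Definition sscale (A B : fobj) (a : k) (f : shom A B) : shom A B :=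
  sclass (a *: repr f).

Lemma sscaleE (A B : fobj) a (f : fhom A B) :
  sscale a (sclass f) = sclass (a *: f).
Proof.
apply/sclass_eq; rewrite -scalerBr rpredZ //.
by apply/sclass_eq; rewrite sclassK.
Qed.

Lemma scompE (A B C : fobj) (g : fhom B C) (f : fhom A B) :
  scomp (sclass g) (sclass f) = sclass (fcomp g f).
Proof.
apply/sclass_eq.
set g' := repr _; set f' := repr _.
have -> : fcomp g' f' - fcomp g f = fcomp (g' - g) f' + fcomp g (f' - f).
  by rewrite fcompDl fcompDr fcompNl fcompNr addrA subrK.
by apply: rpredD; [apply: fnull_compr | apply: fnull_compl];
  apply/sclass_eq; rewrite sclassK.
Qed.

Fact sscaleA (A B : fobj) a b (f : shom A B) :
  sscale a (sscale b f) = sscale (a * b) f.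
Proof. by rewrite -[f]sclassK !sscaleE scalerA. Qed.
Fact sscale1 (A B : fobj) : left_id 1 (@sscale A B).
Proof. by move=> f; rewrite -[f]sclassK !sscaleE scale1r. Qed.
Fact sscaleDr (A B : fobj) : right_distributive (@sscale A B) +%R.
Proof.
move=> a f g; rewrite -[f]sclassK -[g]sclassK -sclassD !sscaleE -sclassD.
by rewrite scalerDr.
Qed.
Fact sscaleDl (A B : fobj) (f : shom A B) :
  {morph (@sscale A B)^~ f : a b / a + b}.
Proof. by move=> a b; rewrite -[f]sclassK !sscaleE -sclassD scalerDl. Qed.
HB.instance Definition _ (A B : fobj) :=
  GRing.Zmodule_isLmodule.Build k (shom A B)
    (@sscaleA A B) (@sscale1 A B) (@sscaleDr A B) (@sscaleDl A B).

Definition sid (A : fobj) : shom A A := sclass (fid A).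

End CategoryF.

Section ObjectsE.
Variables (R : realType) (k : fieldType).
Notation tau := (tau R).
Notation fobj := (fobj R k).
Implicit Types x y a b : R.

Lemma cptDtau x : cpt (x + tau) = cpt x.
Proof.
by apply/cpt_eq; rewrite addrC addKr tauZE divff ?tau_neq0 // rpred1.
Qed.

(* The coordinate of e^a : P_[x] -> P_[x+a] in the basis of Hom(P_[x], P_[x+a]),
   for a >= 0. *)
Definition texp (a : R) : fps k := fpsX k ^+ wind a.

Lemma texp_comp p q r x a b : 0 <= a -> 0 <= b ->
  p = cpt x -> q = cpt (x + a) -> r = cpt (x + a + b) ->
  fpsX k ^+ carry p q r * (texp b * texp a) = texp (a + b).
Proof.
move=> a0 b0 -> -> ->; rewrite /texp -!exprD; congr (_ ^+ _).
by rewrite (addnC (wind b)) addnA wind_carry.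
Qed.

Lemma texp_tau : texp tau = fpsX k.
Proof. by rewrite /texp /wind divff ?tau_neq0 // truncn1 expr1. Qed.

(* The index false (resp. true) is that of the summand P_[x] (resp. P_[y]). *)
Definition Ept x y : pobj R := @PObj R bool (fun c : bool => if c then cpt y else cpt x).

Definition Emx x y : phom k (Ept x y) (Ept x y) :=
  [ffun z : bool * bool => match z return fps k with
             | (true, false) => texp (y - x)
             | (false, true) => texp (x + tau - y)
             | _ => 0
             end].

Lemma Emx_sqr x y : x <= y <= x + tau ->
  pcomp (Emx x y) (Emx x y) = ptmul (pid k (Ept x y)).
Proof.
move=> /andP[xy yx]; have h1 : 0 <= y - x by rewrite subr_ge0.
have h2 : 0 <= x + tau - y by rewrite subr_ge0.
apply/ffunP => -[[] []]; rewrite pcompE big_bool /= !ffunE /=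
  ?mul0r ?mulr0 ?addr0 ?add0r ?mulr1 ?mulr0 //.
- rewrite (@texp_comp _ _ _ y) //.
  + by rewrite -texp_tau; congr texp; ring.
  + by rewrite -[LHS]cptDtau; congr cpt; ring.
  + by rewrite -[LHS]cptDtau; congr cpt; ring.
- rewrite (@texp_comp _ _ _ x) //.
  + by rewrite -texp_tau; congr texp; ring.
  + by congr cpt; ring.
  + by rewrite -[LHS]cptDtau; congr cpt; ring.
Qed.

Definition E x y (h : x <= y <= x + tau) : fobj := FObj (Emx_sqr h).

(* Up to a common multiple of 2 pi, which does not change E(x', y'),
   x' = x + a and y' = y + b. *)
Definition shift_by x y x' y' a b : Prop :=
  [/\ 0 <= a, 0 <= b, cpt (x + a) = cpt x', cpt (y + b) = cpt y' &
      a + (y' - x') = (y - x) + b].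

Definition diag_mx x y x' y' a b : phom k (Ept x y) (Ept x' y') :=
  [ffun z : bool * bool => match z return fps k with
             | (false, false) => texp a
             | (true, true) => texp b
             | _ => 0
             end].

Lemma Ediag_subproof x y x' y' (h : x <= y <= x + tau)
    (h' : x' <= y' <= x' + tau) a b : shift_by x y x' y' a b ->
  diag_mx x y x' y' a b \in @fcommute R k (E h) (E h').
Proof.
move=> [a0 b0 hx hy e]; apply/eqP.
have [/andP[h1 h2] /andP[h3 h4]] := (h, h').
rewrite -subr_ge0 in h1; rewrite -subr_ge0 in h2.
rewrite -subr_ge0 in h3; rewrite -subr_ge0 in h4.
apply/ffunP => -[[] []]; rewrite !pcompE !big_bool /= !ffunE /=
  ?mul0r ?mulr0 ?addr0 ?add0r ?mulr1 ?mulr0 //.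
- rewrite (@texp_comp _ _ _ x) //; first last.
  + by rewrite -hy; congr cpt; ring.
  + by congr cpt; ring.
  rewrite (@texp_comp _ _ _ x) ?hx //; first by rewrite -e.
  rewrite -hy; congr cpt.
  by lra.
- have e2 : x + tau - y + a = b + (x' + tau - y').
    by lra.
  rewrite (@texp_comp _ _ _ y) //; first last.
  + by rewrite -hx -[LHS]cptDtau; congr cpt; ring.
  + by rewrite -[LHS]cptDtau; congr cpt; ring.
  rewrite (@texp_comp _ _ _ y) ?hy //; first by rewrite e2.
  rewrite -hx -addrA -e2 -[LHS]cptDtau; congr cpt; ring.
Qed.

(* The morphism written 1 : E(x,y) -> E(x',y'), with entries e^a and e^b. *)
Definition Ediag x y x' y' (h : x <= y <= x + tau)
    (h' : x' <= y' <= x' + tau) a b (s : shift_by x y x' y' a b) :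
  fhom (E h) (E h') := FHom (Ediag_subproof h h' s).

(* E(x,y), x < y < x + 2 pi, is encoded by the ordered pair ([x], [y]) of
   distinct points, which determines it since E(x,y) = E(x+2pi,y+2pi). *)
Record indec := Indec { ends : circle R * circle R; _ : ends.1 != ends.2 }.
HB.instance Definition _ := [isSub for ends].
HB.instance Definition _ := [Choice of indec by <:].

Implicit Types e : indec.

Lemma endsP e : (ends e).1 != (ends e).2.
Proof. by case: e. Qed.

Lemma eswap_subproof e : ((ends e).2, (ends e).1).1 != ((ends e).2, (ends e).1).2.
Proof. by rewrite /= eq_sym endsP. Qed.
(* E(y,x+2pi) for e = E(x,y) *)
Definition eswap e : indec := Indec (eswap_subproof e).

(* real numbers x = lo e and y = hi e, x < y < x + 2 pi, such that e = E(x,y) *)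
Definition lo e : R := repr (ends e).1.
Definition hi e : R := lo e + arc (ends e).1 (ends e).2.

Lemma cpt_lo e : cpt (lo e) = (ends e).1.
Proof. exact: cptK. Qed.
Lemma cpt_hi e : cpt (hi e) = (ends e).2.
Proof. exact: arcP. Qed.

Lemma lo_lt_hi e : lo e < hi e.
Proof. by rewrite ltrDl arc_gt0 // endsP. Qed.
Lemma hi_lt_lo e : hi e < lo e + tau.
Proof. by rewrite ltrD2l; have /andP[] := arc_itv (ends e).1 (ends e).2. Qed.

Lemma hi_swap e : hi (eswap e) - lo (eswap e) = lo e + tau - hi e.
Proof.
rewrite /hi /lo /= [LHS]addrC addKr.
have := carryE (ends e).1 (ends e).2 (ends e).1.
rewrite arcpp subr0.
set p := (ends e).1; set q := (ends e).2.
have p0 : 0 < arc p q by rewrite arc_gt0 ?endsP.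
have /andP[q0 q1] := arc_itv q p; have /andP[_ p1] := arc_itv p q.
case: (carry p q p) => [|[|n]]; rewrite ?mulr0 ?mulr1 => hc.
- by exfalso; lra.
- by rewrite hc; ring.
- exfalso.
  have : tau * n.+2%:R >= tau * 2.
    by rewrite ler_pM2l ?tau_gt0 // ler_nat.
  by rewrite hc; lra.
Qed.

Lemma Exy_itv e : lo e <= hi e <= lo e + tau.
Proof. by rewrite !ltW ?lo_lt_hi ?hi_lt_lo. Qed.
Lemma Eyy_itv y : y <= y <= y + tau.
Proof. by rewrite lexx lerDl ltW ?tau_gt0. Qed.
Lemma Exx_itv x : x <= x + tau <= x + tau.
Proof. by rewrite lexx lerDl ltW ?tau_gt0. Qed.

Definition Eobj e : fobj := E (Exy_itv e).

(* E(y,y) + E(x,x+2pi) *)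
Definition Iobj e : fobj := fsum (E (Eyy_itv (hi e))) (E (Exx_itv (lo e))).

Lemma iota_shift1 e : shift_by (lo e) (hi e) (hi e) (hi e) (hi e - lo e) 0.
Proof.
split; rewrite ?subr_ge0 ?(ltW (lo_lt_hi e)) ?addr0 ?subrr ?addr0 //.
by rewrite addrC subrK.
Qed.
Lemma iota_shift2 e :
  shift_by (lo e) (hi e) (lo e) (lo e + tau) 0 (lo e + tau - hi e).
Proof.
split; rewrite ?subr_ge0 ?(ltW (hi_lt_lo e)) ?addr0 //; last by ring.
by rewrite addrC subrK.
Qed.
Lemma proj_shift1 e : shift_by (hi e) (hi e) (lo (eswap e)) (hi (eswap e))
  0 (lo e + tau - hi e).
Proof.
split; rewrite ?subr_ge0 ?(ltW (hi_lt_lo e)) ?addr0 //.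
- by rewrite cpt_hi cpt_lo.
- by rewrite addrC subrK cptDtau cpt_hi cpt_lo.
- by rewrite hi_swap subrr.
Qed.
Lemma proj_shift2 e : shift_by (lo e) (lo e + tau) (lo (eswap e)) (hi (eswap e))
  (hi e - lo e) 0.
Proof.
split; rewrite ?subr_ge0 ?(ltW (lo_lt_hi e)) ?addr0 //.
- by rewrite addrC subrK cpt_hi cpt_lo.
- by rewrite cptDtau cpt_hi cpt_lo.
- by rewrite hi_swap; ring.
Qed.

(* The exact sequence E(x,y) -> E(y,y) + E(x,x+2pi) -> E(y,x+2pi), with the
   maps (1,-1) and (1,1). *)
Definition Iinj e : fhom (Eobj e) (Iobj e) :=
  fcomp (finl _ _) (Ediag (Exy_itv e) (Eyy_itv (hi e)) (iota_shift1 e)) -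
  fcomp (finr _ _) (Ediag (Exy_itv e) (Exx_itv (lo e)) (iota_shift2 e)).

Definition Iproj e : fhom (Iobj e) (Eobj (eswap e)) :=
  fcomp (Ediag (Eyy_itv (hi e)) (Exy_itv (eswap e)) (proj_shift1 e)) (fprl _ _) +
  fcomp (Ediag (Exx_itv (lo e)) (Exy_itv (eswap e)) (proj_shift2 e)) (fprr _ _).

End ObjectsE.

Section ClusterCategory.
Variables (R : realType) (k : fieldType).
Local Open Scope classical_set_scope.

(* The list e1, ..., en stands for the ordered direct sum of the ei. *)
Definition cobj := seq (indec R).

Fixpoint cF (X : cobj) : fobj R k :=
  if X is e :: X' then fsum (Eobj k e) (cF X') else fzero R k.

Definition chom (X Y : cobj) := shom (cF X) (cF Y).
HB.instance Definition _ X Y := GRing.Lmodule.on (chom X Y).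

Definition cid (X : cobj) : chom X X := sid (cF X).
Definition ccomp (X Y Z : cobj) (g : chom Y Z) (f : chom X Y) : chom X Z :=
  scomp g f.

(* Injections and projections of the direct sum X ++ Y. *)
Fixpoint cinl (X Y : cobj) : fhom (cF X) (cF (X ++ Y)) :=
  if X is e :: X' return fhom (cF X) (cF (X ++ Y))
  then fsumhom (fid (Eobj k e)) (cinl X' Y) else 0.
Fixpoint cinr (X Y : cobj) : fhom (cF Y) (cF (X ++ Y)) :=
  if X is e :: X' return fhom (cF Y) (cF (X ++ Y))
  then fcomp (finr (Eobj k e) (cF (X' ++ Y))) (cinr X' Y) else fid (cF Y).
Fixpoint cprl (X Y : cobj) : fhom (cF (X ++ Y)) (cF X) :=
  if X is e :: X' return fhom (cF (X ++ Y)) (cF X)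
  then fsumhom (fid (Eobj k e)) (cprl X' Y) else 0.
Fixpoint cprr (X Y : cobj) : fhom (cF (X ++ Y)) (cF Y) :=
  if X is e :: X' return fhom (cF (X ++ Y)) (cF Y)
  then fcomp (cprr X' Y) (fprr (Eobj k e) (cF (X' ++ Y))) else fid (cF Y).

Definition csum (X X' Y Y' : cobj) (f : chom X Y) (g : chom X' Y') :
    chom (X ++ X') (Y ++ Y') :=
  scomp (sclass (cinl Y Y')) (scomp f (sclass (cprl X X'))) +
  scomp (sclass (cinr Y Y')) (scomp g (sclass (cprr X X'))).

Definition cshift (X : cobj) : cobj := map (@eswap R) X.

Fixpoint cI (X : cobj) : fobj R k :=
  if X is e :: X' then fsum (Iobj k e) (cI X') else fzero R k.
Fixpoint cIinj (X : cobj) : fhom (cF X) (cI X) :=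
  if X is e :: X' return fhom (cF X) (cI X)
  then fsumhom (Iinj k e) (cIinj X') else 0.
Fixpoint cIproj (X : cobj) : fhom (cI X) (cF (cshift X)) :=
  if X is e :: X' return fhom (cI X) (cF (cshift X))
  then fsumhom (Iproj k e) (cIproj X') else 0.

Definition lifts_to_shift (X Y : cobj) (f : fhom (cF X) (cF Y))
    (h : fhom (cF (cshift X)) (cF (cshift Y))) : Prop :=
  exists g : fhom (cI X) (cI Y),
    fcomp g (cIinj X) = fcomp (cIinj Y) f /\
    fcomp h (cIproj X) = fcomp (cIproj Y) g.

(* Happel's construction of the shift of a morphism; such an h exists and its
   stable class depends only on that of f. *)
Definition cshift_hom (X Y : cobj) (f : chom X Y) :
    chom (cshift X) (cshift Y) :=
  xget 0 [set s | exists f0 h0,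
    [/\ sclass f0 = f, sclass h0 = s & lifts_to_shift f0 h0]].

Definition is_pushout (A B C D : fobj R k) (f : fhom A B) (g : fhom A C)
    (b : fhom B D) (c : fhom C D) : Prop :=
  fcomp b f = fcomp c g /\
  forall (D' : fobj R k) (b' : fhom B D') (c' : fhom C D'),
    fcomp b' f = fcomp c' g ->
    exists! h : fhom D D', fcomp h b = b' /\ fcomp h c = c'.

Definition standard_triangle (X Y : cobj) (C : fobj R k)
    (u : fhom (cF X) (cF Y)) (v : fhom (cF Y) C)
    (w : fhom C (cF (cshift X))) : Prop :=
  exists j : fhom (cI X) C,
    [/\ is_pushout u (cIinj X) v j, fcomp w v = 0 & fcomp w j = cIproj X].

Definition is_siso (A B : fobj R k) (f : shom A B) : Prop :=
  exists g : shom B A, scomp g f = sid A /\ scomp f g = sid B.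

Definition ciso (X Y : cobj) : Prop := exists f : chom X Y, is_siso f.

(* The cone C of a standard triangle is an object of F that need not be
   literally one of the chosen objects of the stable category. *)
Definition distinguished (X Y Z : cobj) (u : chom X Y) (v : chom Y Z)
    (w : chom Z (cshift X)) : Prop :=
  exists (X' Y' : cobj) (C : fobj R k) (u' : fhom (cF X') (cF Y'))
    (v' : fhom (cF Y') C) (w' : fhom C (cF (cshift X')))
    (a : chom X X') (b : chom Y Y') (c : shom (cF Z) C),
    [/\ standard_triangle u' v' w',
        is_siso a, is_siso b, is_siso c &
        [/\ scomp b u = scomp (sclass u') a,
            scomp c v = scomp (sclass v') b &
            scomp (cshift_hom a) w = scomp (sclass w') c]].

(* Strict equalities of morphisms are equalities of morphisms bundled with their
   endpoints, as the latter are only propositionally equal. *)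
Definition carrow := {X : cobj & {Y : cobj & chom X Y}}.
Definition arrow (X Y : cobj) (f : chom X Y) : carrow :=
  existT _ X (existT _ Y f).

Record cmap := CMap {
  cobj_map :> cobj -> cobj;
  chom_map : forall X Y : cobj, chom X Y -> chom (cobj_map X) (cobj_map Y) }.

Definition is_functor (F : cmap) : Prop :=
  (forall X, chom_map F (cid X) = cid (F X)) /\
  (forall (X Y Z : cobj) (g : chom Y Z) (f : chom X Y),
     chom_map F (ccomp g f) = ccomp (chom_map F g) (chom_map F f)).

Definition is_klinear (F : cmap) : Prop :=
  forall X Y, linear (@chom_map F X Y).

Definition strictly_additive (F : cmap) : Prop :=
  [/\ F [::] = [::],
      forall X Y : cobj, F (X ++ Y) = F X ++ F Y &
      forall (X X' Y Y' : cobj) (f : chom X Y) (g : chom X' Y'),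
        arrow (chom_map F (csum f g)) =
        arrow (csum (chom_map F f) (chom_map F g))].

(* Here w' is F w, retyped along F (cshift X) = cshift (F X). *)
Definition strictly_triangulated (F : cmap) : Prop :=
  [/\ forall X, F (cshift X) = cshift (F X),
      forall (X Y : cobj) (f : chom X Y),
        arrow (chom_map F (cshift_hom f)) = arrow (cshift_hom (chom_map F f)) &
      forall (X Y Z : cobj) (u : chom X Y) (v : chom Y Z)
          (w : chom Z (cshift X)), distinguished u v w ->
        forall w' : chom (F Z) (cshift (F X)),
          arrow w' = arrow (chom_map F w) ->
          distinguished (chom_map F u) (chom_map F v) w'].

Record cendo := CEndo {
  cendo_map :> cmap;
  cendoP : [/\ is_functor cendo_map, is_klinear cendo_map,
               strictly_additive cendo_map &
               strictly_triangulated cendo_map] }.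

Lemma cendo_inj (F G : cendo) : cendo_map F = cendo_map G -> F = G.
Proof.
case: F G => [F hF] [G hG] /= e; case: _ / e in hG *.
by rewrite (Prop_irrelevance hF hG).
Qed.

Definition cmap1 : cmap := @CMap id (fun X Y f => f).
Definition cmap_comp (F G : cmap) : cmap :=
  @CMap (fun X => F (G X)) (fun X Y f => chom_map F (chom_map G f)).

Lemma arrow_inj (X Y : cobj) (f g : chom X Y) : arrow f = arrow g -> f = g.
Proof.
move=> e; apply: (@eq_from_Tagged _ (chom X) Y).
exact: (@eq_from_Tagged _ (fun X : cobj => {Y : cobj & chom X Y}) X _ _ e).
Qed.

Lemma arrow_cast (X Y Y' : cobj) (f : chom X Y) (e : Y = Y') :
  exists f' : chom X Y', arrow f' = arrow f.
Proof. by case: _ / e; exists f. Qed.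

Lemma arrow_map (F : cmap) (X Y X' Y' : cobj) (f : chom X Y) (g : chom X' Y') :
  arrow f = arrow g -> arrow (chom_map F f) = arrow (chom_map F g).
Proof.
pose Fa (t : carrow) := arrow (chom_map F (projT2 (projT2 t))).
exact: (congr1 Fa).
Qed.

Lemma cendo1_subproof : [/\ is_functor cmap1, is_klinear cmap1,
  strictly_additive cmap1 & strictly_triangulated cmap1].
Proof.
by split=> //; split=> // X Y Z u v w d w' /arrow_inj ->.
Qed.
Definition cendo1 : cendo := CEndo cendo1_subproof.

Lemma cendo_comp_subproof (F G : cendo) :
  [/\ is_functor (cmap_comp F G), is_klinear (cmap_comp F G),
     strictly_additive (cmap_comp F G) & strictly_triangulated (cmap_comp F G)].
Proof.
case: F G => [F [[F1 F2] F3 [F4 F5 F6] [F7 F8 F9]]].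
move=> [G [[G1 G2] G3 [G4 G5 G6] [G7 G8 G9]]]; split => /=.
- by split=> [X|X Y Z g f] /=; rewrite ?G1 ?G2.
- by move=> X Y a f g /=; rewrite G3 F3.
- split=> /=; first by rewrite G4.
    by move=> X Y; rewrite G5.
  move=> X X' Y Y' f g; rewrite -F6; apply: arrow_map; exact: G6.
- split=> /= [X|X Y f|X Y Z u v w d w' e]; first by rewrite G7.
    by rewrite -F8; apply: arrow_map; exact: G8.
  have [w1 e1] := arrow_cast (chom_map G w) (G7 X).
  apply: (F9 _ _ _ _ _ _ (G9 _ _ _ _ _ _ d w1 e1)).
  by rewrite e; apply: arrow_map.
Qed.
Definition cendo_comp (F G : cendo) : cendo :=
  CEndo (cendo_comp_subproof F G).

(* Automorphisms are the invertible elements of the monoid of strict k-linear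
   triangulated endofunctors. *)
Record caut := CAut {
  caut_endo :> cendo;
  cautP : exists G : cendo,
    cendo_comp caut_endo G = cendo1 /\ cendo_comp G caut_endo = cendo1 }.
HB.instance Definition _ := gen_eqMixin caut.
HB.instance Definition _ := gen_choiceMixin caut.

Lemma caut_inj (F G : caut) : caut_endo F = caut_endo G -> F = G.
Proof.
case: F G => [F hF] [G hG] /= e; case: _ / e in hG *.
by rewrite (Prop_irrelevance hF hG).
Qed.

Lemma cendo_compA : associative cendo_comp.
Proof. by move=> F G H; apply: cendo_inj. Qed.
Lemma cendo_comp1l : left_id cendo1 cendo_comp.
Proof. by move=> F; apply: cendo_inj; case: F => -[]. Qed.
Lemma cendo_comp1r : right_id cendo1 cendo_comp.
Proof. by move=> F; apply: cendo_inj; case: F => -[]. Qed.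

Lemma caut1_subproof : exists G : cendo,
  cendo_comp cendo1 G = cendo1 /\ cendo_comp G cendo1 = cendo1.
Proof. by exists cendo1; rewrite cendo_comp1l. Qed.
Definition caut1 : caut := CAut caut1_subproof.

Lemma caut_comp_subproof (F F' : caut) : exists G : cendo,
  cendo_comp (cendo_comp F F') G = cendo1 /\
  cendo_comp G (cendo_comp F F') = cendo1.
Proof.
case: F F' => [F [G [h1 h2]]] [F' [G' [h1' h2']]] /=.
exists (cendo_comp G' G); split.
  by rewrite -cendo_compA (cendo_compA F') h1' cendo_comp1l.
by rewrite -cendo_compA (cendo_compA G) h2 cendo_comp1l.
Qed.
Definition caut_comp (F F' : caut) : caut := CAut (caut_comp_subproof F F').

Definition caut_inv_endo (F : caut) : cendo := sval (boolp.cid (cautP F)).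
Lemma caut_inv_endoP (F : caut) : cendo_comp F (caut_inv_endo F) = cendo1 /\
  cendo_comp (caut_inv_endo F) F = cendo1.
Proof. exact: (svalP (boolp.cid (cautP F))). Qed.
Lemma caut_inv_subproof (F : caut) : exists G : cendo,
  cendo_comp (caut_inv_endo F) G = cendo1 /\
  cendo_comp G (caut_inv_endo F) = cendo1.
Proof. by exists F; case: (caut_inv_endoP F). Qed.
Definition caut_inv (F : caut) : caut := CAut (caut_inv_subproof F).

Fact caut_compA : associative caut_comp.
Proof. by move=> F G H; apply: caut_inj; exact: cendo_compA. Qed.
Fact caut_comp1l : left_id caut1 caut_comp.
Proof. by move=> F; apply: caut_inj; exact: cendo_comp1l. Qed.
Fact caut_comp1r : right_id caut1 caut_comp.
Proof. by move=> F; apply: caut_inj; exact: cendo_comp1r. Qed.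
Fact caut_compVl : left_inverse caut1 caut_inv caut_comp.
Proof. by move=> F; apply: caut_inj; exact: (caut_inv_endoP F).2. Qed.
Fact caut_compVr : right_inverse caut1 caut_inv caut_comp.
Proof. by move=> F; apply: caut_inj; exact: (caut_inv_endoP F).1. Qed.
HB.instance Definition _ := isGroup.Build caut
  caut_compA caut_comp1l caut_comp1r caut_compVl caut_compVr.

End ClusterCategory.

Section Homeo.
Variable R : realType.
Notation circle := (circle R).

Definition orientation_preserving (f : circle -> circle) : Prop :=
  exists F : R -> R,
    [/\ continuous F, {homo F : x y / x < y} & forall x, f (cpt x) = cpt (F x)].

Definition homeomorphism (f : circle -> circle) : Prop :=
  continuous f /\
  exists g : circle -> circle, [/\ cancel f g, cancel g f & continuous g].

Record homeo := Homeo {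
  homeo_fun :> circle -> circle;
  homeoP : homeomorphism homeo_fun /\ orientation_preserving homeo_fun }.
HB.instance Definition _ := gen_eqMixin homeo.
HB.instance Definition _ := gen_choiceMixin homeo.

Lemma homeo_ext (f g : homeo) : f =1 g -> f = g.
Proof.
case: f g => [f hf] [g hg] /= /funext e; case: _ / e in hg *.
by rewrite (Prop_irrelevance hf hg).
Qed.

Lemma homeo_inj (f : homeo) : injective f.
Proof. by case: (homeoP f) => -[_ [g [/can_inj]]]. Qed.

Lemma homeo1_subproof :
  homeomorphism (@id circle) /\ orientation_preserving (@id circle).
Proof.
split; last by exists id; split=> // x; exact: cvg_id.
by split=> [x|]; [exact: cvg_id | exists id; split=> // x; exact: cvg_id].
Qed.
Definition homeo1 : homeo := Homeo homeo1_subproof.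

Lemma homeo_comp_subproof (f g : homeo) :
  homeomorphism (f \o g) /\ orientation_preserving (f \o g).
Proof.
case: f g => [f [[cf [f' [fK f'K cf']]] [F [cF iF hF]]]].
move=> [g [[cg [g' [gK g'K cg']]] [G [cG iG hG]]]] /=; split.
  split; first by move=> x; apply: continuous_comp; [exact: cg | exact: cf].
  exists (g' \o f'); split; [exact: can_comp | exact: can_comp |].
  by move=> x; apply: continuous_comp; [exact: cf' | exact: cg'].
exists (F \o G); split.
- by move=> x; apply: continuous_comp; [exact: cG | exact: cF].
- by move=> x y xy /=; apply: iF; exact: iG.
- by move=> x /=; rewrite hG hF.
Qed.
Definition homeo_comp (f g : homeo) : homeo := Homeo (homeo_comp_subproof f g).

Lemma lift_surj (f : homeo) (F : R -> R) : continuous F ->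
  {homo F : x y / x < y} -> (forall x, f (cpt x) = cpt (F x)) ->
  forall y, exists x, F x = y.
Proof.
move=> cF iF hF y.
have step x : F x + tau R <= F (x + tau R).
  have : F (x + tau R) - F x \in @tauZ R by apply/cpt_eq; rewrite -!hF cptDtau.
  rewrite tauZE => /intrP[n hn].
  have hn' : F (x + tau R) - F x = n%:~R * tau R.
    by rewrite -hn divfK ?tau_neq0.
  have : 0 < F (x + tau R) - F x by rewrite subr_gt0 iF // ltrDl tau_gt0.
  rewrite hn' pmulr_lgt0 ?tau_gt0 // ltr0z gtz0_ge1 => n1.
  rewrite -lerBrDl hn' -{1}[tau R]mul1r ler_pM2r ?tau_gt0 //.
  by rewrite -(ler_int R) in n1.
have up n : F 0 + tau R * n%:R <= F (tau R * n%:R).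
  elim: n => [|n ih]; first by rewrite mulr0 addr0.
  rewrite -addn1 natrD mulrDr mulr1; apply: le_trans (step _).
  by rewrite addrA lerD2r.
have dn n : F (- (tau R * n%:R)) <= F 0 - tau R * n%:R.
  elim: n => [|n ih]; first by rewrite mulr0 oppr0 addr0.
  have := step (- (tau R * n.+1%:R)).
  have -> : - (tau R * n.+1%:R) + tau R = - (tau R * n%:R).
    by rewrite -addn1 natrD; ring.
  move=> h; rewrite -addn1 natrD in h *; lra.
pose n := (Num.truncn (`|y - F 0| / tau R)).+1.
have hn : `|y - F 0| < tau R * n%:R.
  by rewrite mulrC -ltr_pdivrMr ?tau_gt0 // truncnS_gt.
move: hn; rewrite ltr_norml => /andP[h1 h2].
have ab : - (tau R * n%:R) <= tau R * n%:R.
  by rewrite ge0_cp // mulr_ge0 // ltW // tau_gt0.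
have [||c _ <-] := @IVT R F _ _ y ab.
- by apply: continuous_subspaceT.
- have := up n; have := dn n; move=> k1 k2.
  by rewrite ge_min le_max; apply/andP; split; apply/orP;
    [left | right]; lra.
- by exists c.
Qed.

Lemma homeo_inv_ex (f : homeo) : exists g : homeo, cancel f g /\ cancel g f.
Proof.
case: (f) (@lift_surj f) => [f0 [[cf [g [fK gK cg]]] [F [cF iF hF]]]] /= sF.
suff hg : homeomorphism g /\ orientation_preserving g by exists (Homeo hg).
split; first by split=> //; exists f0.
have mF : {mono F : x y / x <= y} by apply: le_mono.
pose G y := sval (boolp.cid (sF F cF iF hF y)).
have FG y : F (G y) = y by exact: (svalP (boolp.cid (sF F cF iF hF y))).
have GF x : G (F x) = x.
  by apply/eqP; rewrite eq_le -(mF (G (F x))) -(mF x) FG lexx.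
have mG : {homo G : x y / x < y}.
  by move=> x y xy; rewrite ltNge -(mF (G y)) !FG -ltNge.
exists G; split=> //; last first.
  by move=> x; rewrite -{1}(FG x) -hF fK.
move=> y; apply/cvgrPdist_lt => e e0.
near=> z; rewrite distrC ltr_distl; apply/andP; split.
- rewrite -{1}(GF (G y - e)); apply: mG; near: z; apply: lt_nbhsr.
  by rewrite -[X in _ < X](FG y) iF // ltrBlDr ltrDl.
- rewrite -{1}(GF (G y + e)); apply: mG; near: z; apply: lt_nbhsl.
  by rewrite -[X in X < _](FG y) iF // ltrDl.
Unshelve. all: by end_near.
Qed.

Definition homeo_inv (f : homeo) : homeo := sval (boolp.cid (homeo_inv_ex f)).
Lemma homeo_invP (f : homeo) : cancel f (homeo_inv f) /\ cancel (homeo_inv f) f.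
Proof. exact: (svalP (boolp.cid (homeo_inv_ex f))). Qed.

Fact homeo_compA : associative homeo_comp.
Proof. by move=> f g h; exact: homeo_ext. Qed.
Fact homeo_comp1l : left_id homeo1 homeo_comp.
Proof. by move=> f; exact: homeo_ext. Qed.
Fact homeo_comp1r : right_id homeo1 homeo_comp.
Proof. by move=> f; exact: homeo_ext. Qed.
Fact homeo_compVl : left_inverse homeo1 homeo_inv homeo_comp.
Proof. by move=> f; apply: homeo_ext => x; exact: (homeo_invP f).1. Qed.
Fact homeo_compVr : right_inverse homeo1 homeo_inv homeo_comp.
Proof. by move=> f; apply: homeo_ext => x; exact: (homeo_invP f).2. Qed.
HB.instance Definition _ := isGroup.Build homeo
  homeo_compA homeo_comp1l homeo_comp1r homeo_compVl homeo_compVr.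

Lemma homeo_indec_subproof (f : homeo) (e : indec R) :
  (f (ends e).1, f (ends e).2).1 != (f (ends e).1, f (ends e).2).2.
Proof. by rewrite /= (inj_eq (@homeo_inj f)) endsP. Qed.
Definition homeo_indec (f : homeo) (e : indec R) : indec R :=
  Indec (homeo_indec_subproof f e).

End Homeo.

(* Main.v *)
From HB Require Import structures.
From mathcomp Require Import all_boot all_order all_algebra.
From mathcomp Require Import all_classical all_reals all_analysis.
From mathcomp Require Import ring lra zify.
Require Import Defs.
Set Implicit Arguments.
Unset Strict Implicit.
Unset Printing Implicit Defensive.
Import Order.TTheory GRing.Theory Num.Theory.
Import numFieldNormedType.Exports.
Local Open Scope ring_scope.

(* In the stable category, morphisms vanish exactly when they are null-homotopic
   (f = s d + d s): every object is covered by a free one, P + P with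
   d = [[0, t], [1, 0]], which is contractible. Hence Hom(E(x,y), E(x',y')) is
   nonzero iff exactly one of x', y' lies on the arc [x, y[. Call e adjacent to
   e' if Hom(e, e') is nonzero but Hom(e', e) is zero; this means that e = E(x,y)
   and e' = E(x,z) with x, y, z in cyclic order. Three edges that pairwise share
   one vertex form a directed cycle for adjacency when they are the sides of a
   triangle, but not when they share a common vertex. So an automorphism, which
   permutes the indecomposables and preserves adjacency, maps stars of vertices
   to stars and comes from a bijection of the circle that preserves the cyclic
   order, i.e. from an orientation preserving homeomorphism. Conversely, a
   homeomorphism g relabels the points P_[x] into P_[g x] and keeps all matrices:
   this respects composition because g preserves the carries, hence also d, the
   sequences defining the shift, and the triangles. *)

(** * Carries, cyclic order and lifts to the line *)

Section CircleOrder.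
Variable R : realType.
Implicit Types (p q r o : circle R) (x y : R).

(** All arcs lie in [[0, tau[], so [carryE] leaves only the values 0 and 1; the value is 1 exactly
    when, going from [p], one meets [r] before [q]. Carries thus encode the cyclic order. *)
Lemma carry_arc p q r : carry p q r = (arc p r < arc p q) :> nat.
Proof.
have := carryE p q r.
have /andP[a1 a2] := arc_itv p q; have /andP[b1 b2] := arc_itv q r.
have /andP[c1 c2] := arc_itv p r; have t0 := tau_gt0 R.
case: (carry p q r) => [|[|n]]; rewrite ?mulr0 ?mulr1 => h.
- by case: ltP => // k; exfalso; lra.
- by case: ltP => // k; exfalso; lra.
- have : tau R * n.+2%:R >= tau R * 2 by rewrite ler_pM2l ?tau_gt0 // ler_nat.
  by move=> k; exfalso; lra.
Qed.

Lemma arc_inj o : injective (arc o).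
Proof. by move=> p q h; rewrite -(arcP o p) h arcP. Qed.

Lemma arc_cpt x y : x <= y < x + tau R -> arc (cpt x) (cpt y) = y - x.
Proof.
by move=> /andP[h1 h2]; rewrite arcE cfrac_id // subr_ge0 h1 ltrBlDl.
Qed.

Lemma cpt_lt_tau x y : x < y -> cpt x = cpt y -> x + tau R <= y.
Proof.
move=> xy /esym/cpt_eq; rewrite tauZE => /intrP[n hn].
have hn' : y - x = n%:~R * tau R by rewrite -hn divfK ?tau_neq0.
have : 0 < y - x by rewrite subr_gt0.
rewrite hn' pmulr_lgt0 ?tau_gt0 // ltr0z gtz0_ge1 => n1.
rewrite -lerBrDl hn' -{1}[tau R]mul1r ler_pM2r ?tau_gt0 //.
by rewrite -(ler_int R) in n1.
Qed.

(** [orientation_preserving] does not impose degree one. It follows from injectivity of [f]: the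
    preimage [y] of [F x + tau] lies over the same point as [x], hence [x + tau <= y]. *)
Lemma homeo_lift (f : homeo R) : exists F : R -> R,
  [/\ {homo F : x y / x < y}, forall x, F (x + tau R) = F x + tau R &
      forall x, f (cpt x) = cpt (F x)].
Proof.
have [_ [F [cF iF hF]]] := homeoP f; exists F; split=> // x.
have sF := lift_surj cF iF hF.
have mF : {mono F : x y / x <= y} by apply: le_mono.
apply/eqP; rewrite eq_le; apply/andP; split.
- have [y hy] := sF (F x + tau R).
  rewrite -hy mF; apply: cpt_lt_tau.
    by rewrite -(leW_mono mF) hy ltrDl tau_gt0.
  by apply: (@homeo_inj R f); rewrite !hF hy cptDtau.
- apply: cpt_lt_tau; first by rewrite iF // ltrDl tau_gt0.
  by rewrite -!hF cptDtau.
Qed.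

(** A lift [F] carries arcs starting at [p] to arcs starting at [f p] and is monotone, so the
    comparison in [carry_arc] is unchanged. *)
Lemma homeo_carry (f : homeo R) p q r : carry (f p) (f q) (f r) = carry p q r.
Proof.
have [F [iF FD hF]] := homeo_lift f.
have mF : {mono F : x y / x <= y} by apply: le_mono.
have arcf s : arc (f p) (f s) = F (repr p + arc p s) - F (repr p).
  have /andP[a1 a2] := arc_itv p s.
  rewrite -{1}(cptK p) -{1}(arcP p s) !hF arc_cpt // -FD mF (leW_mono mF).
  by rewrite lerDl ltrD2l a1 a2.
by rewrite !carry_arc !arcf ltrD2r (leW_mono mF) ltrD2l.
Qed.

Lemma increasing_surj_continuous (F : R -> R) :
  {homo F : x y / x < y} -> (forall y, exists x, F x = y) -> continuous F.
Proof.
move=> iF sF x; have mF : {mono F : x y / x < y} by apply/leW_mono/le_mono.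
apply/cvgrPdist_lt => e e0.
have [a ha] := sF (F x - e); have [b hb] := sF (F x + e).
near=> z; rewrite distrC ltr_distl; apply/andP; split.
- rewrite -ha mF; near: z; apply: lt_nbhsr.
  by rewrite -mF ha ltrBlDr ltrDl.
- rewrite -hb mF; near: z; apply: lt_nbhsl.
  by rewrite -mF hb ltrDl.
Unshelve. all: by end_near.
Qed.

(** * Surjections of the circle that preserve carries *)

Section CyclicOrder.
Variable phi : circle R -> circle R.
Hypothesis phi_surj : forall q, exists p, phi p = q.
Hypothesis phi_carry : forall p q r,
  carry (phi p) (phi q) (phi r) = carry p q r.

Let base := repr (phi (cpt 0)).
(** On [[0, tau[] this follows the arc from the image of [[0]]; the last term extends it by
    [lift (x + tau) = lift x + tau]. *)
Let lift x := base + arc (phi (cpt 0)) (phi (cpt x)) + (x - cfrac x).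

Let lift_cpt x : phi (cpt x) = cpt (lift x).
Proof.
rewrite -[LHS](arcP (phi (cpt 0))); apply/cpt_eq.
by rewrite /lift opprD addrA subrr sub0r rpredN cfrac_tauZ.
Qed.

Let arc_phi p q r : (arc (phi p) (phi q) < arc (phi p) (phi r)) =
  (arc p q < arc p r).
Proof. by apply: (can_inj oddb); rewrite -!carry_arc phi_carry. Qed.

Let lift_homo : {homo lift : x y / x < y}.
Proof.
move=> x y xy; pose m z := Num.floor (z / tau R).
have mE z : z - cfrac z = tau R * (m z)%:~R.
  by rewrite /cfrac opprB addrC subrK.
have : m x <= m y by rewrite le_floor // ler_pM2r ?invr_gt0 ?tau_gt0 ?ltW.
(* Within one period, monotonicity is [arc_phi]; across periods the jump of at least [tau] exceeds
   any arc. *)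
rewrite le_eqVlt => /orP[/eqP e|lt].
  have : cfrac x < cfrac y by rewrite /cfrac -/(m x) -/(m y) e ltrD2r.
  rewrite /lift !mE e ltrD2r ltrD2l arc_phi !arcE !subr0 //.
have /andP[_ a2] := arc_itv (phi (cpt 0)) (phi (cpt x)).
have b1 := arc_ge0 (phi (cpt 0)) (phi (cpt y)).
rewrite /lift !mE.
have : tau R * (m x)%:~R + tau R <= tau R * (m y)%:~R.
  rewrite -{2}[tau R]mulr1 -mulrDr ler_pM2l ?tau_gt0 //.
  by rewrite -[1]/(1%:~R) -intrD ler_int; lia.
by move: a2 b1; lra.
Qed.

Let lift_onto y : exists x, lift x = y.
Proof.
pose n := Num.floor ((y - base) / tau R).
have e0 : y - base = cfrac (y - base) + tau R * n%:~R by rewrite subrK.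
have [p hp] := phi_surj (cpt y).
have [c0 c1] : 0 <= arc (cpt 0) p /\ arc (cpt 0) p < tau R.
  by have /andP[] := arc_itv (cpt 0) p.
(* The representative of the preimage [p] in [[0, tau[], moved by the number of full turns from
   [base] to [y]. *)
exists (arc (cpt 0) p + tau R * n%:~R).
have ex : cpt (arc (cpt 0) p + tau R * n%:~R) = p.
  transitivity (cpt (arc (cpt 0) p)).
    apply/cpt_eq; rewrite addrC addKr tauZE mulrC mulrA mulVf ?tau_neq0 //.
    by rewrite mul1r intr_int.
  have := arcP (cpt 0) p => h; rewrite -[RHS]h; apply/cpt_eq.
  rewrite opprD addrCA subrr addr0 -[- _]add0r.
  by apply/cpt_eq; rewrite cptK.
have -> : lift (arc (cpt 0) p + tau R * n%:~R) =
    base + arc (phi (cpt 0)) (phi p) + tau R * n%:~R.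
  rewrite /lift ex; congr (_ + _).
  have -> : cfrac (arc (cpt 0) p + tau R * n%:~R) = arc (cpt 0) p.
    transitivity (cfrac (arc (cpt 0) p)); last by rewrite cfrac_id ?c0.
    apply: cfracE; rewrite addrC addKr tauZE mulrC mulrA mulVf ?tau_neq0 //.
    by rewrite mul1r intr_int.
  by rewrite addrC addKr.
rewrite hp.
have -> : arc (phi (cpt 0)) (cpt y) = cfrac (y - base).
  by rewrite -{1}(cptK (phi (cpt 0))) arcE.
by rewrite -addrA -e0 addrC subrK.
Qed.

(** Carries separate points: [carry p q p] is 1 for distinct points and 0 for equal ones. *)
Let phi_inj : injective phi.
Proof.
move=> p q e; apply/eqP; apply: contraT => pq.
have : carry p q p = 1%N by rewrite carry_arc arcpp arc_gt0.
by rewrite -phi_carry e carrypp.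
Qed.

Let phi_continuous : continuous phi.
Proof.
apply/quotient_continuous.
rewrite (_ : _ \o _ = (@cpt R) \o lift); last by apply/funext => x; exact: lift_cpt.
move=> x; apply: continuous_comp; last exact: pi_continuous.
exact: increasing_surj_continuous.
Qed.

Lemma cyclic_bijection_lift : exists F : R -> R,
    [/\ continuous F, {homo F : x y / x < y} & forall x, phi (cpt x) = cpt (F x)].
Proof. by exists lift; split=> //; exact: increasing_surj_continuous. Qed.

Lemma cyclic_bijection : continuous phi /\ injective phi.
Proof. by split. Qed.

End CyclicOrder.

(** The inverse map preserves carries as well, so continuity holds in both directions. *)
Lemma carry_homeo (phi : circle R -> circle R) :
  (forall q, exists p, phi p = q) ->
  (forall p q r, carry (phi p) (phi q) (phi r) = carry p q r) ->
  exists f : homeo R, f =1 phi.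
Proof.
move=> sphi cphi; have [c1 i1] := cyclic_bijection sphi cphi.
pose psi q := sval (boolp.cid (sphi q)).
have psiK q : phi (psi q) = q by exact: (svalP (boolp.cid (sphi q))).
have phiK p : psi (phi p) = p by apply: i1.
have [c2 _] : continuous psi /\ injective psi.
  apply: cyclic_bijection => [p|p q r]; first by exists (phi p).
  by rewrite -cphi !psiK.
have hphi : homeomorphism phi /\ orientation_preserving phi.
  by split; [split=> //; exists psi | exact: cyclic_bijection_lift].
by exists (Homeo hphi).
Qed.

End CircleOrder.

(** * Null homotopies *)

Section NullHomotopy.
Variables (R : realType) (k : fieldType).
Implicit Types (U V W : pobj R) (A B C Q : fobj R k).

Lemma pcomp0l U V W (f : phom k U V) : pcomp (0 : phom k V W) f = 0.
Proof. by rewrite -(scale0r 0) pcompZl scale0r. Qed.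
Lemma pcomp0r U V W (g : phom k V W) : pcomp g (0 : phom k U V) = 0.
Proof. by rewrite -(scale0r 0) pcompZr scale0r. Qed.
Lemma pcompNl U V W (g : phom k V W) (f : phom k U V) :
  pcomp (- g) f = - pcomp g f.
Proof. by apply/eqP; rewrite -addr_eq0 -pcompDl addNr pcomp0l. Qed.
Lemma pcompNr U V W (g : phom k V W) (f : phom k U V) :
  pcomp g (- f) = - pcomp g f.
Proof. by apply/eqP; rewrite -addr_eq0 -pcompDr addNr pcomp0r. Qed.

Lemma pcomp_tmull U V W (g : phom k V W) (f : phom k U V) :
  pcomp (ptmul g) f = ptmul (pcomp g f).
Proof.
apply/ffunP => -[w u]; rewrite [RHS]ffunE !pcompE mulr_sumr.
by apply: eq_bigr => j _; rewrite ffunE -mulrA mulrCA.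
Qed.
Lemma pcomp_tmulr U V W (g : phom k V W) (f : phom k U V) :
  pcomp g (ptmul f) = ptmul (pcomp g f).
Proof.
apply/ffunP => -[w u]; rewrite [RHS]ffunE !pcompE mulr_sumr.
by apply: eq_bigr => j _; rewrite ffunE [RHS]mulrCA; congr (_ * _); rewrite mulrCA.
Qed.
Lemma ptmulD V W (f g : phom k V W) : ptmul (f + g) = ptmul f + ptmul g.
Proof. by apply/ffunP => z; rewrite !ffunE mulrDr. Qed.

Lemma ptmul0 V W : ptmul (0 : phom k V W) = 0.
Proof. by apply/ffunP => z; rewrite !ffunE mulr0. Qed.

Lemma fd_sqr A W (f : phom k W (fV A)) :
  pcomp (fd A) (pcomp (fd A) f) = ptmul f.
Proof. by rewrite pcompA fdP pcomp_tmull pcomp1l. Qed.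
Lemma sqr_fd A W (f : phom k (fV A) W) :
  pcomp (pcomp f (fd A)) (fd A) = ptmul f.
Proof. by rewrite -pcompA fdP pcomp_tmulr pcomp1r. Qed.

Lemma fhomP A B (f : fhom A B) : pcomp f (fd A) = pcomp (fd B) f.
Proof. by case: f => m /= hm; apply/eqP; exact: hm. Qed.

(** Both composites of [m d + d m] with [d] equal [t m + d m d]. *)
Lemma boundary_subproof A B (m : phom k (fV A) (fV B)) :
  pcomp m (fd A) + pcomp (fd B) m \in @fcommute R k A B.
Proof.
rewrite unfold_in /fcommute pcompDl pcompDr sqr_fd fd_sqr -pcompA.
by rewrite addrC.
Qed.
Definition boundary A B (m : phom k (fV A) (fV B)) : fhom A B :=
  FHom (boundary_subproof m).

Lemma boundary_compl A B C (g : fhom B C) (m : phom k (fV A) (fV B)) :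
  fcomp g (boundary m) = boundary (pcomp g m).
Proof.
by apply: val_inj; rewrite /= pcompDr !pcompA fhomP.
Qed.

Lemma boundary_compr A B C (m : phom k (fV B) (fV C)) (f : fhom A B) :
  fcomp (boundary m) f = boundary (pcomp m f).
Proof.
by apply: val_inj; rewrite /= pcompDl -!pcompA fhomP.
Qed.

(** * Contractible objects are projective and injective *)

Section Contractible.
Variables (Q : fobj R k) (s : phom k (fV Q) (fV Q)).
Hypothesis sQ : boundary s = fid Q.

(** The splitting [q] of [g] need not commute with [d], but the boundary of [q h s] does, and [g]
    sends it to the boundary of [h s], which is [h] composed with the identity. *)
Lemma contractible_projective : fprojective Q.
Proof.
move=> A B C f g [r [q [_ qg _ _]]] h.
exists (boundary (pcomp (pcomp q h) s)).
by rewrite boundary_compl !pcompA qg pcomp1l -boundary_compl sQ fcomp1r.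
Qed.

Lemma contractible_injective : finjective Q.
Proof.
move=> A B C f g [r [q [rf _ _ _]]] h.
exists (boundary (pcomp s (pcomp h r))).
by rewrite boundary_compr -!pcompA rf pcomp1r -boundary_compr sQ fcomp1l.
Qed.
End Contractible.

(** * The free object on [V] *)

Section Induced.
Variable V : pobj R.
Let d : phom k (psum V V) (psum V V) :=
  ptmul (pcomp (pinl k V V) (pprr k V V)) + pcomp (pinr k V V) (pprl k V V).

Let comp4 U U' V' W W' (a : phom k W W') (b : phom k V' W) (c : phom k U' V')
  (e : phom k U U') : pcomp (pcomp a b) (pcomp c e) =
   pcomp a (pcomp (pcomp b c) e).
Proof. by rewrite !pcompA. Qed.

Lemma induced_subproof : pcomp d d = ptmul (pid k (psum V V)).
Proof.
rewrite /d !pcompDl !pcompDr !pcomp_tmull !pcomp_tmulr !comp4.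
rewrite pprr_inl pprr_inr pprl_inl pprl_inr !pcomp0l !pcomp0r !pcomp1l.
by rewrite !ptmul0 add0r addr0 -ptmulD psum_id.
Qed.

Definition induced : fobj R k := FObj induced_subproof.

(** The inverse of the invertible entry of [d]; the terms containing [t] cancel out of its boundary
    since [pprr] kills [pinl]. *)
Definition induced_contraction : phom k (fV induced) (fV induced) :=
  pcomp (pinl k V V) (pprr k V V).

Lemma induced_contractible : boundary induced_contraction = fid induced.
Proof.
apply: val_inj; rewrite /= /d /induced_contraction.
rewrite !pcompDl !pcompDr !pcomp_tmull !pcomp_tmulr !comp4.
rewrite pprr_inl pprr_inr pprl_inl !pcomp0l !pcomp0r !pcomp1l.
by rewrite ptmul0 !add0r psum_id.
Qed.

(* A homotopy m : A -> B factors through the free object on V. *)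
Lemma from_induced_subproof B (m : phom k V (fV B)) :
  pcomp m (pprl k V V) + pcomp (fd B) (pcomp m (pprr k V V)) \in
  @fcommute R k induced B.
Proof.
rewrite unfold_in /fcommute /= /d !pcompDl !pcompDr !pcomp_tmulr fd_sqr.
rewrite -!pcompA (pcompA (pprl k V V)) (pcompA (pprr k V V)).
rewrite (pcompA (pprl k V V) (pinr k V V)) (pcompA (pprr k V V) (pinr k V V)).
rewrite pprr_inl pprr_inr pprl_inl pprl_inr !pcomp0l !pcomp0r !pcomp1l.
by rewrite ptmul0 addr0 add0r addrC.
Qed.
Definition from_induced B (m : phom k V (fV B)) : fhom induced B :=
  FHom (from_induced_subproof m).

(** The free object is also cofree: [m] is the second component, and commutation with [d] forces the
    first to be [m d]. *)
Lemma to_induced_subproof A (m : phom k (fV A) V) :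
  pcomp (pinl k V V) (pcomp m (fd A)) + pcomp (pinr k V V) m \in
  @fcommute R k A induced.
Proof.
rewrite unfold_in /fcommute /= /d !pcompDl !pcompDr !pcomp_tmull.
rewrite -!pcompA fdP.
rewrite (pcompA (pprl k V V)) (pcompA (pprr k V V)).
rewrite (pcompA (pprl k V V) (pinr k V V)) (pcompA (pprr k V V) (pinr k V V)).
rewrite pprr_inl pprr_inr pprl_inl pprl_inr !pcomp0l !pcomp0r !pcomp1l.
by rewrite ptmul0 addr0 add0r !pcomp_tmulr pcomp1r.
Qed.
Definition to_induced A (m : phom k (fV A) V) : fhom A induced :=
  FHom (to_induced_subproof m).

Lemma induced_factor A B (a : phom k (fV A) V) (b : phom k V (fV B)) :
  fcomp (from_induced b) (to_induced a) = boundary (pcomp b a).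
Proof.
apply: val_inj; rewrite /= !pcompDl !pcompDr -!pcompA.
rewrite (pcompA (pprl k V V)) (pcompA (pprr k V V)).
rewrite (pcompA (pprl k V V) (pinr k V V)) (pcompA (pprr k V V) (pinr k V V)).
rewrite pprr_inl pprr_inr pprl_inl pprl_inr !pcomp0l !pcomp0r !pcomp1l.
by rewrite addr0 add0r.
Qed.
End Induced.

(** [A] with the opposite differential is the kernel of the canonical cover of [A] by the free
    object on its underlying object. *)
Lemma fopp_subproof A :
  pcomp (- fd A) (- fd A) = ptmul (pid k (fV A)).
Proof. by rewrite pcompNl pcompNr opprK fdP. Qed.
Definition fopp A : fobj R k := FObj (fopp_subproof A).

Lemma cover_kernel_subproof A :
  pinr k (fV A) (fV A) - pcomp (pinl k (fV A) (fV A)) (fd A) \in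
  @fcommute R k (fopp A) (induced (fV A)).
Proof.
have := fhomP (@to_induced (fV A) (fopp A) (pid k (fV A))).
rewrite /= pcomp1l pcomp1r (pcompNr (pinl k _ _)) => h.
by rewrite unfold_in /fcommute /= addrC h.
Qed.

Lemma induced_cover_exact A : fexact
  (FHom (cover_kernel_subproof A)) (from_induced (pid k (fV A) : phom k _ (fV A))).
Proof.
exists (pprr k _ _), (pinl k _ _); split=> /=.
- by rewrite pcompDr pcompNr pcompA pprr_inl pprr_inr pcomp0l subr0.
- rewrite !pcomp1l pcompDl -pcompA pprr_inl pprl_inl pcomp0r addr0 //.
- rewrite !pcomp1l !pcompDl !pcompDr !pcompNr -!pcompA !(pcompA (pprl _ _ _)).
  rewrite !(pcompA (pprr _ _ _)) pprr_inl pprr_inr pprl_inl pprl_inr.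
  by rewrite !pcomp0l !pcomp0r !pcomp1l pcomp1r sub0r subr0 addNr.
- rewrite !pcomp1l !pcompDl !pcompDr pcompNl -!pcompA.
  by rewrite addrCA subrK psum_id.
Qed.

(** A homotopy factors through a free object, which is contractible, hence projective and injective.
    Conversely, the free cover of a projective [Q] splits, so the identity of [Q], and every map
    through [Q], is a boundary. *)
Lemma fnull_homotopy A B (f : fhom A B) :
  f \in @fnull R k A B <-> exists m, f = boundary m.
Proof.
split=> [/fnullP[Q [a [b [pQ _ ->]]]]|[m ->]]; last first.
  apply/fnullP; exists (induced (fV A)), (to_induced (pid k _)), (from_induced m).
  have sI := induced_contractible (fV A).
  split; [exact: contractible_projective sI | exact: contractible_injective sI |].
  by rewrite induced_factor pcomp1r.
have [l hl] := pQ _ _ _ _ _ (induced_cover_exact Q) (fid Q).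
rewrite -[b]fcomp1r -hl -[l]fcomp1l -(induced_contractible (fV Q)).
by rewrite boundary_compr !boundary_compl boundary_compr; eexists.
Qed.

End NullHomotopy.

(** * Morphisms between the objects E(x, y) *)

Lemma fpsX_expI (k : fieldType) n : injective (fun f : fps k => fpsX k ^+ n * f).
Proof.
have coefX (f : fps k) m : fcoef (fpsX k * f) m.+1 = fcoef f m.
  rewrite -[RHS]mul1r /= big_ord_recl /= mul0r add0r big_ord_recl /=.
  rewrite big1 => [|i _]; last by rewrite mul0r.
  by rewrite addr0 /bump /= subn1.
elim: n => [|n ih] f g; first by rewrite !expr0 !mul1r.
rewrite !exprSr -!mulrA => /ih e; apply: fpsP => m.
by rewrite -[LHS]coefX -[RHS]coefX e.
Qed.

Lemma fcoef0_expX (k : fieldType) n (f : fps k) : (0 < n)%N ->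
  fcoef (fpsX k ^+ n * f) 0 = 0.
Proof.
case: n => // n _; rewrite exprS -mulrA /= big_ord_recl big_ord0 /=.
by rewrite mul0r addr0.
Qed.

Section HomE.
Variables (R : realType) (k : fieldType).
Implicit Types (e : indec R) (p q r : circle R).

Lemma carry_le1 p q r : (carry p q r <= 1)%N.
Proof. by rewrite carry_arc leq_b1. Qed.

Lemma carry_return p q : p != q -> carry p q p = 1%N.
Proof. by move=> pq; rewrite carry_arc arcpp arc_gt0. Qed.

(** The half-open arcs [[p, q[] and [[q, p[] partition the circle, and [carry p q r] indicates
    whether [r] lies in the first. *)
Lemma carry_compl p q r : p != q -> (carry p q r + carry q p r = 1)%N.
Proof.
by move=> /carry_return h; have := carryA p q p r; rewrite carrypp h; lia.
Qed.

Lemma wind_small (a : R) : 0 <= a < tau R -> wind a = 0%N.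
Proof.
move=> /andP[a0 a1]; apply: (@tau_natI R).
by rewrite windE // cfrac_id ?a0 // subrr mulr0.
Qed.

Lemma texp_small (a : R) : 0 <= a < tau R -> texp k a = 1.
Proof. by move=> /wind_small ha; rewrite /texp ha expr0. Qed.

Definition ept e (c : bool) : circle R := if c then (ends e).2 else (ends e).1.

Arguments ept : simpl never.

Lemma ept_neq e c : ept e c != ept e (~~ c).
Proof. by rewrite /ept; case: c => /=; [rewrite eq_sym|]; exact: endsP. Qed.

Lemma Eobj_ppt e (c : bool) : @ppt R (fV (Eobj k e)) c = ept e c.
Proof. by case: c => /=; rewrite ?cpt_hi ?cpt_lo. Qed.

(** Both off-diagonal lengths are below [tau], so the coordinates are 1; the factor [t] of the
    square of [d] comes from a carry. *)
Lemma Eobj_fd e (i j : bool) : fd (Eobj k e) (i, j) = (i != j)%:R.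
Proof.
have t0 := lo_lt_hi e; have t1 := hi_lt_lo e.
rewrite /= ffunE; case: i; case: j => //=; rewrite texp_small //.
  by apply/andP; split; lra.
by apply/andP; split; lra.
Qed.

Section Maps.
Variables e e' : indec R.

Lemma pcomp_Ed (m : phom k (fV (Eobj k e)) (fV (Eobj k e'))) (i j : bool) :
  pcomp m (fd (Eobj k e)) (j, i) =
  fpsX k ^+ carry (ept e i) (ept e (~~ i)) (ept e' j) * m (j, ~~ i).
Proof.
rewrite pcompE (bigD1 (~~ i : pidx (fV (Eobj k e)))) //= big1 => [|b bi].
  rewrite addr0 Eobj_fd; rewrite -!Eobj_ppt; case: i => /=; rewrite mulr1 //.
by rewrite Eobj_fd; case: (b) (i) bi => -[] //= _; rewrite !mulr0.
Qed.

Lemma Ed_pcomp (m : phom k (fV (Eobj k e)) (fV (Eobj k e'))) (i j : bool) :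
  pcomp (fd (Eobj k e')) m (j, i) =
  fpsX k ^+ carry (ept e i) (ept e' (~~ j)) (ept e' j) * m (~~ j, i).
Proof.
rewrite pcompE (bigD1 (~~ j : pidx (fV (Eobj k e')))) //= big1 => [|b bi].
  rewrite addr0 Eobj_fd; rewrite -!Eobj_ppt; case: j => /=; rewrite mul1r //.
by rewrite Eobj_fd; case: (b) (j) bi => -[] //= _; rewrite !mul0r mulr0.
Qed.

(* x' in [x, y[ and y' in [y, x[, where E(x, y) = e and (x', y') are the ends
   of e' in the order determined by b *)
Definition crosses (b : bool) : bool :=
  (0 < carry (ept e false) (ept e true) (ept e' b))%N &&
  (0 < carry (ept e true) (ept e false) (ept e' (~~ b)))%N.

(** This compares the [(j, i)] entries of [f d] and [d f]; the cocycle identity [carryA] exposes a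
    common power of [t], which cancels. *)
Lemma fhom_entry (f : fhom (Eobj k e) (Eobj k e')) i j :
  carry (ept e i) (ept e (~~ i)) (ept e' (~~ j)) = 0%N ->
  fhom_val f (j, ~~ i) =
  fpsX k ^+ carry (ept e (~~ i)) (ept e' (~~ j)) (ept e' j) * fhom_val f (~~ j, i).
Proof.
move=> c0.
have := congr1 (fun g : phom k (fV (Eobj k e)) (fV (Eobj k e')) => g (j, i))
  (fhomP f).
rewrite pcomp_Ed Ed_pcomp => h.
apply: (@fpsX_expI k (carry (ept e i) (ept e (~~ i)) (ept e' j))).
rewrite /= h mulrA -exprD; congr (_ ^+ _ * _).
by rewrite addnC -carryA c0.
Qed.

(** Without a crossing both ends of [e'] lie on the same one of the two half-open arcs cut out by
    [e]. *)
Lemma ncross_null (f : fhom (Eobj k e) (Eobj k e')) :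
  (forall b, ~~ crosses b) -> f \in @fnull R k _ _.
Proof.
move=> nc; apply/fnull_homotopy.
pose z j := carry (ept e false) (ept e true) (ept e' j) == 0%N.
have z' j : ~~ z j -> carry (ept e true) (ept e false) (ept e' (~~ j)) = 0%N.
  by have := nc j; rewrite /crosses /z lt0n; case: eqP => //= _; rewrite -eqn0Ngt => /eqP.
(* The homotopy swaps the columns of [f] and keeps only the part that composition with [d] returns
   without a power of [t]. *)
exists [ffun c : bool * bool =>
  if c.2 then (if z c.1 then fhom_val f (c.1, false) else 0)
  else if z (~~ c.1) then 0 else fhom_val f (c.1, true)].
apply: val_inj; apply/ffunP => -[j i] /=.
rewrite [RHS]ffunE pcomp_Ed Ed_pcomp !ffunE /= negbK; case: i => /=.
  case: ifP => zj; first by rewrite mulr0 add0r -(@fhom_entry f false) //; apply/eqP.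
  by rewrite -[j in ept e' j]negbK z' ?zj // expr0 mul1r mulr0 addr0.
case: ifP => zj; first by rewrite mulr0 addr0 (eqP zj) expr0 mul1r.
by rewrite mulr0 add0r -(@fhom_entry f true) //; apply: z'; rewrite zj.
Qed.

(** Diagonal for [b = false] and antidiagonal for [b = true]: the first end of [e] is sent to the
    end [b] of [e']. *)
Definition cross_mx (b : bool) : phom k (fV (Eobj k e)) (fV (Eobj k e')) :=
  [ffun c : bool * bool => (c.1 == c.2 (+) b)%:R].

Lemma cross_subproof b : crosses b -> cross_mx b \in @fcommute R k _ _.
Proof.
move=> /andP[c1 c2]; apply/eqP/ffunP => -[j i].
rewrite pcomp_Ed Ed_pcomp !ffunE /=.
have -> : (j == ~~ i (+) b) = (~~ j == i (+) b) by case: i b j {c1 c2} => -[] [].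
have [h|] := eqVneq; last by rewrite !mulr0.
congr (_ ^+ _ * _); move: h c1 c2.
have n1 : ept e false != ept e true := ept_neq e false.
have k1 := carry_compl (ept e' b) n1; have k2 := carry_compl (ept e' (~~ b)) n1.
have l1 := carry_le1 (ept e true) (ept e' b) (ept e' (~~ b)).
have l2 := carry_le1 (ept e false) (ept e' (~~ b)) (ept e' b).
have m1 := carryA (ept e false) (ept e true) (ept e' b) (ept e' (~~ b)).
have m2 := carryA (ept e true) (ept e false) (ept e' (~~ b)) (ept e' b).
case: i => /= h c1 c2.
  have -> : j = b by case: (j) (b) h => -[].
  lia.
have -> : j = ~~ b by rewrite -h negbK.
rewrite negbK; lia.
Qed.

(** In position [(b, false)] both terms of a boundary are divisible by [t], since their carries are
    positive, while the entry of [cross_mx] is 1. *)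
Lemma cross_nonnull b (c : crosses b) :
  FHom (cross_subproof c) \notin @fnull R k _ _.
Proof.
apply/negP => /fnull_homotopy[m].
move/(congr1 (fun g : fhom (Eobj k e) (Eobj k e') => fhom_val g (b, false))).
rewrite [LHS]ffunE [RHS]ffunE pcomp_Ed Ed_pcomp [(b, false).1]/= eqxx.
move=> /(congr1 (fun g => fcoef g 0)).
case/andP: c => c1 c2.
have n1 : ept e false != ept e true := ept_neq e false.
have k2 := carry_compl (ept e' (~~ b)) n1.
have m1 := carryA (ept e false) (ept e true) (ept e' (~~ b)) (ept e' b).
have c3 : (0 < carry (ept e false) (ept e' (~~ b)) (ept e' b))%N by lia.
have := fcoef0_expX (m (~~ b, false)) c3; have := fcoef0_expX (m (b, true)) c1.
move=> /= -> ->; rewrite addr0 => /eqP; by rewrite oner_eq0.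
Qed.

Definition homnz : bool := crosses false || crosses true.

Lemma homnzP : homnz <-> exists f : fhom (Eobj k e) (Eobj k e'),
  f \notin @fnull R k _ _.
Proof.
rewrite /homnz; split=> [/orP[] c|[f]].
- by exists (FHom (cross_subproof c)); exact: cross_nonnull.
- by exists (FHom (cross_subproof c)); exact: cross_nonnull.
- by apply: contraR; rewrite negb_or => /andP[h1 h2]; apply: ncross_null => -[].
Qed.

End Maps.

Lemma crosses_swap e : crosses e (eswap e) true.
Proof.
by rewrite /crosses /ept /= !carry_return // ?endsP // eq_sym endsP.
Qed.

(** The exchange of summands that gives $E(x,y)\cong E(y,x+2\pi)$. *)
Definition fswap e : fhom (Eobj k e) (Eobj k (eswap e)) :=
  FHom (cross_subproof (crosses_swap e)).

Lemma eswapK e : eswap (eswap e) = e.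
Proof. by apply: val_inj; case: e => -[]. Qed.

Lemma crosses_swap' e : crosses (eswap e) e true.
Proof. by rewrite -{2}(eswapK e) crosses_swap. Qed.

Definition fswap' e : fhom (Eobj k (eswap e)) (Eobj k e) :=
  FHom (cross_subproof (crosses_swap' e)).

Lemma fswapK e : fcomp (fswap' e) (fswap e) = fid (Eobj k e).
Proof.
apply: val_inj; apply/ffunP => -[i j]; rewrite [LHS]pcompE big_bool !ffunE.
by case: i; case: j => /=; rewrite ?mulr0 ?mul0r ?mulr1 ?addr0 ?add0r ?mulr0 //;
  rewrite ?cpt_hi ?cpt_lo /= carrypp.
Qed.

Lemma fswapK' e : fcomp (fswap e) (fswap' e) = fid (Eobj k (eswap e)).
Proof.
apply: val_inj; apply/ffunP => -[i j]; rewrite [LHS]pcompE big_bool !ffunE.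
by case: i; case: j => /=; rewrite ?mulr0 ?mul0r ?mulr1 ?addr0 ?add0r ?mulr0 //;
  rewrite ?cpt_hi ?cpt_lo /= carrypp.
Qed.

End HomE.

(** * Arcs of the circle as edges *)

Section Edges.
Variable R : realType.
Implicit Types (e a b c : indec R) (p q r v w x y z : circle R).

(** Membership in the half-open arc [[x, y[] for [e = E(x, y)]. *)
Definition inarc e p : bool := (0 < carry (ends e).1 (ends e).2 p)%N.

Lemma homnzE e e' :
  homnz e e' = inarc e (ends e').1 (+) inarc e (ends e').2.
Proof.
rewrite /homnz /crosses /ept /= /inarc.
have k1 := carry_compl (ends e').1 (endsP e).
have k2 := carry_compl (ends e').2 (endsP e).
have -> : (0 < carry (ends e).2 (ends e).1 (ends e').1)%N =
  ~~ (0 < carry (ends e).1 (ends e).2 (ends e').1)%N by lia.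
have -> : (0 < carry (ends e).2 (ends e).1 (ends e').2)%N =
  ~~ (0 < carry (ends e).1 (ends e).2 (ends e').2)%N by lia.
by case: (0 < _)%N; case: (0 < _)%N.
Qed.

Lemma inarc_swap e p : inarc (eswap e) p = ~~ inarc e p.
Proof. by have := carry_compl p (endsP e); rewrite /inarc /=; lia. Qed.

Lemma homnz_swapl e e' : homnz (eswap e) e' = homnz e e'.
Proof. by rewrite !homnzE !inarc_swap addbN addNb negbK. Qed.

Lemma homnz_swapr e e' : homnz e (eswap e') = homnz e e'.
Proof. by rewrite !homnzE /= addbC. Qed.

Lemma cpt_small (s t : R) : 0 <= s < 4 -> 0 <= t < 4 -> cpt s = cpt t -> s = t.
Proof.
move=> /andP[s0 s4] /andP[t0 t4] st.
have t4' : 4 <= tau R by rewrite /tau; have := @pi_ge2 R; lra.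
have : arc (cpt 0) (cpt s) = arc (cpt 0) (cpt t) by rewrite st.
by rewrite !arc_cpt ?subr0 ?add0r // ?s0 ?t0 /=; lra.
Qed.

(** One of the points of 0, 1 and 2, distinct because [4 <= tau], avoids both [x] and [y]. *)
Lemma third_point x y : exists z, x != z /\ y != z.
Proof.
have h01 : cpt (0 : R) != cpt 1.
  by apply/eqP => /cpt_small; rewrite ?lexx /=; lra.
have h02 : cpt (0 : R) != cpt 2.
  by apply/eqP => /cpt_small; rewrite ?lexx /=; lra.
have h12 : cpt (1 : R) != cpt 2.
  by apply/eqP => /cpt_small; rewrite ?lexx /=; lra.
have [e0|n0] := boolP ((x != cpt 0) && (y != cpt 0)).
  by exists (cpt 0); apply/andP.
have [e1|n1] := boolP ((x != cpt 1) && (y != cpt 1)).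
  by exists (cpt 1); apply/andP.
exists (cpt 2); apply/andP; move: n0 n1; rewrite !negb_and !negbK.
case/orP => /eqP ->; rewrite ?(negPf h01) /=.
  by move=> /eqP ->; rewrite h02.
by rewrite orbF => /eqP ->; rewrite h12.
Qed.

Lemma edge0_subproof : (cpt (0 : R), cpt (1 : R)).1 != (cpt (0 : R), cpt (1 : R)).2.
Proof.
by apply/eqP => /cpt_small; rewrite ?lexx /=; lra.
Qed.

(* E(x, y) when x and y are distinct, and a junk value otherwise *)
Definition edge x y : indec R := insubd (Indec edge0_subproof) (x, y).

Lemma ends_edge x y : x != y -> ends (edge x y) = (x, y).
Proof. by move=> xy; rewrite -[LHS]/(val _) val_insubd /= xy. Qed.

Lemma edgeE e : e = edge (ends e).1 (ends e).2.
Proof.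
by apply: val_inj; rewrite -[RHS]/(ends _) ends_edge ?endsP // -surjective_pairing.
Qed.

Lemma eswap_edge x y : x != y -> eswap (edge x y) = edge y x.
Proof.
move=> xy; apply: val_inj.
by rewrite -[LHS]/(_, _) -[RHS]/(ends _) !ends_edge // eq_sym.
Qed.

Definition on x e : bool := (x == (ends e).1) || (x == (ends e).2).

Lemma on_swap x e : on x (eswap e) = on x e.
Proof. by rewrite /on /= orbC. Qed.

Lemma on_edge w x y : x != y -> on w (edge x y) = (w == x) || (w == y).
Proof. by move=> xy; rewrite /on ends_edge. Qed.

(** Reduces a property invariant under exchange of ends to edges that start at the chosen end
    [x]. *)
Lemma edge_ind (P : indec R -> Prop) x e :
  (forall e, P e -> P (eswap e)) -> on x e ->
  (forall y, x != y -> P (edge x y)) -> P e.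
Proof.
move=> Pswap /orP[] /eqP ex Pe.
  by rewrite (edgeE e) -ex; apply: Pe; rewrite ex endsP.
have n : x != (ends e).1 by rewrite ex eq_sym endsP.
by rewrite (edgeE e) -ex -eswap_edge //; apply/Pswap/Pe.
Qed.

Lemma on_inj x y e e' : x != y -> on x e -> on y e -> on x e' -> on y e' ->
  e = e' \/ e = eswap e'.
Proof.
move=> xy; have one f : on x f -> on y f -> f = edge x y \/ f = edge y x.
  move=> xf yf; rewrite (edgeE f).
  move: xf yf xy => /orP[] /eqP -> /orP[] /eqP ->; rewrite ?eqxx //; by [left|right].
move=> xe ye xe' ye'.
have [ ] := one e xe ye; have [ ] := one e' xe' ye' => -> ->; rewrite ?eswap_edge //;
  by [left | right | rewrite eq_sym].
Qed.

Definition adj e e' : bool := homnz e e' && ~~ homnz e' e.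

Lemma adj_swapl e e' : adj (eswap e) e' = adj e e'.
Proof. by rewrite /adj homnz_swapl homnz_swapr. Qed.
Lemma adj_swapr e e' : adj e (eswap e') = adj e e'.
Proof. by rewrite /adj homnz_swapl homnz_swapr. Qed.

Lemma homnz_edge x y z : x != y -> x != z ->
  homnz (edge x y) (edge x z) = (arc x y <= arc x z).
Proof.
move=> xy xz; rewrite homnzE /inarc !ends_edge //= carry_return //=.
by rewrite carry_arc lt0b leNgt.
Qed.

(** On the star of [x], adjacency is thus the strict linear order by arc length. *)
Lemma adj_edge x y z : x != y -> x != z ->
  adj (edge x y) (edge x z) = (arc x y < arc x z).
Proof. by move=> xy xz; rewrite /adj !homnz_edge // -ltNge andb_idl // => /ltW. Qed.

Lemma carry_rot p q r : p != q -> p != r -> carry p q r = carry q r p.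
Proof.
by move=> pq pr; have := carryA p q r p; rewrite !carry_return //; lia.
Qed.

(** For disjoint pairs of ends, both sides say that the chords cross. After rotation of the carries
    this is the parity of one instance of [carryA]. *)
Lemma homnz_disjoint e e' : (forall x, ~~ (on x e && on x e')) ->
  homnz e e' = homnz e' e.
Proof.
move=> dis; rewrite !homnzE /inarc.
have m p q : on p e -> on q e' -> p != q.
  by move=> pe qe; apply: contra (dis p) => /eqP e1; rewrite pe e1 qe.
have [x1 y1 u1 v1] : [/\ on (ends e).1 e, on (ends e).2 e,
    on (ends e').1 e' & on (ends e').2 e'] by rewrite /on !eqxx !orbT.
have := endsP e; have := endsP e'.
set x := (ends e).1 in x1 *; set y := (ends e).2 in y1 *.
set u := (ends e').1 in u1 *; set v := (ends e').2 in v1 * => uv xy.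
have [xu xv yu yv] := And4 (m _ _ x1 u1) (m _ _ x1 v1) (m _ _ y1 u1) (m _ _ y1 v1).
rewrite -(carry_rot xu xv) -(carry_rot yu yv).
have := carryA x y u v.
have := carry_le1 x u v; have := carry_le1 y u v.
have := carry_le1 x y u; have := carry_le1 x y v.
by do 4![case: (carry _ _ _) => [|[|?]] //].
Qed.

(** With no shared end [homnz] is symmetric, and with two the edges agree up to exchange; both
    contradict the asymmetry in [adj]. *)
Lemma adjW e e' : adj e e' -> exists x,
  [/\ on x e, on x e' & forall w, on w e -> on w e' -> w = x].
Proof.
move=> ee'.
have [[x /andP[xe xe']]|dis] := pselect (exists x, on x e && on x e'); last first.
  move: ee'; rewrite /adj homnz_disjoint ?andbN // => x.
  by apply/negP => h; apply: dis; exists x.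
exists x; split=> // w we we'; apply/eqP; apply: contraT => wx.
suff : ~~ adj e e' by rewrite ee'.
have [->|->] := on_inj wx we xe we' xe'; rewrite ?adj_swapl /adj;
  by case: (homnz _ _).
Qed.

(** Sharing exactly one end, by [touchW] and [touch_edge], but phrased through adjacency so that
    automorphisms preserve it. *)
Definition touch e e' : bool := adj e e' || adj e' e.

Lemma touchW e e' : touch e e' -> exists x,
  [/\ on x e, on x e' & forall w, on w e -> on w e' -> w = x].
Proof.
case/orP => /adjW // [x [h1 h2 h3]]; exists x; split=> // w k1 k2.
exact: h3.
Qed.

Lemma touch_edge x y z : x != y -> x != z -> y != z ->
  touch (edge x y) (edge x z).
Proof.
move=> xy xz yz; rewrite /touch !adj_edge // -neq_lt.
by rewrite (inj_eq (@arc_inj R x)).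
Qed.

(** All three edges may be taken to start at [v], where adjacency is a strict order. *)
Lemma star_acyclic v a b c : on v a -> on v b -> on v c ->
  adj a b -> adj b c -> adj c a -> False.
Proof.
move=> va vb vc; pose P a b c := adj a b -> adj b c -> adj c a -> False.
apply: (edge_ind (P := fun a => P a b c) _ va) => [e|x vx].
  by rewrite /P adj_swapl adj_swapr.
apply: (edge_ind (P := fun b => P _ b c) _ vb) => [e|y vy].
  by rewrite /P adj_swapl adj_swapr.
apply: (edge_ind (P := fun c => P _ _ c) _ vc) => [e|z vz].
  by rewrite /P adj_swapl adj_swapr.
rewrite /P !adj_edge // => h1 h2 h3.
by have := lt_trans h1 (lt_trans h2 h3); rewrite ltxx.
Qed.

Definition cyclic3 a b c := [&& adj a b, adj b c & adj c a].

(** Each adjacency between sides is the vanishing of a carry of the vertices. Rotation identifies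
    the three carries of each cycle, and the orientation of [x, y, z] selects the cycle. *)
Lemma triangle_cyclic x y z : x != y -> y != z -> x != z ->
  cyclic3 (edge x y) (edge z x) (edge y z) ||
  cyclic3 (edge x y) (edge y z) (edge z x).
Proof.
move=> xy yz xz.
have [yx zy zx] : [/\ y != x, z != y & z != x].
  by split; rewrite eq_sym.
have A p q r : p != q -> p != r -> q != r ->
    adj (edge p q) (edge p r) = ~~ (0 < carry p q r)%N.
  move=> pq pr qr; rewrite adj_edge // carry_arc lt0b -leNgt le_eqVlt.
  by rewrite (inj_eq (@arc_inj R p)) (negPf qr).
have r1 := carry_rot xy xz; have r2 := carry_rot yz yx.
have c1 := carry_compl z xy; have r3 := carry_rot yx yz; have r4 := carry_rot xz xy.
rewrite /cyclic3.
have -> : adj (edge x y) (edge z x) = ~~ (0 < carry x y z)%N.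
  by rewrite -(eswap_edge xz) adj_swapr A.
have -> : adj (edge z x) (edge y z) = ~~ (0 < carry z x y)%N.
  by rewrite -(eswap_edge zy) adj_swapr A.
have -> : adj (edge y z) (edge x y) = ~~ (0 < carry y z x)%N.
  by rewrite -(eswap_edge yx) adj_swapr A.
have -> : adj (edge x y) (edge y z) = ~~ (0 < carry y x z)%N.
  by rewrite -(eswap_edge yx) adj_swapl A.
have -> : adj (edge y z) (edge z x) = ~~ (0 < carry z y x)%N.
  by rewrite -(eswap_edge zy) adj_swapl A.
have -> : adj (edge z x) (edge x y) = ~~ (0 < carry x z y)%N.
  by rewrite -(eswap_edge xz) adj_swapl A.
lia.
Qed.

(** The pairwise common ends are distinct, so the edges are the sides of a triangle. With
    [star_acyclic], adjacency alone tells stars from triangles. *)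
Lemma no_common_cyclic a b c : touch a b -> touch b c -> touch a c ->
  ~ (exists x, [/\ on x a, on x b & on x c]) ->
  cyclic3 a b c || cyclic3 a c b.
Proof.
have sw1 a' b' c' : cyclic3 (eswap a') b' c' = cyclic3 a' b' c'.
  by rewrite /cyclic3 adj_swapl adj_swapr.
have sw2 a' b' c' : cyclic3 a' (eswap b') c' = cyclic3 a' b' c'.
  by rewrite /cyclic3 adj_swapl adj_swapr.
have sw3 a' b' c' : cyclic3 a' b' (eswap c') = cyclic3 a' b' c'.
  by rewrite /cyclic3 adj_swapl adj_swapr.
move=> /touchW[x [xa xb xu]] /touchW[y [yb yc yu]] /touchW[z [za zc zu]] no.
have xy : x != y by apply: contra_notN no => /eqP e; exists x; split=> //; rewrite e.
have xz : x != z by apply: contra_notN no => /eqP e; exists x; split=> //; rewrite e.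
have yz : y != z.
  by apply: contra_notN no => /eqP e; exists y; split=> //; rewrite e.
have eE p q e : p != q -> on p e -> on q e -> e = edge p q \/ e = eswap (edge p q).
  move=> pq pe qe; apply: (on_inj pq) => //; rewrite on_edge // eqxx ?orbT //.
have zx : z != x by rewrite eq_sym.
have zy : z != y by rewrite eq_sym.
have := triangle_cyclic zx xy zy; rewrite orbC.
by have [->|->] := eE _ _ _ zx za xa; have [->|->] := eE _ _ _ xy xb yb;
  have [->|->] := eE _ _ _ yz yc zc; rewrite ?(sw1, sw2, sw3).
Qed.

(** * From edge maps preserving nonzero Hom to homeomorphisms *)

Section VertexMap.
Variable Phi : indec R -> indec R.
Hypothesis Phi_homnz : forall e e', homnz (Phi e) (Phi e') = homnz e e'.
Hypothesis Phi_swap : forall e, Phi (eswap e) = eswap (Phi e).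
Hypothesis Phi_surj : forall e, exists e', Phi e' = e.

Let Phi_adj e e' : adj (Phi e) (Phi e') = adj e e'.
Proof. by rewrite /adj !Phi_homnz. Qed.
Let Phi_touch e e' : touch (Phi e) (Phi e') = touch e e'.
Proof. by rewrite /touch !Phi_adj. Qed.
Let Phi_cyclic3 a b c : cyclic3 (Phi a) (Phi b) (Phi c) = cyclic3 a b c.
Proof. by rewrite /cyclic3 !Phi_adj. Qed.

(** The images of two edges at [x] meet in a single end [v]. If the image of a third edge missed
    [v], the three images would form a cycle, and so would the original star. *)
Let star_image x : exists v, forall e, on x e -> on v (Phi e).
Proof.
have [y [xy _]] := third_point x x; have [z [xz yz]] := third_point x y.
have [v [v1 v2 vu]] : exists v, [/\ on v (Phi (edge x y)), on v (Phi (edge x z))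
    & forall w, on w (Phi (edge x y)) -> on w (Phi (edge x z)) -> w = v].
  by apply: touchW; rewrite Phi_touch touch_edge.
exists v => e xe; apply: (edge_ind (P := fun e => on v (Phi e)) _ xe) => {e xe} [e|w xw].
  by rewrite Phi_swap on_swap.
have [<-//|yw] := eqVneq y w; have [<-//|zw] := eqVneq z w.
apply: contrapT => nv.
have xon t : x != t -> on x (edge x t) by move=> xt; rewrite on_edge // eqxx.
have acy a b c : on x a -> on x b -> on x c -> ~~ cyclic3 a b c.
  move=> xa xb xc; apply/negP => /and3P[h1 h2 h3].
  exact: (star_acyclic xa xb xc h1 h2 h3).
have [t [t1 t2 t3]] : exists t,
    [/\ on t (Phi (edge x y)), on t (Phi (edge x z)) & on t (Phi (edge x w))].
  apply: contrapT => /no_common_cyclic.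
  rewrite !Phi_touch !touch_edge // !Phi_cyclic3.
  rewrite (negPf (acy _ _ _ _ _ _)) ?xon // (negPf (acy _ _ _ _ _ _)) ?xon //.
  by move=> /(_ isT isT isT).
by apply: nv; rewrite -(vu t t1 t2).
Qed.

Lemma edge_vertex_map : exists f : homeo R, forall e,
  Phi e = homeo_indec f e \/ Phi e = eswap (homeo_indec f e).
Proof.
have [phi hphi] : exists phi : circle R -> circle R,
    forall x e, on x e -> on (phi x) (Phi e).
  by have [phi h] := boolp.choice star_image; exists phi.
have xon t u : t != u -> on t (edge t u) by move=> xt; rewrite on_edge // eqxx.
have yon t u : t != u -> on u (edge t u).
  by move=> xt; rewrite on_edge // eqxx orbT.
(* If [x] and [y] had the same image, the sides of a triangle would be sent to a star that is still
   cyclic. *)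
have iphi : injective phi.
  move=> x y e; apply/eqP; apply: contraT => xy.
  have [z [xz yz]] := third_point x y; have zx : z != x by rewrite eq_sym.
  have v1 : on (phi x) (Phi (edge x y)) by rewrite hphi ?xon.
  have v2 : on (phi x) (Phi (edge z x)) by rewrite hphi ?yon.
  have v3 : on (phi x) (Phi (edge y z)) by rewrite e hphi ?xon.
  have := triangle_cyclic xy yz xz; rewrite -Phi_cyclic3 -(Phi_cyclic3 _ (edge y z)).
  case/orP => /and3P[h1 h2 h3].
    by case: (star_acyclic v1 v2 v3 h1 h2 h3).
  by case: (star_acyclic v1 v3 v2 h1 h2 h3).
have Phi_edge x y : x != y -> Phi (edge x y) = edge (phi x) (phi y) \/
    Phi (edge x y) = eswap (edge (phi x) (phi y)).
  move=> xy; have fxy : phi x != phi y by rewrite (inj_eq iphi).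
  by apply: (on_inj fxy); rewrite ?xon ?yon // hphi ?xon ?yon.
(* Preimages of two edges meeting only in [v] touch, and their common end is sent to [v]. *)
have sphi v : exists x, phi x = v.
  have [y [vy _]] := third_point v v; have [z [vz yz]] := third_point v y.
  have [e1 h1] := Phi_surj (edge v y); have [e2 h2] := Phi_surj (edge v z).
  have [x [x1 x2 _]] : exists x, [/\ on x e1, on x e2 &
      forall w, on w e1 -> on w e2 -> w = x].
    by apply: touchW; rewrite -Phi_touch h1 h2 touch_edge.
  exists x; have := hphi _ _ x1; have := hphi _ _ x2; rewrite h1 h2 !on_edge //.
  case/orP => /eqP -> /orP[] /eqP //.
  by move=> zy; rewrite zy eqxx in yz.
(* For distinct points a carry at [p] is an adjacency of edges starting at [p], which [Phi]
   preserves. *)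
have [|f hf] := carry_homeo sphi.
  move=> p q r; rewrite !carry_arc.
  have [->|pq] := eqVneq p q; first by rewrite !arcpp !ltNge !arc_ge0.
  have fpq : phi p != phi q by rewrite (inj_eq iphi).
  have [<-|pr] := eqVneq p r; first by rewrite !arcpp !arc_gt0.
  have fpr : phi p != phi r by rewrite (inj_eq iphi).
  rewrite -!adj_edge // -(Phi_adj (edge p r)).
  by have [->|->] := Phi_edge _ _ pq; have [->|->] := Phi_edge _ _ pr;
    rewrite ?(adj_swapl, adj_swapr).
exists f => e; have {1 3}-> := edgeE e.
have -> : homeo_indec f e = edge (phi (ends e).1) (phi (ends e).2).
  apply: val_inj; rewrite -[RHS]/(ends _) ends_edge ?(inj_eq iphi) ?endsP //=.
  by rewrite !hf.
by apply: Phi_edge; exact: endsP.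
Qed.

End VertexMap.

(** If [f x] differed from [g x], then [f x = g y] for every other [y], against injectivity of
    [g]. *)
Lemma homeo_edge_inj (f g : homeo R) :
  (forall e, homeo_indec f e = homeo_indec g e \/
             homeo_indec f e = eswap (homeo_indec g e)) -> f = g.
Proof.
move=> h; apply: homeo_ext => x; apply/eqP; apply: contraT => nx.
have fon y : x != y -> f x = g y.
  move=> xy; have [] := h (edge x y) => /(congr1 (@ends R)) /=;
  rewrite ends_edge //= => -[e1 e2] //; by rewrite e1 eqxx in nx.
have [y [xy _]] := third_point x x; have [z [xz yz]] := third_point x y.
by have := homeo_inj (etrans (esym (fon y xy)) (fon z xz)) => e; rewrite e eqxx in yz.
Qed.

(** A half-open arc contains its start but not its end. If the starts [x] and [u] differed, going
    from [u] one would meet [y] before [x], so [y] would lie in the arc. *)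
Lemma inarc_inj e e' : inarc e =1 inarc e' -> e = e'.
Proof.
rewrite (edgeE e) (edgeE e'); move: (endsP e) (endsP e').
set x := (ends e).1; set y := (ends e).2; set u := (ends e').1.
set v := (ends e').2 => xy uv; rewrite /inarc !ends_edge //= => h.
have h' p : (arc x p < arc x y) = (arc u p < arc u v).
  by have := h p; rewrite !carry_arc !lt0b.
have xu : x = u.
  apply/eqP; apply: contraT => xu.
  have c0 : carry x u y = 0%N.
    by apply/eqP; rewrite carry_arc eqb0 -leNgt ltW // h' arcpp arc_gt0.
  have uyx : arc u y < arc u x.
    by have := carry_compl y xu; rewrite c0 carry_arc; case: ltP.
  have ux : arc u x < arc u v by rewrite -h' arcpp arc_gt0.
  by have : arc x y < arc x y; [rewrite h' (lt_trans uyx ux) | rewrite ltxx].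
rewrite -xu in h' *; congr edge; apply: (@arc_inj R x); apply/eqP.
have := h' v; have := h' y; rewrite !ltxx => e1 e2.
by rewrite eq_le !leNgt e2 -e1.
Qed.

(** The edge from [p] to [q] detects whether [inarc e] changes between them. So the two arcs are
    equal or complementary, and [eswap] gives the complement. *)
Lemma homnz_inj e e' : (forall a, homnz e a = homnz e' a) ->
  e = e' \/ e = eswap e'.
Proof.
move=> h; pose d p := inarc e p (+) inarc e' p.
have hd p q : d p = d q.
  have [->//|pq] := eqVneq p q.
  have := h (edge p q); rewrite !homnzE ends_edge //= /d.
  by do 4!case: (inarc _ _).
have [d0|d0] := boolP (d (ends e).1).
  right; apply: inarc_inj => p; rewrite inarc_swap.
  by move: d0; rewrite (hd _ p) /d; do 2!case: (inarc _ _).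
left; apply: inarc_inj => p.
by move: d0; rewrite (hd _ p) /d; do 2!case: (inarc _ _).
Qed.

End Edges.

(** * The action of an automorphism on the circle *)

Section StableCategory.
Variables (R : realType) (k : fieldType).
Implicit Types (A B C D : fobj R k) (X Y Z : cobj R) (e : indec R).

Lemma scompA A B C D (h : shom C D) (g : shom B C) (f : shom A B) :
  scomp h (scomp g f) = scomp (scomp h g) f.
Proof.
by rewrite -[f]sclassK -[g]sclassK -[h]sclassK !scompE fcompA.
Qed.
Lemma scomp1l A B (f : shom A B) : scomp (sid B) f = f.
Proof. by rewrite -[f]sclassK /sid scompE fcomp1l. Qed.
Lemma scomp1r A B (f : shom A B) : scomp f (sid A) = f.
Proof. by rewrite -[f]sclassK /sid scompE fcomp1r. Qed.

Lemma sclass0 A B : sclass (0 : fhom A B) = 0.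
Proof. by apply: (addrI (sclass 0)); rewrite -sclassD !addr0. Qed.
Lemma sclass_eq0 A B (f : fhom A B) : sclass f = 0 <-> f \in @fnull R k A B.
Proof. by rewrite -(sclass0 A B) -[f in f \in _]subr0; exact: sclass_eq. Qed.
Lemma scomp0l A B C (f : shom A B) : scomp (0 : shom B C) f = 0.
Proof. by rewrite -[f]sclassK -sclass0 scompE fcomp0l sclass0. Qed.
Lemma fsum0_id A : fcomp (finl A (fzero R k)) (fprl A (fzero R k)) = fid _.
Proof.
by rewrite -fsum_id [fprr _ _]fzero_ext fcomp0r addr0.
Qed.

(** [cF [:: e]] is [Eobj e] plus a zero object, so [homnzP] is transported along the inclusion and
    projection of the first summand. *)
Lemma homnz_chom e e' : homnz e e' <-> exists f : chom k [:: e] [:: e'], f <> 0.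
Proof.
rewrite homnzP; split=> [[f nf]|[f nf]].
  exists (sclass (fcomp (finl _ _) (fcomp f (fprl _ _)))).
  move/sclass_eq0 => h; case/negP: nf.
  rewrite -[f]fcomp1l -[f]fcomp1r -(fprl_inl (Eobj k e) (fzero R k)).
  rewrite -[X in fcomp X _](fprl_inl (Eobj k e') (fzero R k)).
  rewrite -!fcompA; apply: fnull_compl; rewrite !fcompA.
  by apply: fnull_compr; rewrite -!fcompA.
exists (fcomp (fprl _ _) (fcomp (repr f) (finl _ _))).
apply/negP => h; apply: nf; rewrite -[f]sclassK; apply/sclass_eq0.
rewrite -[repr f]fcomp1l -[repr f]fcomp1r -!fsum0_id.
rewrite -!fcompA; apply: fnull_compl; rewrite !fcompA.
by apply: fnull_compr; rewrite -!fcompA.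
Qed.

Lemma ciso_refl X : ciso k X X.
Proof. by exists (sid _), (sid _); rewrite scomp1l. Qed.

Lemma ciso_sym X Y : ciso k X Y -> ciso k Y X.
Proof. by case=> f [g [h1 h2]]; exists g, f. Qed.

Lemma siso_comp A B C (g : shom B C) (f : shom A B) :
  is_siso g -> is_siso f -> is_siso (scomp g f).
Proof.
move=> [g' [g1 g2]] [f' [f1 f2]]; exists (scomp f' g').
by rewrite -!scompA (scompA g') g1 scomp1l f1 (scompA f) f2 scomp1l g2.
Qed.

Lemma ciso_trans X Y Z : ciso k X Y -> ciso k Y Z -> ciso k X Z.
Proof.
by move=> [f hf] [g hg]; exists (scomp g f); exact: siso_comp.
Qed.

Lemma siso_sclass A B (f : fhom A B) (g : fhom B A) :
  fcomp g f = fid A -> fcomp f g = fid B -> is_siso (sclass f).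
Proof. by move=> h1 h2; exists (sclass g); rewrite !scompE h1 h2. Qed.

Lemma fsumhom_comp A B C A' B' C' (g : fhom B C) (f : fhom A B)
    (g' : fhom B' C') (f' : fhom A' B') :
  fcomp (fsumhom g g') (fsumhom f f') = fsumhom (fcomp g f) (fcomp g' f').
Proof.
rewrite /fsumhom fcompDl !fcompDr -!fcompA (fcompA (fprl _ _)) (fcompA (fprl _ _)).
rewrite (fcompA (fprr _ _)) (fcompA (fprr _ _)) fprl_inl fprl_inr fprr_inl fprr_inr.
by rewrite !fcomp0l !fcomp0r !fcomp1l addr0 add0r.
Qed.

Lemma fsumhom_id A B : fsumhom (fid A) (fid B) = fid (fsum A B).
Proof. by rewrite /fsumhom !fcomp1l fsum_id. Qed.

Lemma ciso_cons_eswap e X : ciso k (eswap e :: X) (e :: X).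
Proof.
exists (sclass (fsumhom (fswap' k e) (fid (cF k X)))).
by apply: (@siso_sclass _ _ _ (fsumhom (fswap k e) (fid _)));
  rewrite fsumhom_comp ?fswapK ?fswapK' fcomp1l fsumhom_id.
Qed.

Lemma ciso_cons e X Y : ciso k X Y -> ciso k (e :: X) (e :: Y).
Proof.
case=> f [g [fg gf]].
pose S U V (h : chom k U V) : chom k (e :: U) (e :: V) :=
  scomp (sclass (finl _ _)) (sclass (fprl _ _)) +
  scomp (sclass (finr _ _)) (scomp h (sclass (fprr _ _))).
have SE U V (h : fhom (cF k U) (cF k V)) : S U V (sclass h) =
    sclass (fsumhom (fid (Eobj k e)) h).
  by rewrite /S !scompE -sclassD /fsumhom fcomp1l.
have SC U V W (h' : chom k V W) (h : chom k U V) :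
    scomp (S _ _ h') (S _ _ h) = S _ _ (scomp h' h).
  rewrite -[h]sclassK -[h']sclassK scompE !SE scompE fsumhom_comp.
  by rewrite fcomp1l.
have S1 U : S _ _ (sid (cF k U)) = sid (cF k (e :: U)).
  by rewrite SE fsumhom_id.
by exists (S _ _ f), (S _ _ g); rewrite !SC fg gf !S1.
Qed.

(** Isomorphic objects have nonzero morphisms to the same edges, and these determine an edge up to
    exchange. *)
Lemma ciso_edge e e' : ciso k [:: e] [:: e'] <-> e = e' \/ e = eswap e'.
Proof.
split=> [h|[->|->]]; [|exact: ciso_refl|exact: ciso_cons_eswap].
apply: homnz_inj => a.
have half b c : ciso k [:: b] [:: c] -> homnz b a -> homnz c a.
  move=> [f [g [fg gf]]] /homnz_chom[u nu]; apply/homnz_chom.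
  exists (scomp u g) => z; apply: nu.
  by rewrite -[u]scomp1r -fg scompA z scomp0l.
by apply/idP/idP; apply: half => //; exact: ciso_sym.
Qed.

End StableCategory.

(** * The homeomorphism attached to an automorphism *)

Section Automorphisms.
Variables (R : realType) (k : fieldType).
Implicit Types (F G : caut R k) (X Y Z : cobj R) (e : indec R) (f g : homeo R).

Lemma cendo_cat (F : cendo R k) X Y : F (X ++ Y) = F X ++ F Y.
Proof. by have [_ _ [_ -> _] _] := cendoP F. Qed.
Lemma cendo_nil (F : cendo R k) : F [::] = [::].
Proof. by have [_ _ [-> _ _] _] := cendoP F. Qed.
Lemma cendo_shift (F : cendo R k) X : F (cshift X) = cshift (F X).
Proof. by have [_ _ _ [-> _ _]] := cendoP F. Qed.
Lemma cendo_hom0 (F : cendo R k) X Y : chom_map F (0 : chom k X Y) = 0.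
Proof.
have [_ h _ _] := cendoP F.
by have := h X Y (-1) 0 0; rewrite scaler0 addr0 scaleN1r addNr.
Qed.

(** Strict additivity gives an invertible map of free monoids of lists. An image with two or more
    terms would return under [G] as two nonempty lists. *)
Lemma cendo_single (F G : cendo R k) : cendo_comp F G = cendo1 R k ->
  cendo_comp G F = cendo1 R k -> forall e, exists e', F [:: e] = [:: e'].
Proof.
move=> FG GF e.
have GFX X : G (F X) = X by exact: (congr1 (fun H : cendo R k => H X) GF).
have FGX X : F (G X) = X by exact: (congr1 (fun H : cendo R k => H X) FG).
case h : (F [:: e]) => [|a [|b l]]; last 2 first.
- by exists a.
- have := GFX [:: e]; rewrite h -cat1s cendo_cat.
  case ha : (G [:: a]) => [|c u]; first by have := FGX [:: a]; rewrite ha cendo_nil.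
  case hb : (G (b :: l)) => [|d v]; first by have := FGX (b :: l); rewrite hb cendo_nil.
  by case: u {ha}.
- by have := GFX [:: e]; rewrite h cendo_nil.
Qed.

Lemma cendo_homnz (F G : cendo R k) : cendo_comp G F = cendo1 R k ->
  forall e e' a a', F [:: e] = [:: a] -> F [:: e'] = [:: a'] ->
  homnz e e' -> homnz a a'.
Proof.
move=> GF e e' a a' h h' /(homnz_chom k)[u nu]; apply/(homnz_chom k).
rewrite -h -h'; exists (chom_map F u) => z; apply: nu.
have : arrow (chom_map G (chom_map F u)) = arrow u.
  exact: (congr1 (fun H : cendo R k => arrow (chom_map H u)) GF).
have GFX X : G (F X) = X by exact: (congr1 (fun H : cendo R k => H X) GF).
rewrite z cendo_hom0; move: (GFX [:: e]) (GFX [:: e']).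
move: (G (F [:: e])) (G (F [:: e'])) => X Y eX eY.
by case: _ / eX in u z *; case: _ / eY in u z * => /arrow_inj.
Qed.

(** Edges are permuted, [F] and its inverse both preserve nonzero Hom, and strict commutation with
    the shift is compatibility with [eswap]; so [edge_vertex_map] applies. *)
Lemma caut_homeo F : exists f, forall e,
  F [:: e] = [:: homeo_indec f e] \/ F [:: e] = [:: eswap (homeo_indec f e)].
Proof.
have [G [FG GF]] := cautP F.
have [phi hphi] := boolp.choice (cendo_single FG GF).
have [psi hpsi] := boolp.choice (cendo_single GF FG).
have phiK e : psi (phi e) = e.
  have : G (F [:: e]) = [:: e] by exact: (congr1 (fun H : cendo R k => H [:: e]) GF).
  by rewrite hphi hpsi => -[].
have psiK e : phi (psi e) = e.
  have : F (G [:: e]) = [:: e] by exact: (congr1 (fun H : cendo R k => H [:: e]) FG).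
  by rewrite hpsi hphi => -[].
have [e e'||e|f hf] := @edge_vertex_map R phi.
- apply/idP/idP; last by apply: (cendo_homnz GF).
  by apply: (cendo_homnz FG); rewrite hpsi phiK.
- by move=> e; have := cendo_shift F [:: e]; rewrite /= !hphi => -[].
- by exists (psi e).
- by exists f => e; rewrite hphi; have [->|->] := hf e; [left|right].
Qed.

Lemma ciso_homeo_inj (F : cendo R k) f g :
  (forall e, ciso k (F [:: e]) [:: homeo_indec f e]) ->
  (forall e, ciso k (F [:: e]) [:: homeo_indec g e]) -> f = g.
Proof.
move=> hf hg; apply: homeo_edge_inj => e; apply/(ciso_edge k).
exact: ciso_trans (ciso_sym (hf e)) (hg e).
Qed.

Lemma homeo_indec_swap f e : homeo_indec f (eswap e) = eswap (homeo_indec f e).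
Proof. exact: val_inj. Qed.

Lemma homeo_indec_comp f g e :
  homeo_indec (homeo_comp f g) e = homeo_indec f (homeo_indec g e).
Proof. exact: val_inj. Qed.

Lemma homeo_indec1 e : homeo_indec (homeo1 R) e = e.
Proof. by apply: val_inj; case: e => -[]. Qed.

Definition vertex_map F : homeo R := sval (boolp.cid (caut_homeo F)).

Lemma vertex_mapP F e : F [:: e] = [:: homeo_indec (vertex_map F) e] \/
  F [:: e] = [:: eswap (homeo_indec (vertex_map F) e)].
Proof. exact: (svalP (boolp.cid (caut_homeo F))). Qed.

Lemma vertex_map_ciso F e : ciso k (F [:: e]) [:: homeo_indec (vertex_map F) e].
Proof.
have [->|->] := vertex_mapP F e; [exact: ciso_refl|exact: ciso_cons_eswap].
Qed.

Lemma vertex_map_unique F f :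
  vertex_map F = f <-> forall e, ciso k (F [:: e]) [:: homeo_indec f e].
Proof.
split=> [<- e|h]; first exact: vertex_map_ciso.
by apply: (@ciso_homeo_inj F) => // e; exact: vertex_map_ciso.
Qed.

Lemma vertex_map_comp F G :
  vertex_map (caut_comp F G) = homeo_comp (vertex_map F) (vertex_map G).
Proof.
apply/vertex_map_unique => e; rewrite -[X in ciso _ X]/(F (G [:: e])) homeo_indec_comp.
have [->|->] := vertex_mapP G e; first exact: vertex_map_ciso.
apply: ciso_trans (vertex_map_ciso _ _) _.
by rewrite homeo_indec_swap; exact: ciso_cons_eswap.
Qed.

(** A trivial vertex map fixes every edge up to [eswap], an isomorphic object; additivity extends
    this to all sums. *)
Lemma vertex_map_ker F :
  vertex_map F = homeo1 R <-> forall X, ciso k (F X) X.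
Proof.
rewrite vertex_map_unique; split=> [h|h e]; last by rewrite homeo_indec1.
elim=> [|e X ih]; first by rewrite cendo_nil; exact: ciso_refl.
have := vertex_mapP F e; have /vertex_map_unique -> := h; rewrite homeo_indec1.
rewrite -[e :: X]cat1s cendo_cat => -[] -> /=.
  exact: ciso_cons.
exact: ciso_trans (ciso_cons_eswap _ _ _) (ciso_cons _ ih).
Qed.

End Automorphisms.

(** * The automorphism induced by a homeomorphism *)

Section HeterogeneousEquality.
Variables (R : realType) (k : fieldType).
Implicit Types A B C D : fobj R k.

Definition fcast A A' B B' (eA : A = A') (eB : B = B') (f : fhom A B) :
    fhom A' B' :=
  match eA in _ = A0, eB in _ = B0 return fhom A0 B0 with erefl, erefl => f end.
Definition scast A A' B B' (eA : A = A') (eB : B = B') (f : shom A B) :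
    shom A' B' :=
  match eA in _ = A0, eB in _ = B0 return shom A0 B0 with erefl, erefl => f end.

(* Equality along the propositional equalities fmap g (cF X) = cF (cmapo g X). *)
Definition feq A B (f : fhom A B) A' B' (f' : fhom A' B') : Prop :=
  exists (eA : A = A') (eB : B = B'), fcast eA eB f = f'.
Definition sheq A B (f : shom A B) A' B' (f' : shom A' B') : Prop :=
  exists (eA : A = A') (eB : B = B'), scast eA eB f = f'.

Lemma feq_refl A B (f : fhom A B) : feq f f.
Proof. by exists erefl, erefl. Qed.
Lemma sheq_refl A B (f : shom A B) : sheq f f.
Proof. by exists erefl, erefl. Qed.

Lemma feq_cast A A' B B' (eA : A = A') (eB : B = B') (f : fhom A B) :
  feq f (fcast eA eB f).
Proof. by exists eA, eB. Qed.
Lemma sheq_cast A A' B B' (eA : A = A') (eB : B = B') (f : shom A B) :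
  sheq f (scast eA eB f).
Proof. by exists eA, eB. Qed.

Lemma sheq_eq A B (f f' : shom A B) : sheq f f' -> f = f'.
Proof.
by move=> [eA [eB <-]]; rewrite (Prop_irrelevance eA erefl) (Prop_irrelevance eB erefl).
Qed.

Lemma sheq_sym A B (f : shom A B) A' B' (f' : shom A' B') :
  sheq f f' -> sheq f' f.
Proof.
by move=> [eA [eB <-]]; case: _ / eA; case: _ / eB; exact: sheq_refl.
Qed.
Lemma sheq_trans A B (f : shom A B) A' B' (f' : shom A' B') A'' B''
    (f'' : shom A'' B'') : sheq f f' -> sheq f' f'' -> sheq f f''.
Proof.
move=> [eA [eB <-]] [eA' [eB' <-]].
case: _ / eA' ; case: _ / eB'; case: _ / eA; case: _ / eB; exact: sheq_refl.
Qed.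

Lemma sheq_sclass A B (f : fhom A B) A' B' (f' : fhom A' B') :
  feq f f' -> sheq (sclass f) (sclass f').
Proof.
by move=> [eA [eB <-]]; case: _ / eA; case: _ / eB; exact: sheq_refl.
Qed.

Lemma feq_comp A B C (g : fhom B C) (f : fhom A B) A' B' C' (g' : fhom B' C')
  (f' : fhom A' B') : feq g g' -> feq f f' -> feq (fcomp g f) (fcomp g' f').
Proof.
move=> [eB [eC <-]] [eA [eB' <-]]; rewrite (Prop_irrelevance eB' eB).
case: _ / eA; case: _ / eB {eB'}; case: _ / eC; exact: feq_refl.
Qed.
Lemma sheq_comp A B C (g : shom B C) (f : shom A B) A' B' C' (g' : shom B' C')
  (f' : shom A' B') : sheq g g' -> sheq f f' -> sheq (scomp g f) (scomp g' f').
Proof.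
move=> [eB [eC <-]] [eA [eB' <-]]; rewrite (Prop_irrelevance eB' eB).
case: _ / eA; case: _ / eB {eB'}; case: _ / eC; exact: sheq_refl.
Qed.

Lemma feqD A B (g f : fhom A B) A' B' (g' f' : fhom A' B') :
  feq g g' -> feq f f' -> feq (g + f) (g' + f').
Proof.
move=> [eA [eB <-]] [eA' [eB' <-]].
rewrite (Prop_irrelevance eB' eB) (Prop_irrelevance eA' eA).
case: _ / eA {eA'}; case: _ / eB {eB'}; exact: feq_refl.
Qed.
Lemma sheqD A B (g f : shom A B) A' B' (g' f' : shom A' B') :
  sheq g g' -> sheq f f' -> sheq (g + f) (g' + f').
Proof.
move=> [eA [eB <-]] [eA' [eB' <-]].
rewrite (Prop_irrelevance eB' eB) (Prop_irrelevance eA' eA).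
case: _ / eA {eA'}; case: _ / eB {eB'}; exact: sheq_refl.
Qed.
Lemma feqN A B (f : fhom A B) A' B' (f' : fhom A' B') :
  feq f f' -> feq (- f) (- f').
Proof.
by move=> [eA [eB <-]]; case: _ / eA; case: _ / eB; exact: feq_refl.
Qed.

Lemma feq0 A B A' B' : A = A' -> B = B' ->
  feq (0 : fhom A B) (0 : fhom A' B').
Proof. by move=> <- <-; exact: feq_refl. Qed.
Lemma feq_id A A' : A = A' -> feq (fid A) (fid A').
Proof. by move=> <-; exact: feq_refl. Qed.

Lemma is_siso_sheq A B (f : shom A B) A' B' (f' : shom A' B') :
  sheq f f' -> is_siso f -> is_siso f'.
Proof. by move=> [eA [eB <-]]; case: _ / eA; case: _ / eB. Qed.

(** With literally equal index types, it suffices to compare points, differentials and matrices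
    entrywise. *)
Lemma feq_mx (T U : finType) (p p' : T -> circle R) (q q' : U -> circle R)
  (a : phom k (PObj p) (PObj p)) (a' : phom k (PObj p') (PObj p'))
  (b : phom k (PObj q) (PObj q)) (b' : phom k (PObj q') (PObj q'))
  (f : phom k (PObj p) (PObj q)) (f' : phom k (PObj p') (PObj q'))
  ha ha' hb hb' hf hf' : p =1 p' -> q =1 q' -> a =1 a' -> b =1 b' -> f =1 f' ->
  feq (@FHom R k (@FObj R k (PObj p) a ha) (@FObj R k (PObj q) b hb) f hf)
      (@FHom R k (@FObj R k (PObj p') a' ha') (@FObj R k (PObj q') b' hb') f' hf').
Proof.
move=> /funext ep /funext eq; case: _ / ep in a' ha' f' hf' *.
case: _ / eq in b' hb' f' hf' * => /ffunP ea /ffunP eb /ffunP ef.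
case: _ / ea in ha' hf' *; case: _ / eb in hb' hf' *; case: _ / ef in hf' *.
rewrite (Prop_irrelevance ha' ha) (Prop_irrelevance hb' hb) in hf' *.
by rewrite (bool_irrelevance hf' hf); exact: feq_refl.
Qed.

Lemma fobj_eq (T : finType) (p p' : T -> circle R)
  (a : phom k (PObj p) (PObj p)) (a' : phom k (PObj p') (PObj p'))
  ha ha' : p =1 p' -> a =1 a' ->
  @FObj R k (PObj p) a ha = @FObj R k (PObj p') a' ha'.
Proof.
move=> /funext ep; case: _ / ep in a' ha' * => /ffunP ea.
by case: _ / ea in ha' *; rewrite (Prop_irrelevance ha' ha).
Qed.

End HeterogeneousEquality.

(** * Relabelling the points by a homeomorphism *)

Section InducedFunctor.
Variables (R : realType) (k : fieldType) (g : homeo R).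
Implicit Types (V W : pobj R) (A B C : fobj R k) (X Y : cobj R) (e : indec R).

Definition pmap V : pobj R := PObj (fun i => g (@ppt R V i)).

(** The matrix itself is kept: [phom] depends only on the index types, not on the points. *)
Definition pmaph V W (f : phom k V W) : phom k (pmap V) (pmap W) := f.

Lemma pmap_comp U V W (h : phom k V W) (f : phom k U V) :
  pcomp (pmaph h) (pmaph f) = pmaph (pcomp h f).
Proof.
apply/ffunP => -[w u]; rewrite [LHS]ffunE [RHS]ffunE.
by apply: eq_bigr => j _; rewrite /= homeo_carry.
Qed.

Lemma fmap_subproof A : pcomp (pmaph (fd A)) (pmaph (fd A)) =
  ptmul (pid k (pmap (fV A))).
Proof. by rewrite pmap_comp fdP. Qed.
Definition fmap A : fobj R k := FObj (fmap_subproof A).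

Lemma fmaph_subproof A B (f : fhom A B) :
  pmaph f \in @fcommute R k (fmap A) (fmap B).
Proof. by apply/eqP; rewrite !pmap_comp fhomP. Qed.
Definition fmaph A B (f : fhom A B) : fhom (fmap A) (fmap B) :=
  FHom (fmaph_subproof f).

Lemma fmaph_full A B (f : fhom (fmap A) (fmap B)) : exists f', f = fmaph f'.
Proof.
have hf : fhom_val f \in @fcommute R k A B.
  by apply/eqP; have := fhomP f; rewrite !pmap_comp.
by exists (@FHom R k A B _ hf); exact: val_inj.
Qed.

Lemma fmaph_inj A B : injective (@fmaph A B).
Proof. by move=> f f' /(congr1 (@fhom_val _ _ _ _)) e; exact: val_inj. Qed.

Lemma fmaph_comp A B C (h : fhom B C) (f : fhom A B) :
  fmaph (fcomp h f) = fcomp (fmaph h) (fmaph f).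
Proof. by apply: val_inj; rewrite /= pmap_comp. Qed.
Lemma fmaph_id A : fmaph (fid A) = fid (fmap A).
Proof. exact: val_inj. Qed.
Lemma fmaphD A B (f f' : fhom A B) : fmaph (f + f') = fmaph f + fmaph f'.
Proof. exact: val_inj. Qed.
Lemma fmaphN A B (f : fhom A B) : fmaph (- f) = - fmaph f.
Proof. exact: val_inj. Qed.
Lemma fmaph0 A B : fmaph (0 : fhom A B) = 0.
Proof. exact: val_inj. Qed.
Lemma fmaphZ A B c (f : fhom A B) : fmaph (c *: f) = c *: fmaph f.
Proof. exact: val_inj. Qed.

(** A homotopy is relabelled like any matrix, so images of projective-injective objects need not be
    examined. *)
Lemma fmaph_null A B (f : fhom A B) : f \in @fnull R k A B ->
  fmaph f \in @fnull R k _ _.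
Proof.
move=> /fnull_homotopy[m ->]; apply/fnull_homotopy; exists (pmaph m).
by apply: val_inj; rewrite /= !pmap_comp.
Qed.

Lemma fmap_sum A B : fmap (fsum A B) = fsum (fmap A) (fmap B).
Proof. by apply: fobj_eq => [[]|]. Qed.

Lemma fmap_inl A B A' B' : fmap A = A' -> fmap B = B' ->
  feq (fmaph (finl A B)) (finl A' B').
Proof.
by move=> <- <-; case: A B => [[T p] a ha] [[U q] b hb]; apply: feq_mx => // -[].
Qed.
Lemma fmap_inr A B A' B' : fmap A = A' -> fmap B = B' ->
  feq (fmaph (finr A B)) (finr A' B').
Proof.
by move=> <- <-; case: A B => [[T p] a ha] [[U q] b hb]; apply: feq_mx => // -[].
Qed.
Lemma fmap_prl A B A' B' : fmap A = A' -> fmap B = B' ->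
  feq (fmaph (fprl A B)) (fprl A' B').
Proof.
by move=> <- <-; case: A B => [[T p] a ha] [[U q] b hb]; apply: feq_mx => // -[].
Qed.
Lemma fmap_prr A B A' B' : fmap A = A' -> fmap B = B' ->
  feq (fmaph (fprr A B)) (fprr A' B').
Proof.
by move=> <- <-; case: A B => [[T p] a ha] [[U q] b hb]; apply: feq_mx => // -[].
Qed.

Lemma fmap_fsumhom A1 B1 A2 B2 A1' B1' A2' B2' (f : fhom A1 B1)
    (h : fhom A2 B2) (f' : fhom A1' B1') (h' : fhom A2' B2') :
  feq (fmaph f) f' -> feq (fmaph h) h' ->
  feq (fmaph (fsumhom f h)) (fsumhom f' h').
Proof.
move=> ef eh; have [eA [eB _]] := ef; have [eA' [eB' _]] := eh.
rewrite /fsumhom fmaphD !fmaph_comp; apply: feqD.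
  by do 2?[apply: feq_comp] => //; [exact: fmap_inl|exact: fmap_prl].
by do 2?[apply: feq_comp] => //; [exact: fmap_inr|exact: fmap_prr].
Qed.

Lemma fmap_zero : fmap (fzero R k) = fzero R k.
Proof. by apply: fobj_eq => [[]|[[]]]. Qed.

End InducedFunctor.

(** * Images of the chosen objects, shift sequences and stable morphisms *)

Section FunctorOnObjects.
Variables (R : realType) (k : fieldType) (g : homeo R).
Implicit Types (A B C : fobj R k) (X Y : cobj R) (e : indec R).
Notation Fm := (fmap (k := k) g).

Lemma fmap_diag (x y x' y' a b s t s' t' c d : R) h h' sh hg hg' shg :
  g (cpt x) = cpt s -> g (cpt y) = cpt t -> g (cpt x') = cpt s' ->
  g (cpt y') = cpt t' -> wind (y - x) = wind (t - s) ->
  wind (x + tau R - y) = wind (s + tau R - t) ->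
  wind (y' - x') = wind (t' - s') ->
  wind (x' + tau R - y') = wind (s' + tau R - t') ->
  wind a = wind c -> wind b = wind d ->
  feq (fmaph g (@Ediag R k x y x' y' h h' a b sh))
      (@Ediag R k s t s' t' hg hg' c d shg).
Proof.
move=> e1 e2 e3 e4 w1 w2 w3 w4 w5 w6; apply: feq_mx.
- by case; rewrite /= ?e1 ?e2.
- by case; rewrite /= ?e3 ?e4.
- by move=> -[[] []]; rewrite /pmaph !ffunE /texp ?w1 ?w2.
- by move=> -[[] []]; rewrite /pmaph !ffunE /texp ?w3 ?w4.
- by move=> -[[] []]; rewrite /pmaph !ffunE /texp ?w5 ?w6.
Qed.

Let wind_hl e : wind (hi e - lo e) = 0%N.
Proof.
have h1 := lo_lt_hi e; have h2 := hi_lt_lo e.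
by apply: wind_small; apply/andP; split; lra.
Qed.
Let wind_lh e : wind (lo e + tau R - hi e) = 0%N.
Proof.
have h1 := lo_lt_hi e; have h2 := hi_lt_lo e.
by apply: wind_small; apply/andP; split; lra.
Qed.
Let wind0 : wind (0 : R) = 0%N.
Proof. by apply: wind_small; rewrite lexx tau_gt0. Qed.

Let g_hi e : g (cpt (hi e)) = cpt (hi (homeo_indec g e)).
Proof. by rewrite !cpt_hi. Qed.
Let g_lo e : g (cpt (lo e)) = cpt (lo (homeo_indec g e)).
Proof. by rewrite !cpt_lo. Qed.

Lemma fmap_E e : Fm (Eobj k e) = Eobj k (homeo_indec g e).
Proof.
apply: fobj_eq => [[]|[[] []]]; rewrite ?g_hi ?g_lo //=;
  by rewrite !ffunE /texp ?wind_hl ?wind_lh.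
Qed.

Let tau_yy (y : R) : y + tau R - y = tau R. Proof. by rewrite addrC addKr. Qed.

Lemma fmap_Iinj e : feq (fmaph g (Iinj k e)) (Iinj k (homeo_indec g e)).
Proof.
rewrite /Iinj fmaphD fmaphN !fmaph_comp.
have s1 : feq (fmaph g (Ediag k (Exy_itv e) (Eyy_itv (hi e)) (iota_shift1 e)))
  (Ediag k (Exy_itv (homeo_indec g e)) (Eyy_itv (hi (homeo_indec g e)))
     (iota_shift1 (homeo_indec g e))).
  by apply: fmap_diag; rewrite ?wind_hl ?wind_lh ?subrr ?tau_yy.
have s2 : feq (fmaph g (Ediag k (Exy_itv e) (Exx_itv (lo e)) (iota_shift2 e)))
  (Ediag k (Exy_itv (homeo_indec g e)) (Exx_itv (lo (homeo_indec g e)))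
     (iota_shift2 (homeo_indec g e))).
  by apply: fmap_diag; rewrite ?cptDtau ?wind_hl ?wind_lh ?subrr ?tau_yy.
have [E0 [E1 _]] := s1; have [_ [E2 _]] := s2.
by apply: feqD; [|apply: feqN]; apply: feq_comp => //;
  [exact: fmap_inl|exact: fmap_inr].
Qed.

Lemma fmap_Iproj e : feq (fmaph g (Iproj k e)) (Iproj k (homeo_indec g e)).
Proof.
rewrite /Iproj fmaphD !fmaph_comp.
have hs (e' : indec R) : hi (eswap e') - lo (eswap e') = lo e' + tau R - hi e'.
  exact: hi_swap.
have ls (e' : indec R) : lo (eswap e') + tau R - hi (eswap e') = hi e' - lo e'.
  by have := hi_swap e'; lra.
have gl : g (cpt (lo (eswap e))) = cpt (lo (eswap (homeo_indec g e))).
  exact: (g_lo (eswap e)).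
have gh : g (cpt (hi (eswap e))) = cpt (hi (eswap (homeo_indec g e))).
  exact: (g_hi (eswap e)).
have s1 : feq (fmaph g (Ediag k (Eyy_itv (hi e)) (Exy_itv (eswap e)) (proj_shift1 e)))
  (Ediag k (Eyy_itv (hi (homeo_indec g e))) (Exy_itv (eswap (homeo_indec g e)))
     (proj_shift1 (homeo_indec g e))).
  apply: fmap_diag; rewrite ?hs ?ls ?wind_hl ?wind_lh ?subrr ?tau_yy //.
have s2 : feq (fmaph g (Ediag k (Exx_itv (lo e)) (Exy_itv (eswap e)) (proj_shift2 e)))
  (Ediag k (Exx_itv (lo (homeo_indec g e))) (Exy_itv (eswap (homeo_indec g e)))
     (proj_shift2 (homeo_indec g e))).
  apply: fmap_diag; rewrite ?cptDtau ?hs ?ls ?wind_hl ?wind_lh ?subrr ?tau_yy //.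
have [E1 [_ _]] := s1; have [E2 [_ _]] := s2.
by apply: feqD; apply: feq_comp => //; [exact: fmap_prl|exact: fmap_prr].
Qed.

Definition cmapo X : cobj R := map (homeo_indec g) X.

Lemma fmap_cF X : Fm (cF k X) = cF k (cmapo X).
Proof.
by elim: X => [|e X ih]; [exact: fmap_zero | rewrite /= fmap_sum fmap_E ih].
Qed.

Lemma fmap_cI X : Fm (cI k X) = cI k (cmapo X).
Proof.
elim: X => [|e X ih]; first exact: fmap_zero.
by rewrite /= fmap_sum ih; have [_ [eI _]] := fmap_Iinj e; rewrite eI.
Qed.

Lemma fmap_cIinj X : feq (fmaph g (cIinj k X)) (cIinj k (cmapo X)).
Proof.
elim: X => [|e X ih]; last by apply: fmap_fsumhom => //; exact: fmap_Iinj.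
by rewrite fmaph0; apply: feq0; exact: fmap_zero.
Qed.

Lemma cmapo_shift X : cmapo (cshift X) = cshift (cmapo X).
Proof. by elim: X => //= e X ->; rewrite homeo_indec_swap. Qed.

Lemma fmap_cF_shift X : Fm (cF k (cshift X)) = cF k (cshift (cmapo X)).
Proof. by rewrite fmap_cF cmapo_shift. Qed.

Lemma fmap_cIproj X : feq (fmaph g (cIproj k X)) (cIproj k (cmapo X)).
Proof.
elim: X => [|e X ih]; last by apply: fmap_fsumhom => //; exact: fmap_Iproj.
by rewrite fmaph0; apply: feq0; exact: fmap_zero.
Qed.

Lemma cmapo_cat X Y : cmapo (X ++ Y) = cmapo X ++ cmapo Y.
Proof. exact: map_cat. Qed.

Lemma fmap_cinl X Y : feq (fmaph g (cinl k X Y)) (cinl k (cmapo X) (cmapo Y)).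
Proof.
elim: X => [|e X ih].
  by rewrite fmaph0; apply: feq0; [exact: fmap_zero|exact: fmap_cF].
by apply: fmap_fsumhom => //; rewrite fmaph_id; apply: feq_id; exact: fmap_E.
Qed.

Lemma fmap_cprl X Y : feq (fmaph g (cprl k X Y)) (cprl k (cmapo X) (cmapo Y)).
Proof.
elim: X => [|e X ih].
  by rewrite fmaph0; apply: feq0; [exact: fmap_cF|exact: fmap_zero].
by apply: fmap_fsumhom => //; rewrite fmaph_id; apply: feq_id; exact: fmap_E.
Qed.

Lemma fmap_cinr X Y : feq (fmaph g (cinr k X Y)) (cinr k (cmapo X) (cmapo Y)).
Proof.
elim: X => [|e X ih] /=; first by rewrite fmaph_id; apply/feq_id/fmap_cF.
rewrite fmaph_comp; apply: feq_comp => //.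
by apply: fmap_inr; rewrite ?fmap_E // fmap_cF cmapo_cat.
Qed.

Lemma fmap_cprr X Y : feq (fmaph g (cprr k X Y)) (cprr k (cmapo X) (cmapo Y)).
Proof.
elim: X => [|e X ih] /=; first by rewrite fmaph_id; apply/feq_id/fmap_cF.
rewrite fmaph_comp; apply: feq_comp => //.
by apply: fmap_prr; rewrite ?fmap_E // fmap_cF cmapo_cat.
Qed.

Definition smap A B (f : shom A B) : shom (Fm A) (Fm B) :=
  sclass (fmaph g (repr f)).

Lemma smapE A B (f : fhom A B) : smap (sclass f) = sclass (fmaph g f).
Proof.
apply/sclass_eq; rewrite -fmaphN -fmaphD; apply: fmaph_null.
by apply/sclass_eq; rewrite sclassK.
Qed.

Lemma smap_comp A B C (h : shom B C) (f : shom A B) :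
  smap (scomp h f) = scomp (smap h) (smap f).
Proof.
by rewrite -[f]sclassK -[h]sclassK scompE !smapE scompE fmaph_comp.
Qed.
Lemma smap_id A : smap (sid A) = sid (Fm A).
Proof. by rewrite /sid smapE fmaph_id. Qed.
Lemma smapD A B (f h : shom A B) : smap (f + h) = smap f + smap h.
Proof.
by rewrite -[f]sclassK -[h]sclassK -sclassD !smapE -sclassD fmaphD.
Qed.
Lemma smapZ A B c (f : shom A B) : smap (c *: f) = c *: smap f.
Proof.
rewrite -[f]sclassK smapE.
by rewrite -[c *: sclass _]/(sscale _ _) -[RHS]/(sscale _ _) !sscaleE smapE fmaphZ.
Qed.

Lemma sheq_smap A B (f : shom A B) A' B' (f' : shom A' B') :
  sheq f f' -> sheq (smap f) (smap f').
Proof. by move=> [eA [eB <-]]; case: _ / eA; case: _ / eB; exact: sheq_refl. Qed.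

Lemma smap_siso A B (f : shom A B) : is_siso f -> is_siso (smap f).
Proof.
by move=> [h [h1 h2]]; exists (smap h); rewrite -!smap_comp h1 h2 !smap_id.
Qed.

End FunctorOnObjects.

(** * Existence and uniqueness of the shift of a morphism *)

Section ShiftOfMorphisms.
Variables (R : realType) (k : fieldType).
Implicit Types (U V W : pobj R) (A B C : fobj R k) (X Y : cobj R) (e : indec R).

Lemma pinl_compE U V W (m : phom k U V) z u :
  pcomp (pinl k V W) m (z, u) = if z is inl a then m (a, u) else 0.
Proof.
case: z => a; last by rewrite pcomp0 // => j; rewrite ffunE mul0r.
rewrite -[in RHS](pcomp1l m) !pcompE; apply: eq_bigr => i _.
by congr (_ * (_ * _)); rewrite ffunE.
Qed.
Lemma pinr_compE U V W (m : phom k U W) z u :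
  pcomp (pinr k V W) m (z, u) = if z is inr a then m (a, u) else 0.
Proof.
case: z => a; first by rewrite pcomp0 // => j; rewrite ffunE mul0r.
rewrite -[in RHS](pcomp1l m) !pcompE; apply: eq_bigr => i _.
by congr (_ * (_ * _)); rewrite ffunE.
Qed.
Lemma comp_pprlE U V W (m : phom k V U) w z :
  pcomp m (pprl k V W) (w, z) = if z is inl a then m (w, a) else 0.
Proof.
case: z => a; last by rewrite pcomp0 // => j; rewrite [X in _ * X]ffunE mulr0.
rewrite -[in RHS](pcomp1r m) !pcompE; apply: eq_bigr => i _.
by congr (_ * (_ * _)); rewrite ffunE.
Qed.
Lemma comp_pprrE U V W (m : phom k W U) w z :
  pcomp m (pprr k V W) (w, z) = if z is inr a then m (w, a) else 0.
Proof.
case: z => a; first by rewrite pcomp0 // => j; rewrite [X in _ * X]ffunE mulr0.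
rewrite -[in RHS](pcomp1r m) !pcompE; apply: eq_bigr => i _.
by congr (_ * (_ * _)); rewrite ffunE.
Qed.

Definition delta (b : bool) : fps k := if b then 1 else 0.

Lemma IinjE e z (i : bool) : fhom_val (Iinj k e) (z, i) =
  match z with inl j => delta (j == i) | inr j => - delta (j == i) end.
Proof.
have t0 := lo_lt_hi e; have t1 := hi_lt_lo e.
have -> : fhom_val (Iinj k e) (z, i) =
    pcomp (pinl k _ _)
      (fhom_val (Ediag k (Exy_itv e) (Eyy_itv (hi e)) (iota_shift1 e))) (z, i) -
    pcomp (pinr k _ _)
      (fhom_val (Ediag k (Exy_itv e) (Exx_itv (lo e)) (iota_shift2 e))) (z, i).
  by rewrite /= !ffunE.
rewrite pinl_compE pinr_compE /=; case: z => -[]; rewrite ffunE ?subr0 ?sub0r;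
  by case: i => //=; rewrite texp_small //; apply/andP; split; lra.
Qed.

Lemma IprojE e (i : bool) z : fhom_val (Iproj k e) (i, z) =
  match z with inl j => delta (j == i) | inr j => delta (j == i) end.
Proof.
have t0 := lo_lt_hi e; have t1 := hi_lt_lo e.
have -> : fhom_val (Iproj k e) (i, z) =
    pcomp (fhom_val (Ediag k (Eyy_itv (hi e)) (Exy_itv (eswap e)) (proj_shift1 e)))
      (pprl k _ _) (i, z) +
    pcomp (fhom_val (Ediag k (Exx_itv (lo e)) (Exy_itv (eswap e)) (proj_shift2 e)))
      (pprr k _ _) (i, z).
  by rewrite /= !ffunE.
rewrite comp_pprlE comp_pprrE /=; case: z => -[]; rewrite ffunE ?addr0 ?add0r;
  by case: i => //=; rewrite texp_small //; apply/andP; split; lra.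
Qed.

Lemma Iexact e : fexact (Iinj k e) (Iproj k e).
Proof.
(* [r] uses the second summand of [E(y,y)] and, with a sign, the first of [E(x,x+2pi)]; [s] uses the
   other two. There the maps of the sequence are [e^0] up to sign. *)
pose r : phom k (fV (Iobj k e)) (fV (Eobj k e)) :=
  [ffun c : bool * (bool + bool) => match c.2 with
    | inl j => delta (j && c.1) | inr j => - delta (~~ (j || c.1)) end].
pose s : phom k (fV (Eobj k (eswap e))) (fV (Iobj k e)) :=
  [ffun c : (bool + bool) * bool => match c.1 with
    | inl j => delta (~~ (j || c.2)) | inr j => delta (j && c.2) end].
have pidE V i j : pid k V (i, j) = delta (i == j).
  by rewrite ffunE /=; case: eqP.
have rE i z : r (i, z) = match z with
    | inl j => delta (j && i) | inr j => - delta (~~ (j || i)) end.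
  by rewrite ffunE.
have sE z i : s (z, i) = match z with
    | inl j => delta (~~ (j || i)) | inr j => delta (j && i) end.
  by rewrite ffunE.
have simp := (@mulr0 (fps k), @mul0r (fps k), @mulr1 (fps k), @mul1r (fps k),
  @addr0 (fps k), @add0r (fps k), @mulrNN (fps k), @mulrN (fps k),
  @mulNr (fps k), @opprK (fps k), @oppr0 (fps k)).
have cc := (@cptDtau R, @cpt_lo R, @cpt_hi R, @carrypp R, @carry0 R,
  @expr0 (fps k)).
exists r, s; split; apply/ffunP => -[i j]; rewrite ?pidE.
- rewrite pcompE big_sumType !big_bool !IinjE !rE.
  by case: i; case: j; rewrite /= ?simp ?cc ?simp.
- rewrite pcompE big_sumType !big_bool !IprojE !sE.
  by case: i; case: j; rewrite /= ?simp ?cc ?simp.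
- rewrite pcompE big_sumType !big_bool !IinjE !IprojE.
  by case: i; case: j; rewrite /= ?simp ?cc ?simp ?subrr ?addNr ?ffunE.
- rewrite [LHS]ffunE !pcompE !big_bool !IinjE !IprojE !rE !sE.
  by case: i => -[]; case: j => -[]; rewrite /= ?simp ?cc ?simp ?subrr ?addNr.
Qed.

Lemma pdiagE V V' W W' (f : phom k V V') (h : phom k W W') z z' :
  pdiag f h (z, z') = match z, z' with
    | inl a, inl b => f (a, b) | inr a, inr b => h (a, b) | _, _ => 0 end.
Proof. by rewrite ffunE. Qed.

Lemma pdiag_id V W : pdiag (pid k V) (pid k W) = pid k (psum V W).
Proof.
by apply/ffunP => -[[a|a] [b|b]]; rewrite pdiagE !ffunE.
Qed.

Lemma pdiagD V V' W W' (f f' : phom k V V') (h h' : phom k W W') :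
  pdiag (f + f') (h + h') = pdiag f h + pdiag f' h'.
Proof.
by apply/ffunP => -[[a|a] [b|b]]; rewrite [RHS]ffunE !pdiagE ?addr0 // ffunE.
Qed.

Lemma pdiag0 V V' W W' : pdiag (0 : phom k V V') (0 : phom k W W') = 0.
Proof. by apply/ffunP => -[[a|a] [b|b]]; rewrite pdiagE !ffunE. Qed.

Lemma fsumhom_val A A' B B' (f : fhom A A') (h : fhom B B') :
  fhom_val (fsumhom f h) = pdiag (fhom_val f) (fhom_val h).
Proof.
apply/ffunP => -[z z']; rewrite pdiagE.
have -> : fhom_val (fsumhom f h) (z, z') =
   pcomp (pinl k _ _) (pcomp (fhom_val f) (pprl k _ _)) (z, z') +
   pcomp (pinr k _ _) (pcomp (fhom_val h) (pprr k _ _)) (z, z').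
  by rewrite /= !ffunE.
rewrite pinl_compE pinr_compE.
by case: z => a; rewrite ?comp_pprlE ?comp_pprrE; case: z' => b; rewrite ?addr0 ?add0r.
Qed.

Lemma fexact_sum A B C A' B' C' (f : fhom A B) (h : fhom B C)
    (f' : fhom A' B') (h' : fhom B' C') :
  fexact f h -> fexact f' h' -> fexact (fsumhom f f') (fsumhom h h').
Proof.
move=> [r [s [e1 e2 e3 e4]]] [r' [s' [e1' e2' e3' e4']]].
exists (pdiag r r'), (pdiag s s'); rewrite !fsumhom_val !pdiag_comp -pdiagD.
by split; rewrite ?e1 ?e2 ?e3 ?e4 ?e1' ?e2' ?e3' ?e4' ?pdiag_id ?pdiag0.
Qed.

Lemma cI_exact X : fexact (cIinj k X) (cIproj k X).
Proof.
elim: X => [|e X ih]; last by apply: fexact_sum => //; exact: Iexact.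
by exists 0, 0; split; apply/ffunP => -[[]].
Qed.

Lemma contraction_sum A B (s : phom k (fV A) (fV A)) (s' : phom k (fV B) (fV B)) :
  boundary s = fid A -> boundary s' = fid B ->
  boundary (A := fsum A B) (B := fsum A B) (pdiag s s') = fid (fsum A B).
Proof.
move=> /(congr1 (@fhom_val _ _ _ _)) /= h /(congr1 (@fhom_val _ _ _ _)) /= h'.
by apply: val_inj; rewrite /= !pdiag_comp -pdiagD h h' pdiag_id.
Qed.

(** The entry of [d] from the first to the second summand is [e^0], and its inverse is a
    contraction; for [E(x,x+2pi)] the opposite entry plays this part. *)
Lemma Eyy_contractible (y : R) :
  exists s, boundary s = fid (E k (Eyy_itv y)).
Proof.
exists [ffun c : bool * bool => delta (~~ c.1 && c.2)].
apply: val_inj; apply/ffunP => -[i j]; rewrite [LHS]ffunE !pcompE !big_bool !ffunE.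
have t0 : texp k (y - y) = 1 by rewrite subrr texp_small // lexx tau_gt0.
case: i; case: j; rewrite /= ?mulr0 ?mul0r ?mulr0 ?addr0 ?add0r //;
  by rewrite ?t0 ?carrypp ?expr0 ?mulr1.
Qed.

Lemma Exx_contractible (x : R) :
  exists s, boundary s = fid (E k (Exx_itv x)).
Proof.
exists [ffun c : bool * bool => delta (c.1 && ~~ c.2)].
apply: val_inj; apply/ffunP => -[i j]; rewrite [LHS]ffunE !pcompE !big_bool !ffunE.
have t0 : texp k (x + tau R - (x + tau R)) = 1.
  by rewrite subrr texp_small // lexx tau_gt0.
case: i; case: j; rewrite /= ?mulr0 ?mul0r ?mulr0 ?addr0 ?add0r //;
  by rewrite ?t0 ?cptDtau ?carrypp ?expr0 ?mulr1.
Qed.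

Lemma cI_contractible X : exists s, boundary s = fid (cI k X).
Proof.
elim: X => [|e X [s hs]]; first by exists 0; exact: etrans (fzero_ext _) (esym (fzero_ext _)).
have [s1 h1] := Eyy_contractible (hi e); have [s2 h2] := Exx_contractible (lo e).
by exists (pdiag (pdiag s1 s2) s); do 2!apply: contraction_sum => //.
Qed.

Lemma cI_projective X : fprojective (cI k X).
Proof. by have [s /contractible_projective] := cI_contractible X. Qed.
Lemma cI_injective X : finjective (cI k X).
Proof. by have [s /contractible_injective] := cI_contractible X. Qed.

Section Exact.
Variables (A B C : fobj R k) (i : fhom A B) (p : fhom B C).
Hypothesis ip : fexact i p.

Lemma fexact_comp0 : fcomp p i = 0.
Proof. by have [r [s [_ _ h _]]] := ip; exact: val_inj. Qed.

Lemma fexact_epi D (h h' : fhom C D) : fcomp h p = fcomp h' p -> h = h'.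
Proof.
have [r [s [_ ps _ _]]] := ip; move=> /(congr1 (@fhom_val _ _ _ _)) /= e.
by apply: val_inj; rewrite /= -[LHS]pcomp1r -[RHS]pcomp1r -ps !pcompA e.
Qed.

(** The factor is [m s] for the underlying splitting [s]; it commutes with [d] because this can be
    tested after composing with [p]. *)
Lemma fexact_cokernel D (m : fhom B D) : fcomp m i = 0 ->
  exists n : fhom C D, m = fcomp n p.
Proof.
have [r [s [_ ps _ id]]] := ip.
move=> /(congr1 (@fhom_val _ _ _ _)) /= mi.
have e : pcomp (pcomp m s) p = m.
  rewrite -[RHS]pcomp1r -id pcompDr [pcomp m (pcomp i r)]pcompA mi pcomp0l add0r.
  by rewrite pcompA.
have hn : pcomp m s \in @fcommute R k C D.
  apply/eqP; rewrite -[LHS]pcomp1r -ps -(pcompA _ (fd C)) (pcompA (fd C)) -fhomP.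
  by rewrite -(pcompA p) (pcompA _ p) e !pcompA fhomP.
by exists (FHom hn); apply: val_inj; rewrite /= e.
Qed.
End Exact.

Lemma lifts_to_shift_exists X Y (f : fhom (cF k X) (cF k Y)) :
  exists h, lifts_to_shift f h.
Proof.
have [l hl] := @cI_injective Y _ _ _ _ _ (cI_exact X) (fcomp (cIinj k Y) f).
have e0 : fcomp (fcomp (cIproj k Y) l) (cIinj k X) = 0.
  by rewrite -fcompA hl fcompA (fexact_comp0 (cI_exact Y)) fcomp0l.
by have [h hh] := fexact_cokernel (cI_exact X) e0; exists h, l.
Qed.

(** If [f = b a] through [Q], extend [a] to [a'] on [cI X]. Correcting [l] by [cIinj b a'] kills
    [cIinj X], so the difference descends to [m] and [h = cIproj m]. *)
Lemma lifts_to_shift_null X Y (f : fhom (cF k X) (cF k Y)) h :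
  lifts_to_shift f h -> f \in @fnull R k _ _ -> h \in @fnull R k _ _.
Proof.
move=> [l [hl hh]] /fnullP[Q [a [b [pQ iQ ef]]]].
have [a' ha'] := iQ _ _ _ _ _ (cI_exact X) a.
have e0 : fcomp (l - fcomp (cIinj k Y) (fcomp b a')) (cIinj k X) = 0.
  by rewrite fcompDl fcompNl hl ef -!fcompA ha' subrr.
have [m hm] := fexact_cokernel (cI_exact X) e0.
apply/fnullP; exists (cI k Y), m, (cIproj k Y).
split; [exact: cI_projective|exact: cI_injective|].
apply: (fexact_epi (cI_exact X)); rewrite hh -fcompA -hm fcompDr fcompNr.
by rewrite fcompA (fexact_comp0 (cI_exact Y)) fcomp0l subr0.
Qed.

Lemma cshift_homE X Y (f : fhom (cF k X) (cF k Y)) h :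
  lifts_to_shift f h -> cshift_hom (X := X) (Y := Y) (sclass f) = sclass h.
Proof.
(* The given [h] rules out the default 0. The lift chosen by [xget] differs from [h] by a lift of
   the null morphism [f0 - f]. *)
move=> fh; rewrite /cshift_hom; case: xgetP => [s _ [f0 [h0 [e <- fh0]]]|no].
  apply/sclass_eq; apply: (@lifts_to_shift_null _ _ (f0 - f)).
    case: fh fh0 => [l [e1 e2]] [l0 [e3 e4]]; exists (l0 - l).
    by rewrite !fcompDl !fcompDr !fcompNl !fcompNr e1 e2 e3 e4.
  exact/sclass_eq.
by case: (no (sclass h)); exists f, h.
Qed.

End ShiftOfMorphisms.

(** * Relabelling of standard triangles *)

Section Triangles.
Variables (R : realType) (k : fieldType).
Implicit Types A B C I S : fobj R k.

(* standard_triangle with cF X, cI X and cF (cshift X) replaced by arbitrary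
   objects, so that it can be transported along equalities of objects *)
Definition cone_triangle A B I S C (u : fhom A B) (i : fhom A I) (p : fhom I S)
    (v : fhom B C) (w : fhom C S) : Prop :=
  exists j : fhom I C, [/\ is_pushout u i v j, fcomp w v = 0 & fcomp w j = p].

Lemma cone_triangle_feq A B I S C (u : fhom A B) (i : fhom A I) (p : fhom I S)
    (v : fhom B C) (w : fhom C S) A' B' I' S' C' (u' : fhom A' B')
    (i' : fhom A' I') (p' : fhom I' S') (v' : fhom B' C') (w' : fhom C' S') :
  feq u u' -> feq i i' -> feq p p' -> feq v v' -> feq w w' ->
  cone_triangle u i p v w -> cone_triangle u' i' p' v' w'.
Proof.
move=> [eA [eB <-]] [eA' [eI <-]] [eI' [eS <-]] [eB' [eC <-]] [eC' [eS' <-]].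
rewrite (Prop_irrelevance eA' eA) (Prop_irrelevance eI' eI).
rewrite (Prop_irrelevance eB' eB) (Prop_irrelevance eC' eC).
rewrite (Prop_irrelevance eS' eS).
move: eA eB eI eS eC {eA' eI' eB' eC' eS'}.
by case: _ /; case: _ /; case: _ /; case: _ /; case: _ /.
Qed.

Variable g : homeo R.

(** Relabelling by the inverse gives a preimage; this reaches every test object of a pushout. *)
Lemma fmap_surj A : exists A', A = fmap g A'.
Proof.
case: A => [[T p] a ha].
have hp : (fun i => g (homeo_inv g (p i))) =1 p.
  by move=> i; rewrite (homeo_invP g).2.
pose V := PObj (fun i => homeo_inv g (p i)); pose a' : phom k V V := a.
have ha' : pcomp a' a' = ptmul (pid k V).
  exact: (@fmap_subproof _ _ (homeo_inv g) (FObj ha)).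
by exists (FObj ha'); apply: fobj_eq => // i; rewrite hp.
Qed.

(** Relabelling is fully faithful and hits every object, so each test diagram comes from one before
    relabelling. *)
Lemma fmap_pushout A B C D (f : fhom A B) (h : fhom A C) (b : fhom B D)
    (c : fhom C D) : is_pushout f h b c ->
  is_pushout (fmaph g f) (fmaph g h) (fmaph g b) (fmaph g c).
Proof.
move=> [e univ]; split; first by rewrite -!fmaph_comp e.
move=> D' b' c'; have [D0 eD] := fmap_surj D'; case: _ / (esym eD) in b' c' *.
have [b0 ->] := fmaph_full b'; have [c0 ->] := fmaph_full c'.
rewrite -!fmaph_comp => /fmaph_inj /univ[h0 [[h1 h2] hu]].
exists (fmaph g h0); split; first by rewrite -!fmaph_comp h1 h2.
move=> h'; have [h3 ->] := fmaph_full h'.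
by rewrite -!fmaph_comp => -[/fmaph_inj k1 /fmaph_inj k2]; rewrite (hu h3).
Qed.

Lemma fmap_cone_triangle A B I S C (u : fhom A B) (i : fhom A I)
    (p : fhom I S) (v : fhom B C) (w : fhom C S) :
  cone_triangle u i p v w -> cone_triangle (fmaph g u) (fmaph g i) (fmaph g p)
    (fmaph g v) (fmaph g w).
Proof.
move=> [j [po wv wj]]; exists (fmaph g j).
by split; [exact: fmap_pushout| |]; rewrite -fmaph_comp ?wv ?fmaph0 ?wj.
Qed.

End Triangles.

(** * The splitting homomorphism *)

Section Lift.
Variables (R : realType) (k : fieldType).
Implicit Types (X Y Z : cobj R) (g h : homeo R).

Lemma arrow_sheq X Y X' Y' (f : chom k X Y) (f' : chom k X' Y') :
  X = X' -> Y = Y' -> sheq f f' -> arrow f = arrow f'.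
Proof.
by move=> eX eY; case: _ / eX in f' *; case: _ / eY in f' * => /sheq_eq ->.
Qed.

Lemma sheq_arrow X Y X' Y' (f : chom k X Y) (f' : chom k X' Y') :
  arrow f = arrow f' -> sheq f f'.
Proof.
move=> e; pose P (t : carrow R k) := sheq (projT2 (projT2 t)) f'.
suff : P (arrow f) by [].
by rewrite e; exact: sheq_refl.
Qed.

Definition lift_hom g X Y (f : chom k X Y) :
    chom k (cmapo g X) (cmapo g Y) :=
  scast (fmap_cF k g X) (fmap_cF k g Y) (smap g f).

Lemma lift_homE g X Y (f : chom k X Y) : sheq (smap g f) (lift_hom g f).
Proof. exact: sheq_cast. Qed.

Definition lift_cmap g : cmap R k := CMap (lift_hom g).

Lemma lift_comp g X Y Z (f' : chom k Y Z) (f : chom k X Y) :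
  lift_hom g (ccomp f' f) = ccomp (lift_hom g f') (lift_hom g f).
Proof.
apply: sheq_eq; apply: sheq_trans (sheq_sym (lift_homE _ _)) _.
by rewrite /ccomp smap_comp; apply: sheq_comp; exact: lift_homE.
Qed.

Lemma lift_functor g : is_functor (lift_cmap g).
Proof.
split=> [X|X Y Z f' f] /=; last exact: lift_comp.
apply: sheq_eq; apply: sheq_trans (sheq_sym (lift_homE _ _)) _.
by rewrite smap_id /sid; apply/sheq_sclass/feq_id/fmap_cF.
Qed.

Lemma scast_linear (A A' B B' : fobj R k) (eA : A = A') (eB : B = B') :
  linear (scast eA eB).
Proof. by case: _ / eA; case: _ / eB. Qed.

Lemma lift_linear g : is_klinear (lift_cmap g).
Proof.
move=> X Y c f f' /=; rewrite /lift_hom smapD smapZ.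
exact: scast_linear.
Qed.

Lemma lift_additive g : strictly_additive (lift_cmap g).
Proof.
split=> //= [X Y|X X' Y Y' f f']; first exact: cmapo_cat.
apply: arrow_sheq; try exact: cmapo_cat.
apply: sheq_trans (sheq_sym (lift_homE _ _)) _.
rewrite /csum smapD !smap_comp !smapE.
apply: sheqD; do 2?[apply: sheq_comp]; try exact: lift_homE;
  apply: sheq_sclass.
- exact: fmap_cinl.
- exact: fmap_cprl.
- exact: fmap_cinr.
- exact: fmap_cprr.
Qed.

(** Relabelling respects [cIinj] and [cIproj], so it sends a lift of [f] to the shift to such a lift
    of its image; [cshift_homE] evaluates both sides. *)
Lemma lift_cshift_hom g X Y (f : chom k X Y) :
  sheq (lift_hom g (cshift_hom f)) (cshift_hom (lift_hom g f)).
Proof.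
have [h0 fh] := lifts_to_shift_exists (repr f).
apply: sheq_trans (sheq_sym (lift_homE _ _)) _.
rewrite -[f]sclassK (cshift_homE fh) smapE.
pose f1 := fcast (fmap_cF k g X) (fmap_cF k g Y) (fmaph g (repr f)).
pose h1 := fcast (fmap_cF_shift k g X) (fmap_cF_shift k g Y) (fmaph g h0).
have f1E : feq (fmaph g (repr f)) f1 := feq_cast _ _ _.
have h1E : feq (fmaph g h0) h1 := feq_cast _ _ _.
have -> : lift_hom g (sclass (repr f)) = sclass f1.
  apply: sheq_eq; apply: sheq_trans (sheq_sym (lift_homE _ _)) _.
  by rewrite smapE; exact: sheq_sclass.
rewrite (@cshift_homE _ _ _ _ _ h1); first exact: sheq_sclass.
have [l [e1 e2]] := fh.
pose l1 := fcast (fmap_cI k g X) (fmap_cI k g Y) (fmaph g l).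
have l1E : feq (fmaph g l) l1 := feq_cast _ _ _.
have feq_eqs A B (a b : fhom A B) A' B' (a' b' : fhom A' B') :
    feq (fmaph g a) a' -> feq (fmaph g b) b' -> a = b -> a' = b'.
  move=> [eA [eB <-]] [eA' [eB' <-]] ->.
  by rewrite (Prop_irrelevance eA' eA) (Prop_irrelevance eB' eB).
exists l1; split.
- by apply: feq_eqs e1; rewrite fmaph_comp; apply: feq_comp => //; exact: fmap_cIinj.
- by apply: feq_eqs e2; rewrite fmaph_comp; apply: feq_comp => //; exact: fmap_cIproj.
Qed.

Lemma lift_triangulated g : strictly_triangulated (lift_cmap g).
Proof.
split=> /= [X|X Y f|X Y Z u v w]; first exact: cmapo_shift.
  by apply: arrow_sheq; [exact: cmapo_shift..|exact: lift_cshift_hom].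
move=> [X' [Y' [C [u' [v' [w' [a [b [c [st ia ib ic [e1 e2 e3]]]]]]]]]]] w1 hw1.
pose u1 := fcast (fmap_cF k g X') (fmap_cF k g Y') (fmaph g u').
pose v1 := fcast (fmap_cF k g Y') erefl (fmaph g v').
pose w2 := fcast erefl (fmap_cF_shift k g X') (fmaph g w').
have u1E : feq (fmaph g u') u1 := feq_cast _ _ _.
have v1E : feq (fmaph g v') v1 := feq_cast _ _ _.
have w2E : feq (fmaph g w') w2 := feq_cast _ _ _.
pose c1 := scast (fmap_cF k g Z) erefl (smap g c).
have c1E : sheq (smap g c) c1 := sheq_cast _ _ _.
have iso A B (f : shom A B) A' B' (f' : shom A' B') : sheq (smap g f) f' ->
    is_siso f -> is_siso f'.
  by move=> h hf; apply: is_siso_sheq h _; exact: smap_siso.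
have sheq_eqs A B (a0 b0 : shom A B) A' B' (a' b' : shom A' B') :
    sheq (smap g a0) a' -> sheq (smap g b0) b' -> a0 = b0 -> a' = b'.
  move=> [eA [eB <-]] [eA' [eB' <-]] ->.
  by rewrite (Prop_irrelevance eA' eA) (Prop_irrelevance eB' eB).
have cls A B (f : fhom A B) A' B' (f' : fhom A' B') : feq (fmaph g f) f' ->
    sheq (smap g (sclass f)) (sclass f').
  by rewrite smapE; exact: sheq_sclass.
(* The relabelled data witness the image triangle; the cone may be any object of F, so [fmap g C]
   needs no cast. *)
exists (cmapo g X'), (cmapo g Y'), (fmap g C), u1, v1, w2.
exists (lift_hom g a), (lift_hom g b), c1; split.
- apply: cone_triangle_feq u1E (fmap_cIinj k g X') (fmap_cIproj k g X') v1E w2E _.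
  exact: fmap_cone_triangle.
- exact: iso (lift_homE _ _) ia.
- exact: iso (lift_homE _ _) ib.
- exact: iso c1E ic.
split.
- by apply: sheq_eqs e1; rewrite smap_comp; apply: sheq_comp;
    first [exact: lift_homE | exact: cls | exact: c1E].
- by apply: sheq_eqs e2; rewrite smap_comp; apply: sheq_comp;
    first [exact: lift_homE | exact: cls | exact: c1E].
- apply: sheq_eqs e3; rewrite smap_comp; apply: sheq_comp => //; try exact: cls.
    apply: sheq_trans (lift_homE _ _) _; exact: lift_cshift_hom.
  apply: sheq_trans (lift_homE _ _) _; exact/sheq_sym/sheq_arrow.
Qed.

Definition lift_endo g : cendo R k :=
  CEndo (And4 (lift_functor g) (@lift_linear g) (lift_additive g)
           (lift_triangulated g)).

Lemma cmap_ext (F G : cmap R k) : (forall X, F X = G X) ->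
  (forall X Y (f : chom k X Y), arrow (chom_map F f) = arrow (chom_map G f)) ->
  F = G.
Proof.
case: F G => [F mF] [G mG] /= /funext e; case: _ / e in mG * => h.
congr CMap; apply: functional_extensionality_dep => X.
apply: functional_extensionality_dep => Y.
by apply/funext => f; exact: arrow_inj.
Qed.

Lemma cmapo_comp g h X : cmapo (homeo_comp g h) X = cmapo g (cmapo h X).
Proof.
by rewrite /cmapo -map_comp; apply: eq_map => e; exact: homeo_indec_comp.
Qed.

Lemma cmapo1 X : cmapo (homeo1 R) X = X.
Proof. by rewrite /cmapo -[RHS]map_id; apply: eq_map => e; exact: homeo_indec1. Qed.

(** Matrices are untouched and labels compose, so the equality is strict, as a group homomorphism
    requires. *)
Lemma lift_endo_comp g h :
  lift_endo (homeo_comp g h) = cendo_comp (lift_endo g) (lift_endo h).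
Proof.
apply/cendo_inj/cmap_ext => [X|X Y f] /=; first exact: cmapo_comp.
apply: arrow_sheq; try exact: cmapo_comp.
apply: sheq_trans (sheq_sym (lift_homE _ _)) _.
apply: sheq_trans (lift_homE _ _).
apply: sheq_trans (sheq_smap _ (lift_homE _ _)).
rewrite -[f]sclassK !smapE; apply: sheq_sclass; move: (repr f).
move: (cF k X) (cF k Y) => [[T p] a ha] [[U q] b hb] [m hm].
exact: feq_mx.
Qed.

Lemma lift_endo1 : lift_endo (homeo1 R) = cendo1 R k.
Proof.
apply/cendo_inj/cmap_ext => [X|X Y f] /=; first exact: cmapo1.
apply: arrow_sheq; try exact: cmapo1.
apply: sheq_trans (sheq_sym (lift_homE _ _)) _.
rewrite -[f]sclassK smapE; apply: sheq_sclass; move: (repr f).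
move: (cF k X) (cF k Y) => [[T p] a ha] [[U q] b hb] [m hm].
exact: feq_mx.
Qed.

Lemma lift_caut_subproof g : exists G : cendo R k,
  cendo_comp (lift_endo g) G = cendo1 R k /\
  cendo_comp G (lift_endo g) = cendo1 R k.
Proof.
exists (lift_endo (homeo_inv g)); rewrite -!lift_endo_comp.
by rewrite -lift_endo1 homeo_compVl homeo_compVr.
Qed.
Definition lift_caut g : caut R k := CAut (lift_caut_subproof g).

Lemma lift_caut_comp g h :
  lift_caut (homeo_comp g h) = caut_comp (lift_caut g) (lift_caut h).
Proof. by apply: caut_inj; exact: lift_endo_comp. Qed.

Lemma vertex_map_lift g : vertex_map (lift_caut g) = g.
Proof. by apply/vertex_map_unique => e; exact: ciso_refl. Qed.

HB.instance Definition _ := isMultiplicative.Build (caut R k) (homeo R)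
  (@vertex_map R k) (@vertex_map_comp R k).
HB.instance Definition _ := isMultiplicative.Build (homeo R) (caut R k)
  lift_caut lift_caut_comp.

End Lift.

Local Open Scope group_scope.

Theorem corollary4p1p3 (R : realType) (k : fieldType) :
  exists p : {multiplicative caut R k -> homeo R},
    [/\ forall (F : caut R k) (f : homeo R),
          p F = f <->
          forall e : indec R, ciso k (F [:: e]) [:: homeo_indec f e],
        exists s : {multiplicative homeo R -> caut R k},
          forall f : homeo R, p (s f) = f &
        forall F : caut R k,
          p F = 1 <-> forall X : cobj R, ciso k (F X) X].
Proof.
exists (@vertex_map R k : {multiplicative caut R k -> homeo R}); split.
- exact: vertex_map_unique.
- exists (@lift_caut R k : {multiplicative homeo R -> caut R k}).
  exact: vertex_map_lift.
- exact: vertex_map_ker.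
Qed.
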